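(* The trim strong triangular array representation $(R^*_{n,i}\mid n\ge1,\ 1\le i\le n)$ of $\{S^*_n\}$ corresponding to the sequence $\{F_n\}$ of admissible permutations encoded by $F$ is P-TIME relative to $\tau^O_1$. That is, the function which to $(n,i,\ell)$ with $n\ge 1$, $1\le i\le n$, $0\le\ell<2^{n(M+1)}$ assigns the index $s\in\{1,\ldots,m\}$ such that $R^*_{n,i}$ has constant value $o_s$ on $D_{n,\ell}$ is P-TIME relative to $\tau^O_1$.
   Context: Work in the probability space $(0,1)$ with Lebesgue measure. For $x\in(0,1)$ write $x=\sum_{i\ge1}\varepsilon_i(x)2^{-i}$ with $\varepsilon_i(x)\in\{0,1\}$ and $\varepsilon_i(x)=0$ for infinitely many $i$. Fix an integer $M\ge 0$, put $m=2^{M+1}$, and fix a random variable $O:(0,1)\to\mathbb{R}$ such that $O(x)$ depends bijectively on $(\varepsilon_1(x),\ldots,\varepsilon_{M+1}(x))$. Its $m$ distinct outcomes are enumerated increasingly as $o_1<\cdots<o_m$; they are equally likely, $\sum_s o_s=0$, and $O$ has variance $1$, i.e. $\sum_s o_s^2=m$. Let $\varsigma_s\in\{0,1\}^{M+1}$ be such that $O(x)=o_s$ iff $(\varepsilon_1(x),\ldots,\varepsilon_{M+1}(x))=\varsigma_s$. Arrange the positive integers consecutively, in increasing order, in rows indexed by $\rho=1,2,\ldots$, where row $\rho$ has length $b$, the unique positive integer with $(b-1)(M+1)<\rho\le b(M+1)$. Let $J_i$ be the $i$-th column (the set of $i$-th entries of all rows of length $\ge i$), enumerated increasingly as $j_{i,1}<j_{i,2}<\cdots$;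 let $\overline J_i=\{j_{i,1},\ldots,j_{i,M+1}\}$ and $\overline J^n=\overline J_1\cup\cdots\cup\overline J_n$. Let $P_i(x)$ be the number with $\varepsilon_k(P_i(x))=\varepsilon_{j_{i,k}}(x)$ for all $k$, and $R_i(x)=O(P_i(x))$; that is, for every $x\in(0,1)$, $R_i(x)=o_s$ iff $(\varepsilon_{j_{i,1}}(x),\ldots,\varepsilon_{j_{i,M+1}}(x))=\varsigma_s$. Put $S_n=\sum_{i=1}^n R_i$. The quantile $S^*_n$ of $S_n$ is $S^*_n(x)=\inf\{t\in\mathbb{R}\mid C(t)>x\}$ for $x\in(0,1)$, where $C$ is the cumulative distribution function of $S_n$. For $0\le\ell<2^{n(M+1)}$: $D_{n,0}=(0,2^{-n(M+1)})$ and $D_{n,\ell}=[\ell 2^{-n(M+1)},(\ell+1)2^{-n(M+1)})$ for $\ell>0$. Let $(\vec e_\ell\mid 0\le\ell<2^{n(M+1)})$ be the lexicographically increasing enumeration of $\{0,1\}^{\overline J^n}$ (coordinates $\overline J^n$ taken in increasing order), and $E_{n,\ell}=\{x\in(0,1)\mid \varepsilon_j(x)=(\vec e_\ell)_j\text{ for all }j\in\overline J^n\}$. $S^*_n$ is constant on each $D_{n,\ell}$; $R_1,\ldots,R_n$ and $S_n$ are constant on each $E_{n,\ell}$. A permutation $\pi$ of $\{0,\ldots,2^{n(M+1)}-1\}$ is admissible iff for all $0\le\ell<2^{n(M+1)}$: $S^*_n(x)=S_n(y)$ for all $x\in D_{n,\ell}$ and all $y\in E_{n,\pi(\ell)}$.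 A sequence $(\pi_n)$ of admissible permutations corresponds to the trim strong triangular array representation of $\{S^*_n\}$ given by: for $x\in D_{n,\ell}$, $R^*_{n,i}(x)=R_i(y)$ for any $y\in E_{n,\pi_n(\ell)}$. $\mathbf{K}_n$ is the set of $\vec k=(k_1,\ldots,k_m)$ of non-negative integers with sum $n$; $\binom{n}{\vec k}=\frac{n!}{k_1!\cdots k_m!}$; $\vec k\cdot\vec o=k_1o_1+\cdots+k_mo_m$. Let $(v_n^t\mid 0\le t\le T_n)$ be the increasing enumeration of the set of values $\{\vec k\cdot\vec o\mid\vec k\in\mathbf{K}_n\}$ (the values of $S_n$). $\mathrm{SMC}^O(n,t)=\sum\binom{n}{\vec k}$, the sum over $\vec k\in\mathbf{K}_n$ with $\vec k\cdot\vec o<v_n^t$. $\mathrm{IStep}(n,\ell)$ is the unique $t$ such that $S^*_n$ has constant value $v_n^t$ on $D_{n,\ell}$. $\mathrm{I}B_{n,t}$ is the set of $\ell<2^{n(M+1)}$ such that $S_n$ has constant value $v_n^t$ on $E_{n,\ell}$, and $(b_{n,t,s}\mid 1\le s\le|\mathrm{I}B_{n,t}|)$ is its increasing enumeration. $F_n$ is the (admissible) permutation of $\{0,\ldots,2^{n(M+1)}-1\}$ given by $F_n(\ell)=b_{n,t,s}$, where $t=\mathrm{IStep}(n,\ell)$ and $s=1+\ell-\mathrm{SMC}^O(n,t)$ (so $\ell$ is the $s$-th element of $\{\ell'\mid\mathrm{IStep}(n,\ell')=t\}$); $F(n,\ell)=F_n(\ell)$. $\tau^O_1$ is the $\{0,1\}$-valued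 function on tuples $(n,k_1,\ldots,k_m,t)$ with $n>0$, $0\le t\le T_n$, $\vec k\in\mathbf{K}_n$, with $\tau^O_1(n,\vec k,t)=1$ iff $\vec k\cdot\vec o=v_n^t$ (as an oracle it answers $0$ outside this domain). A function is P-TIME relative to $\tau^O_1$ if it is computed by a Turing machine with oracle $\tau^O_1$ in time polynomial in $n$ (the first argument), integer arguments being given in binary; $M$ (hence $m$) and $O$ are fixed. *)

(* Defs.v *)
(* MathComp-Analysis. *)
From HB Require Import structures.
From mathcomp Require Export all_boot all_order all_algebra.
From mathcomp Require Export all_classical all_reals all_analysis.

Set Implicit Arguments.
Unset Strict Implicit.
Unset Printing Implicit Defensive.

Import Order.TTheory GRing.Theory Num.Theory.
Import numFieldNormedType.Exports.

Local Open Scope classical_set_scope.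
Local Open Scope ring_scope.

(** ** Oracle Turing machines *)

(* [Some b] is the binary digit [b], [None] is the separator. *)
Definition letter : finType := option bool.
Definition word := seq letter.

(* Tape symbols over an auxiliary finite alphabet [X]; [None] is the blank. *)
Definition symbol (X : finType) : finType := option (letter + X)%type.

Inductive direction := MoveLeft | Stay | MoveRight.

(* A tape is infinite in both directions: [lft] lists the symbols to the left of
   the head, nearest first, [rgt] those to its right, nearest first, and all
   cells beyond these lists are blank. *)
Record tape (X : finType) := Tape {
  lft : seq (symbol X);
  cur : symbol X;
  rgt : seq (symbol X) }.

Definition tape_of_word (X : finType) (w : word) : tape X :=
  let s := [seq Some (inl a) | a <- w] in Tape [::] (head None s) (behead s).

Fixpoint leading_word (X : finType) (s : seq (symbol X)) : word :=
  if s is Some (inl a) :: s' then a :: leading_word s' else [::].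

(* The word on a tape starts at the head and extends to the right up to the
   first symbol which is not a letter. *)
Definition word_of_tape (X : finType) (tp : tape X) : word :=
  leading_word (cur tp :: rgt tp).

Definition write_move (X : finType) (tp : tape X) (a : symbol X * direction) :
    tape X :=
  match a.2 with
  | MoveLeft => Tape (behead (lft tp)) (head None (lft tp)) (a.1 :: rgt tp)
  | Stay => Tape (lft tp) a.1 (rgt tp)
  | MoveRight => Tape (a.1 :: lft tp) (head None (rgt tp)) (behead (rgt tp))
  end.

(* What the machine does in a given state: halt; query the oracle, the next state
   depending on the answer only; or read the scanned symbols and accordingly
   change state, write on all tapes and move all heads. *)
Inductive instruction (Q X I : finType) :=
  | Halt
  | Query of Q & Q
  | Act of ({ffun I -> symbol X} -> Q * (I -> symbol X * direction)).

Record oracle_machine := OracleMachine {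
  state : finType;
  aux : finType;
  tape_index : finType;
  input_tape : tape_index;
  query_tape : tape_index;
  output_tape : tape_index;
  initial : state;
  program : state -> instruction state aux tape_index }.

Record config (Z : oracle_machine) := Config {
  cstate : state Z;
  ctape : tape_index Z -> tape (aux Z) }.

Definition initial_config (Z : oracle_machine) (w : word) : config Z :=
  Config (initial Z)
    (fun i => tape_of_word (aux Z) (if i == input_tape Z then w else [::])).

(* A query costs one step, as does every other instruction; a configuration in
   a halting state is not changed. *)
Definition step (A : word -> bool) (Z : oracle_machine) (c : config Z) :
    config Z :=
  match program (cstate c) with
  | Halt => c
  | Query yes no =>
      Config (if A (word_of_tape (ctape c (query_tape Z))) then yes else no)
             (ctape c)
  | Act d =>
      let r := d [ffun i => cur (ctape c i)] in
      Config r.1 (fun i => write_move (ctape c i) (r.2 i))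
  end.

Definition halted (Z : oracle_machine) (c : config Z) : bool :=
  if program (cstate c) is Halt then true else false.

Definition outputs_within (A : word -> bool) (Z : oracle_machine)
    (w : word) (N : nat) (u : word) : Prop :=
  let c := iter N (step A (Z := Z)) (initial_config Z w) in
  halted c /\ word_of_tape (ctape c (output_tape Z)) = u.

(* Binary notation, most significant digit first; zero is written [0]. *)
Definition binary (a : nat) : word :=
  [seq Some (odd (a %/ 2 ^ i)%N) | i <- rev (iota 0 (trunc_log 2 a).+1)].

(* Each entry of a tuple of integers is followed by a separator. *)
Definition encode (s : seq nat) : word := flatten [seq rcons (binary a) None | a <- s].

(* A set of tuples of integers as an oracle; words not encoding a tuple in the
   set are answered negatively. *)
Definition oracle (A : set (seq nat)) (w : word) : bool :=
  `[< exists2 s, A s & w = encode s >].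

(* Time is measured as a function of the first argument. *)
Definition ptime_relative (A dom : set (seq nat)) (f : seq nat -> nat) : Prop :=
  exists (Z : oracle_machine) (p : {poly nat}), forall s, dom s ->
    outputs_within (oracle A) Z (encode s) p.[head 0%N s] (binary (f s)).

(** ** Binary expansions *)

(* Digits are indexed by the positive integers; [e 0] is irrelevant. *)
Definition binary_expansion (R : realType) (x : R) (e : nat -> bool) : Prop :=
  (fun N => \sum_(1 <= i < N.+1) (e i)%:R * 2^-1 ^+ i : R) @ \oo --> x /\
  (forall N, exists2 i, (N < i)%N & e i = false).

Definition eps (R : realType) (x : R) : nat -> bool :=
  xget (fun=> false) [set e | binary_expansion x e].

(** ** The rows and columns of the positive integers *)

Definition rowlen (M r : nat) : nat := (r.-1 %/ M.+1).+1.

Lemma rowlenP (M r : nat) : (0 < r)%N ->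
  ((rowlen M r).-1 * M.+1 < r <= rowlen M r * M.+1)%N.
Proof.
case: r => // r _; rewrite /rowlen /= ltnS leq_divM /=.
by rewrite ltn_ceil.
Qed.

Definition entry (M r i : nat) : nat := (\sum_(1 <= q < r) rowlen M q + i)%N.

Definition column (M i : nat) : set nat :=
  [set entry M r i | r in [set r | (0 < r)%N /\ (i <= rowlen M r)%N]].

(* The rows of length at least [i] are those after row [(i - 1) (M + 1)]. *)
Definition jcol (M i k : nat) : nat := entry M (i.-1 * M.+1 + k) i.

Lemma column_jcol (M i : nat) : (0 < i)%N ->
  column M i = [set jcol M i k | k in [set k | (0 < k)%N]].
Proof.
case: i => // i _; rewrite /column /jcol /rowlen /=; apply/seteqP; split.
- move=> _ [r [r0 ir] <-]; exists (r - i * M.+1)%N => /=.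
    rewrite subn_gt0; case: r r0 ir => // r _ /=; rewrite ltnS leq_divRL //.
  rewrite subnKC //; case: r r0 ir => // r _ /=.
  by rewrite ltnS leq_divRL // => /leqW.
- move=> _ [[//|k] _ <-]; exists (i * M.+1 + k.+1)%N => //; split; rewrite addnS //=.
  by rewrite divnMDl // ltnS leq_addr.
Qed.

Lemma jcol_lt (M i k : nat) : (0 < k)%N -> (jcol M i k < jcol M i k.+1)%N.
Proof.
move=> k0; rewrite /jcol /entry addnS ltn_add2r big_nat_recr /=.
  by rewrite -[X in (X < _)%N]addn0 ltn_add2l.
by rewrite (leq_trans k0) // leq_addl.
Qed.

Definition nbits (M n : nat) : nat := (n * M.+1)%N.

(* The elements of the first [M + 1] rows of columns [1], ..., [n], increasing. *)
Definition Jbar (M n : nat) : seq nat :=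
  sort leq [seq jcol M i k | i <- iota 1 n, k <- iota 1 M.+1].

(* Position [p] of a bit vector is the coordinate indexed by [nth 0 (Jbar M n) p]. *)
Definition lexvec (M n l : nat) : seq bool :=
  nth [::] [seq tval w | w <- Order.enum [set: (nbits M n).-tuplelexi bool]%SET] l.

(** ** The random variables *)

Definition nout (M : nat) : nat := (2 ^ M.+1)%N.

(* Random variables are functions on [R] of which only the restrictions to
   [(0,1)] matter.  Outcomes are indexed from [0]. *)
Record outcomes (R : realType) (M : nat) (O : R -> R)
    (o : 'I_(nout M) -> R) (vsig : 'I_(nout M) -> M.+1.-tuple bool) : Prop := {
  outcomes_increasing : forall s t : 'I_(nout M), (s < t)%N -> o s < o t;
  outcomes_mean : \sum_s o s = 0;
  outcomes_variance : \sum_s o s ^+ 2 = (nout M)%:R;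
  vsig_bijective : bijective vsig;
  outcomesP : forall x s, 0 < x < 1 ->
    O x = o s <-> [tuple eps x k.+1 | k < M.+1] = vsig s }.

Section Representation.
Context {R : realType} (M : nat) (O : R -> R) (o : 'I_(nout M) -> R).
Implicit Types (n i l t : nat) (x y : R).

(* Only digits [1], ..., [M + 1] are prescribed, on which alone [O] depends: when
   the digits of [x] in column [i] are eventually [1], or all [0], no number in
   [(0,1)] has exactly these digits. *)
Definition Pcol i x : R :=
  xget 0 [set y | 0 < y < 1 /\
    forall k, (1 <= k <= M.+1)%N -> eps y k = eps x (jcol M i k)].

Definition Rcol i x : R := O (Pcol i x).

Definition Ssum n x : R := \sum_(1 <= i < n.+1) Rcol i x.

Definition cdfS n (r : R) : R :=
  fine (lebesgue_measure [set x : R | 0 < x < 1 /\ Ssum n x <= r]).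

Definition Sstar n x : R := inf [set r | x < cdfS n r].

Definition cellD n l : set R :=
  let u : R := 2^-1 ^+ nbits M n in
  if l == 0%N then [set` `]0, u[] else [set` `[l%:R * u, l.+1%:R * u[].

Definition cellE n l : set R :=
  [set x | 0 < x < 1 /\ forall j, j \in Jbar M n ->
    eps x j = nth false (lexvec M n l) (index j (Jbar M n))].

Definition admissible n (pi : nat -> nat) : Prop :=
  set_bij `I_(2 ^ nbits M n) `I_(2 ^ nbits M n) pi /\
  forall l, (l < 2 ^ nbits M n)%N ->
    forall x y, cellD n l x -> cellE n (pi l) y -> Sstar n x = Ssum n y.

(* [Rs] is the array given by the sequence [pi] of admissible permutations. *)
Definition corresponds (pi : nat -> nat -> nat) (Rs : nat -> nat -> R -> R) : Prop :=
  forall n, (0 < n)%N -> admissible n (pi n) /\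
    forall i l, (1 <= i <= n)%N -> (l < 2 ^ nbits M n)%N ->
    forall x y, cellD n l x -> cellE n (pi n l) y -> Rs n i x = Rcol i y.

Definition Kset n : {set {ffun 'I_(nout M) -> 'I_n.+1}} :=
  [set k : {ffun 'I_(nout M) -> 'I_n.+1} | (\sum_s k s == n)%N]%SET.

Definition multinom n (k : {ffun 'I_(nout M) -> 'I_n.+1}) : nat :=
  (n`! %/ \prod_s (k s)`!)%N.

Definition dotp n (k : {ffun 'I_(nout M) -> 'I_n.+1}) : R :=
  \sum_s (k s)%:R * o s.

Definition values n : seq R :=
  sort <=%R (undup [seq dotp k | k <- enum (Kset n)]).

Definition Svalue n t : R := nth 0 (values n) t.

Definition Tmax n : nat := (size (values n)).-1.

Definition SMC n t : nat :=
  (\sum_(k in Kset n | (dotp k < Svalue n t)%R) multinom k)%N.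

Definition IStep n l : nat :=
  xget 0%N [set t | (t <= Tmax n)%N /\ forall x, cellD n l x -> Sstar n x = Svalue n t].

Definition IB n t : seq nat :=
  [seq l <- iota 0 (2 ^ nbits M n) | `[< forall x, cellE n l x -> Ssum n x = Svalue n t >]].

Definition Fperm n l : nat :=
  let t := IStep n l in
  let s := (1 + l - SMC n t)%N in
  nth 0%N (IB n t) s.-1.

(* The set of tuples [(n, k_1, ..., k_m, t)] where the oracle function is [1]. *)
Definition tau1 : set (seq nat) :=
  [set a | exists n t (k : {ffun 'I_(nout M) -> 'I_n.+1}),
    [/\ a = n :: [seq (k s : nat) | s <- enum 'I_(nout M)] ++ [:: t],
        (0 < n)%N, (t <= Tmax n)%N, k \in Kset n & dotp k = Svalue n t]].

Definition array_args : set (seq nat) :=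
  [set a | exists n i l,
    [/\ a = [:: n; i; l], (1 <= n)%N, (1 <= i <= n)%N & (l < 2 ^ nbits M n)%N]].

(* [f] is the function assigning to [(n, i, l)] the (one-based) index of the value
   of [Rs n i] on the [l]-th dyadic interval. *)
Definition index_function (Rs : nat -> nat -> R -> R) (f : seq nat -> nat) : Prop :=
  forall n i l, array_args [:: n; i; l] ->
  exists2 s : 'I_(nout M), f [:: n; i; l] = s.+1 &
    forall x, cellD n l x -> Rs n i x = o s.

Definition ptime_array (A : set (seq nat)) (Rs : nat -> nat -> R -> R) : Prop :=
  exists2 f, index_function Rs f & ptime_relative A array_args f.

End Representation.

(* Main.v *)
Require Import Defs.
From mathcomp Require Import zify ring lra.

Set Implicit Arguments.
Unset Strict Implicit.
Unset Printing Implicit Defensive.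

(** A word of length [n] over the [m = 2 ^ (M + 1)] outcomes is coded by a number
    [l < m ^ n], the letters being its base [m] digits, the most significant one
    first.  The first [M + 1] entries of column [i] are the
    last entries of the rows of length [i], so that, in increasing order, the
    coordinates come column by column ([jcol_row_end], [JbarE]).  Therefore the
    [l]-th bit vector in lexicographic order is the binary expansion of [l]
    ([lexvecE]), and on the cell [E_l] the variable [R_i] takes the outcome coded
    by the [i]-th base [m] digit of [l] ([cellE_Rcol]).

    The cells [E_l] all consist of equally many dyadic intervals of the same length,
    so the distribution function counts words ([cdfSE]), and the quantile takes on
    [D_l] the [l]-th entry of the sorted list of the sums of the [m ^ n] words
    ([SstarE]).  If this value is [v_t], the number of words with a smaller sum is
    at most [l], and the permutation sends [l] to the word [b] of sum [v_t] which
    is preceded by exactly [l - SMC n t] words of the same sum ([FpermP]).  This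
    shows that the permutation is admissible ([Fperm_admissible]), and describes
    [b] by counting only.

    These counts are computable in polynomial time although there are
    exponentially many words.  The words with a given prefix and the sum [v_t] are
    classified by how often each letter occurs; there are at most [(n + 1) ^ m]
    vectors of letter counts, the oracle says which of them have the dot product
    [v_t], and the number of completions with given counts is a multinomial
    coefficient, which is a product of binomial coefficients ([blockE]).  Summing
    over [t' < t] gives [SMC] and so [t] ([find_rankE]); summing over the first
    position at which a word differs from [b] gives the number of words of sum
    [v_t] below [b] ([count_belowE]), a monotone function of [b], so [b] is found
    by binary search ([find_wordE]).

    That this is polynomial time on a Turing machine is shown once for all
    programs of a small functional language with bounded loops over the
    operations addition, truncated subtraction, comparison and oracle query.  A
    program becomes a register machine ([compile_correct]), and the registers are
    the tracks of a single tape, so that every instruction is a sweep over this tape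
    and back, or over the query ([run_instr]).  An instruction lengthens the numbers by at most one
    digit, hence counting instructions is enough: a number of instructions
    polynomial in [n] takes polynomially many steps ([definable_ptime]). *)

(** * Register machines and their sweeps over a tape *)

(** [IEmit] appends a number in binary to the query tape, [IAsk] asks the query
    written there and clears it, [IGet] branches on the next input letter.  All
    jumps are absolute. *)
Inductive instr :=
  | ISet of nat & bool
  | IAdd of nat & nat & nat
  | ISub of nat & nat & nat
  | ILt of nat & nat & nat & nat
  | IEmit of nat & bool
  | IAsk of nat & nat
  | IGet of nat & nat & nat
  | IStop.

Record astate := AState {
  apc : nat; aenv : nat -> nat; aquery : word; ainput : word }.

Definition upd (e : nat -> nat) (d v : nat) : nat -> nat :=
  fun x => if x == d then v else e x.

Definition astep (A : word -> bool) (code : seq instr) (s : astate) : astate :=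
  let: AState pc e q w := s in
  match nth IStop code pc with
  | ISet d b => AState pc.+1 (upd e d b) q w
  | IAdd d x y => AState pc.+1 (upd e d (e x + e y)) q w
  | ISub d x y => AState pc.+1 (upd e d (e x - e y)) q w
  | ILt x y yes no => AState (if e x < e y then yes else no) e q w
  | IEmit x sep =>
      AState pc.+1 e (q ++ binary (e x) ++ nseq sep None) w
  | IAsk yes no => AState (if A q then yes else no) e [::] w
  | IGet l0 l1 lsep =>
      AState (if head None w is Some b then if b then l1 else l0 else lsep)
        e q (behead w)
  | IStop => s
  end.

Definition instr_max (i : instr) : nat :=
  match i with
  | ISet d _ => d
  | IAdd d x y => maxn d (maxn x y)
  | ISub d x y => maxn d (maxn x y)
  | ILt x y l1 l2 => maxn (maxn x y) (maxn l1 l2)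
  | IEmit x _ => x
  | IAsk l1 l2 => maxn l1 l2
  | IGet l0 l1 l2 => maxn l0 (maxn l1 l2)
  | IStop => 0
  end.

(** A common bound for registers and addresses, so that both are ordinals below
    its successor. *)
Definition code_max (code : seq instr) : nat :=
  size code + \sum_(i <- code) instr_max i.

Lemma instr_max_le code pc : instr_max (nth IStop code pc) <= code_max code.
Proof.
have [lt|ge] := ltnP pc (size code); last by rewrite nth_default.
rewrite /code_max (big_nth IStop) big_mkord (bigD1 (Ordinal lt)) //=; lia.
Qed.

(** ** Least significant bit first *)

Definition bitval (bs : seq bool) : nat := foldr (fun (b : bool) v => b + v.*2) 0 bs.

Section Columns.
Variable B : nat.

(** A symbol of the work tape holds one bit of every register. *)
Definition column_type : finType := {ffun 'I_B.+1 -> bool}.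
Implicit Types (c : column_type) (cs : seq column_type).

Definition col_set c d b : column_type :=
  [ffun i => if i == inord d then b else c i].

Definition track (x : nat) cs : seq bool := [seq c (inord x) | c <- cs].

Definition blank_col : column_type := [ffun=> false].

(** The transition of the finite transducer that reads the columns, least
    significant first.  Its bit of memory is the carry of [IAdd], the borrow of
    [ISub], the comparison of the parts read by [ILt], and for [ISet] whether the
    lowest digit has been written. *)
Definition delta (i : instr) (s : bool) c : bool * column_type :=
  match i with
  | ISet d b => (true, col_set c d (~~ s && b))
  | IAdd d x y =>
      let a := c (inord x) in let b := c (inord y) in
      (if a (+) b then s else b, col_set c d (a (+) b (+) s))
  | ISub d x y =>
      let a := c (inord x) in let b := c (inord y) in
      (if a (+) b then b else s, col_set c d (a (+) b (+) s))
  | ILt x y _ _ =>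
      let a := c (inord x) in let b := c (inord y) in
      (if a (+) b then b else s, c)
  | _ => (s, c)
  end.

(** On the way back: a final borrow means that the subtraction is truncated. *)
Definition fixup (i : instr) (s : bool) c : column_type :=
  if i is ISub d _ _ then if s then col_set c d false else c else c.

Fixpoint transduce (i : instr) (s : bool) cs : bool * seq column_type :=
  if cs is c :: cs' then
    let r := delta i s c in
    let r' := transduce i r.1 cs' in (r'.1, r.2 :: r'.2)
  else (s, [::]).

(** The additional column receives the last carry, so no operation overflows. *)
Definition sweep (i : instr) cs : bool * seq column_type :=
  let r := transduce i false (rcons cs blank_col) in
  (r.1, [seq fixup i r.1 c | c <- r.2]).

Lemma size_transduce i s cs : size (transduce i s cs).2 = size cs.
Proof. by elim: cs s => //= c cs IH s; rewrite IH. Qed.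

Lemma size_sweep i cs : size (sweep i cs).2 = (size cs).+1.
Proof. by rewrite size_map size_transduce size_rcons. Qed.

Lemma inord_eq x y : x <= B -> y <= B -> (inord x == inord y :> 'I_B.+1) = (x == y).
Proof. by move=> xB yB; rewrite -val_eqE /= !inordK. Qed.

Lemma col_setE c d b x : x <= B -> d <= B ->
  col_set c d b (inord x) = if x == d then b else c (inord x).
Proof. by move=> xB dB; rewrite ffunE inord_eq. Qed.

Lemma bitval_rcons bs b : bitval (rcons bs b) = bitval bs + b * 2 ^ size bs.
Proof.
elim: bs => [|a bs IH] /=; first by rewrite expn0; lia.
rewrite IH expnS; lia.
Qed.

Lemma bitval_blank x cs : bitval (track x (rcons cs blank_col)) = bitval (track x cs).
Proof. by rewrite /track map_rcons bitval_rcons ffunE mul0n addn0. Qed.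

Definition instr_target (i : instr) : option nat :=
  match i with
  | ISet d _ | IAdd d _ _ | ISub d _ _ => Some d
  | _ => None
  end.

Lemma delta_frame i s c x : instr_max i <= B -> x <= B -> instr_target i != Some x ->
  (delta i s c).2 (inord x) = c (inord x).
Proof.
case: i => //= [d b|d y z|d y z] iB xB; rewrite (inj_eq (@Some_inj _)) => dx;
  rewrite col_setE //; try lia; by rewrite eq_sym (negbTE dx).
Qed.

Lemma fixup_frame i s c x : instr_max i <= B -> x <= B -> instr_target i != Some x ->
  fixup i s c (inord x) = c (inord x).
Proof.
case: i => //= d y z iB xB; rewrite (inj_eq (@Some_inj _)) => dx.
case: s => //; rewrite col_setE //; try lia; by rewrite eq_sym (negbTE dx).
Qed.

Lemma transduce_frame i s cs x : instr_max i <= B -> x <= B ->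
  instr_target i != Some x -> track x (transduce i s cs).2 = track x cs.
Proof.
move=> iB xB ix; elim: cs s => //= c cs IH s.
by rewrite IH delta_frame.
Qed.

Lemma sweep_frame i cs x : instr_max i <= B -> x <= B ->
  instr_target i != Some x -> bitval (track x (sweep i cs).2) = bitval (track x cs).
Proof.
move=> iB xB ix; rewrite -(bitval_blank x cs).
rewrite -[in RHS](@transduce_frame i false (rcons cs blank_col) x) //.
congr bitval; rewrite /track /= -map_comp; apply: eq_map => c /=.
by rewrite fixup_frame.
Qed.

Lemma transduce_lt x y l1 l2 s cs :
  (transduce (ILt x y l1 l2) s cs).1 =
  (bitval (track x cs) < bitval (track y cs) + s).
Proof.
elim: cs s => [|c cs IH] s /=; first by case: s.
rewrite IH; move: (bitval _) (bitval _) => u v.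
by case: (c _) (c _) s => [] [] []; rewrite /=; lia.
Qed.

Lemma sweep_lt x y l1 l2 cs :
  (sweep (ILt x y l1 l2) cs).1 = (bitval (track x cs) < bitval (track y cs)).
Proof. by rewrite /sweep transduce_lt !bitval_blank addn0. Qed.

Lemma sweep_set d b cs : d <= B -> bitval (track d (sweep (ISet d b) cs).2) = b.
Proof.
move=> dB; rewrite /sweep /= /track -!map_comp.
have E s cs' : bitval [seq (fixup (ISet d b) true c) (inord d) |
    c <- (transduce (ISet d b) s cs').2] = if cs' is [::] then 0 else ~~ s && b.
  elim: cs' s => //= c cs' IH s; rewrite IH col_setE // eqxx.
  by case: cs' {IH} => [|? ?]; rewrite ?addn0.
rewrite (E false); by case: cs.
Qed.

Lemma transduce_add d x y s cs : d <= B -> x <= B -> y <= B ->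
  let r := transduce (IAdd d x y) s cs in
  bitval (track d r.2) + r.1 * 2 ^ size cs = bitval (track x cs) + bitval (track y cs) + s.
Proof.
move=> dB xB yB; elim: cs s => [|c cs IH] s /=; first by rewrite expn0 muln1.
move/(_ (if c (inord x) (+) c (inord y) then s else c (inord y))): IH => /=.
rewrite col_setE // eqxx expnS; move: (_.1 : bool) => t.
move: (bitval (track d _)) (bitval (track x _)) (bitval (track y _)) (2 ^ _) => u v w z.
by case: (c _) (c _) s t => [] [] [] [] /=; lia.
Qed.

Lemma bitval_lt bs : bitval bs < 2 ^ size bs.
Proof. by elim: bs => //= b bs IH; rewrite expnS; case: b; lia. Qed.

Lemma size_track x cs : size (track x cs) = size cs. Proof. exact: size_map. Qed.

Lemma sweep_add d x y cs : d <= B -> x <= B -> y <= B ->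
  bitval (track d (sweep (IAdd d x y) cs).2) = bitval (track x cs) + bitval (track y cs).
Proof.
move=> dB xB yB; have := @transduce_add d x y false (rcons cs blank_col) dB xB yB.
rewrite /= !bitval_blank addn0 size_rcons expnS /sweep /= map_id.
have := bitval_lt (track x cs); have := bitval_lt (track y cs).
rewrite !size_track; case: (_.1 : bool) => /=; lia.
Qed.

Lemma transduce_sub d x y s cs : d <= B -> x <= B -> y <= B ->
  let r := transduce (ISub d x y) s cs in
  r.1 = (bitval (track x cs) < bitval (track y cs) + s) /\
  bitval (track d r.2) + bitval (track y cs) + s =
    bitval (track x cs) + r.1 * 2 ^ size cs.
Proof.
move=> dB xB yB; elim: cs s => [|c cs IH] s /=; first by rewrite expn0 muln1; case: s.
move/(_ (if c (inord x) (+) c (inord y) then c (inord y) else s)): IH => /=.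
rewrite col_setE // eqxx expnS; move: (_.1 : bool) => t.
move: (bitval (track d _)) (bitval (track x _)) (bitval (track y _)) (2 ^ _) => u v w z.
by case: (c _) (c _) s t => [] [] [] [] /= [-> E]; split => //; lia.
Qed.

Lemma sweep_sub d x y cs : d <= B -> x <= B -> y <= B ->
  bitval (track d (sweep (ISub d x y) cs).2) = bitval (track x cs) - bitval (track y cs).
Proof.
move=> dB xB yB; have := @transduce_sub d x y false (rcons cs blank_col) dB xB yB.
rewrite /= !bitval_blank !addn0 /sweep => -[]; set r := transduce _ _ _ => E1 E2 /=.
case: r.1 E1 E2 => E1 E2; last by rewrite map_id; lia.
have -> : bitval (track d [seq col_set c d false | c <- r.2]) = 0; last by lia.
rewrite /track -map_comp; elim: {E2} r.2 => //= c cs' ->.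
by rewrite col_setE // eqxx.
Qed.

End Columns.

(** ** Binary notation *)

Definition digits2 (a : nat) : seq bool :=
  [seq odd (a %/ 2 ^ i) | i <- rev (iota 0 (trunc_log 2 a).+1)].

Lemma binaryE a : binary a = [seq Some b | b <- digits2 a].
Proof. by rewrite /binary -map_comp. Qed.

Lemma digits2_double (b : bool) a : 0 < a -> digits2 (b + a.*2) = rcons (digits2 a) b.
Proof.
move=> a0; rewrite /digits2.
have -> : trunc_log 2 (b + a.*2) = (trunc_log 2 a).+1.
  apply/eqP; rewrite eqn_leq; apply/andP; split; last first.
    by rewrite trunc_log_max // expnS; have := trunc_logP (isT : 1 < 2) a0; lia.
  rewrite -ltnS -(@ltn_exp2l 2) //.
  have := @trunc_log_ltn 2 a isT; have := @trunc_logP 2 (b + a.*2) isT; rewrite !expnS; lia.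
have -> : iota 0 (trunc_log 2 a).+2 = 0 :: [seq i.+1 | i <- iota 0 (trunc_log 2 a).+1].
  by rewrite -(iotaDl 1 0).
rewrite rev_cons map_rcons expn0 divn1 oddD odd_double addbF oddb; congr rcons.
rewrite -map_rev -map_comp; apply: eq_map => i /=.
by rewrite expnS divnMA (_ : (b + a.*2) %/ 2 = a) //; lia.
Qed.

(** What is written when bits are read most significant first: leading zeros are
    dropped, but zero keeps one digit. *)
Fixpoint emitted (started : bool) (bs : seq bool) : seq bool :=
  if bs is b :: bs' then
    if started || b then b :: emitted true bs' else emitted false bs'
  else if started then [::] else [:: false].

Lemma emitted_digits2 bs : emitted false (rev bs) = digits2 (bitval bs).
Proof.
elim: bs => [|b bs IH]; first by [].
rewrite rev_cons /=.
have E e cs c : emitted e (rcons cs c) =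
    if e || has id cs then rcons (emitted e cs) c else [:: c].
  elim: cs e => [|a cs IHc] e /=; first by case: e => //; case: c.
  case: e => /=; first by rewrite IHc.
  by case: a => //=; rewrite IHc.
have H : has id (rev bs) = (0 < bitval bs).
  by rewrite has_rev; elim: (bs) => //= a l ->; case: a => //=; lia.
rewrite E H /= IH; case: ltnP => [a0|]; first by rewrite digits2_double.
by rewrite leqn0 => /eqP ->; case: b.
Qed.

Definition read_bits (bs : seq bool) (v : nat) : nat :=
  foldl (fun v (b : bool) => b + v.*2) v bs.

Lemma digits2K a : read_bits (digits2 a) 0 = a.
Proof.
elim/ltn_ind: a => a IH; case: (leqP a 1) => [|a1]; first by case: a {IH} => [|[]].
rewrite -[in LHS](odd_double_half a) digits2_double; last by lia.
rewrite /read_bits -cats1 foldl_cat [foldl _ 0 _]IH /=; first exact: odd_double_half.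
by lia.
Qed.

Lemma size_binary a k : a < 2 ^ k -> size (binary a) <= k.+1.
Proof.
move=> ak; rewrite size_map size_rev size_iota ltnS.
case: a ak => [|a] ak; first by rewrite trunc_log0.
by rewrite -(@leq_exp2l 2) // ltnW // (leq_ltn_trans _ ak) // trunc_logP.
Qed.

Lemma encode_cons a s : encode (a :: s) = binary a ++ None :: encode s.
Proof. by rewrite /encode /= cat_rcons. Qed.

(** The separators make the encoding of tuples uniquely readable. *)
Lemma encode_inj : injective encode.
Proof.
have split_at (u v : seq bool) x y : map Some u ++ (None : letter) :: x = map Some v ++ None
    :: y ->
    u = v /\ x = y.
  elim: u v => [|a u IH] [|b v] //=; first by case.
  by case=> -> /IH [-> ->].
elim=> [|a s IH] [|b t] //.
- by rewrite encode_cons /encode /=; case: (binary b).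
- by rewrite encode_cons /encode /=; case: (binary a).
- by rewrite !encode_cons !binaryE => /split_at [/(can_inj digits2K) -> /IH ->].
Qed.

(** * The Turing machine of a register program *)

Section Machine.
Variables (A : word -> bool) (code : seq instr).

Notation B := (code_max code).
Notation col := (column_type B).
Notation sym := (symbol col).

(** Work tape, input tape, query tape. *)
Definition three T (a b c : T) (i : option bool) : T :=
  match i with None => a | Some false => b | Some true => c end.

(** The address of the instruction being executed, and three bits which say how
    far its execution has got. *)
Definition mstate : finType := ('I_B.+1 * (bool * bool * bool))%type.

Definition goto (pc : nat) : mstate := (inord pc, (false, false, false)).

Definition act3 (f : sym -> sym -> sym -> mstate * (option bool -> sym * direction)) :
    instruction mstate col (option bool) :=
  Act (fun v : {ffun option bool -> sym} => f (v None) (v (Some false)) (v (Some true))).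

(* Only a comparison uses the final memory bit to choose the next address. *)
Definition exit_label (i : instr) (pc : nat) (s : bool) : nat :=
  if i is ILt _ _ yes no then if s then yes else no else pc.+1.

Definition sweep_prog i pc (p s : bool) := act3 (fun a b c =>
  let st : mstate := (inord pc, (p, false, s)) in
  if ~~ p then
    if a is Some (inr x) then
      let r := delta i s x in
      ((inord pc, (false, false, r.1)),
       three (Some (inr r.2), MoveRight) (b, Stay) (c, Stay))
    else
      let r := delta i s (blank_col B) in
      ((inord pc, (true, false, r.1)),
       three (Some (inr r.2), Stay) (b, Stay) (c, Stay))
  else
    if a is Some (inr x) then
      (st, three (Some (inr (fixup i s x)), MoveLeft) (b, Stay) (c, Stay))
    else (goto (exit_label i pc s), three (None, MoveRight) (b, Stay) (c, Stay))).

Definition bit_sym (b : bool) : sym := Some (inl (Some b)).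

(** The head first runs to the most significant end; on the way back bits are
    copied to the query tape, once the first bit 1 has been seen ([s]).  A blank
    met before that means that the number is 0. *)
Definition emit_prog (x : nat) (sep : bool) pc (p s : bool) := act3 (fun a b c =>
  let st : mstate := (inord pc, (p, false, s)) in
  if ~~ p then
    if a is Some (inr _) then (st, three (a, MoveRight) (b, Stay) (c, Stay))
    else ((inord pc, (true, false, s)), three (a, MoveLeft) (b, Stay) (c, Stay))
  else
    if a is Some (inr y) then
      if s || y (inord x) then
        ((inord pc, (true, false, true)),
         three (a, MoveLeft) (b, Stay) (bit_sym (y (inord x)), MoveRight))
      else ((inord pc, (true, false, false)), three (a, MoveLeft) (b, Stay) (c, Stay))
    else if s then
      (goto pc.+1, three (a, MoveRight) (b, Stay)
         (if sep then (Some (inl None), MoveRight) else (c, Stay)))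
    else ((inord pc, (true, false, true)),
         three (a, Stay) (b, Stay) (bit_sym false, MoveRight))).

(** The cell to the left of the query is blank and stops the head. *)
Definition rewind_prog pc (p : bool) := act3 (fun a b c =>
  if ~~ p then ((inord pc, (false, true, false)), three (a, Stay) (b, Stay) (c, MoveLeft))
  else if c is Some _ then
    ((inord pc, (false, true, false)), three (a, Stay) (b, Stay) (c, MoveLeft))
  else ((inord pc, (true, false, false)), three (a, Stay) (b, Stay) (c, MoveRight))).

Definition erase_prog pc (s : bool) (yes no : nat) := act3 (fun a b c =>
  if c is Some _ then
    ((inord pc, (true, true, s)), three (a, Stay) (b, Stay) (None, MoveRight))
  else (goto (if s then yes else no), three (a, Stay) (b, Stay) (c, Stay))).

Definition get_prog (l0 l1 lsep : nat) := act3 (fun a b c =>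
  (goto (if b is Some (inl (Some d)) then if d then l1 else l0 else lsep),
   three (a, Stay) (b, MoveRight) (c, Stay))).

Definition instr_prog (i : instr) (pc : nat) (p q s : bool) :
    instruction mstate col (option bool) :=
  match i with
  | ISet _ _ | IAdd _ _ _ | ISub _ _ _ | ILt _ _ _ _ => sweep_prog i pc p s
  | IEmit x sep => emit_prog x sep pc p s
  | IAsk yes no =>
      if ~~ p then rewind_prog pc q
      else if ~~ q then
        Query col (option bool) (inord pc, (true, true, true) : _ * _)
          (inord pc, (true, true, false))
      else erase_prog pc s yes no
  | IGet l0 l1 lsep => get_prog l0 l1 lsep
  | IStop => if ~~ p then rewind_prog pc q else Halt _ _ _
  end.

Definition mprog (st : mstate) : instruction mstate col (option bool) :=
  let: (pc, (p, q, s)) := st in instr_prog (nth IStop code pc) pc p q s.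

(** The output tape is the query tape: [IStop] rewinds it and halts. *)
Definition machine : oracle_machine :=
  @OracleMachine mstate col (option bool) (Some false) (Some true) (Some true)
    (goto 0) mprog.

Definition cfg (st : mstate) (a b c : tape col) : config machine :=
  @Config machine st (three a b c).

Notation mstep := (step A (Z := machine)).

Lemma step_at i pc p q s a b c f : pc <= B -> nth IStop code pc = i ->
  instr_prog i pc p q s = act3 f ->
  mstep (cfg (inord pc, (p, q, s)) a b c) =
  let r := f (cur a) (cur b) (cur c) in
  cfg r.1 (write_move a (r.2 None)) (write_move b (r.2 (Some false)))
    (write_move c (r.2 (Some true))).
Proof.
move=> pcB pci E; rewrite /step /= inordK // pci E /= !ffunE /cfg; congr Config.
by apply: funext => -[[]|].
Qed.

Lemma write_stay (tp : tape col) : write_move tp (cur tp, Stay) = tp.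
Proof. by case: tp. Qed.

(** The two ways in which the head stands between the cells already visited and
    those still to be visited, according to the direction of the sweep. *)
Definition tape_right (l s : seq sym) : tape col := Tape l (head None s) (behead s).
Definition tape_left (l s : seq sym) : tape col := Tape (behead l) (head None l) s.

Notation blanks k := (nseq k (None : sym)).
Notation colsym := (fun c : col => Some (inr c) : sym).
Notation letsym := (fun a : letter => Some (inl a) : sym).

Definition is_sweep i :=
  match i with ISet _ _ | IAdd _ _ _ | ISub _ _ _ | ILt _ _ _ _ => true | _ => false end.

Lemma instr_prog_sweep i pc p q s : is_sweep i ->
  instr_prog i pc p q s = sweep_prog i pc p s.
Proof. by case: i. Qed.

Lemma run_right i pc (cs : seq col) z k b c s : is_sweep i -> pc <= B ->
  nth IStop code pc = i ->
  let r := transduce i s (rcons cs (blank_col B)) in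
  iter (size cs).+1 mstep
    (cfg (inord pc, (false, false, s)) (tape_right z (map colsym cs ++ blanks k)) b c) =
  cfg (inord pc, (true, false, r.1))
    (tape_left (map colsym (rev r.2) ++ z) (blanks k.-1)) b c.
Proof.
move=> si pcB pci; elim: cs z s => [|x cs IH] z s.
  rewrite /= (step_at _ _ _ pcB pci (instr_prog_sweep _ _ _ _ si)).
  case: k => [|k] /=; by rewrite !write_stay.
rewrite [size _]/= iterSr (step_at _ _ _ pcB pci (instr_prog_sweep _ _ _ _ si)).
rewrite /= !write_stay [write_move _ _](_ : _ =
  tape_right (Some (inr (delta i s x).2) :: z) (map colsym cs ++ blanks k)) //.
have /= := IH (Some (inr (delta i s x).2) :: z) (delta i s x).1.
move=> ->; congr cfg.
by rewrite rev_cons map_rcons cat_rcons.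
Qed.

Lemma run_left i pc (cs : seq col) z t b c s : is_sweep i -> pc <= B ->
  nth IStop code pc = i -> head None z = None ->
  iter (size cs).+1 mstep
    (cfg (inord pc, (true, false, s)) (tape_left (map colsym (rev cs) ++ z) t) b c) =
  cfg (goto (exit_label i pc s))
    (tape_right (None :: behead z) ([seq colsym (fixup i s c) | c <- cs] ++ t)) b c.
Proof.
move=> si pcB pci z0; elim/last_ind: cs t => [|cs x IH] t.
  rewrite /= (step_at _ _ _ pcB pci (instr_prog_sweep _ _ _ _ si)).
  by rewrite /= z0 /= !write_stay.
rewrite size_rcons iterSr (step_at _ _ _ pcB pci (instr_prog_sweep _ _ _ _ si)).
rewrite rev_rcons map_rcons /= !write_stay [write_move _ _](_ : _ =
  tape_left (map colsym (rev cs) ++ z) (colsym (fixup i s x) :: t)) //.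
by have /= -> := IH (colsym (fixup i s x) :: t); rewrite cat_rcons.
Qed.

Lemma run_sweep i pc (cs : seq col) z k b c : is_sweep i -> pc <= B ->
  nth IStop code pc = i -> head None z = None ->
  iter ((size cs).*2 + 3) mstep
    (cfg (goto pc) (tape_right z (map colsym cs ++ blanks k)) b c) =
  cfg (goto (exit_label i pc (sweep i cs).1))
    (tape_right (None :: behead z) (map colsym (sweep i cs).2 ++ blanks k.-1)) b c.
Proof.
move=> si pcB pci z0.
rewrite (_ : _ + 3 = (size cs).+2 + (size cs).+1); last by lia.
rewrite iterD (run_right _ _ _ _ _ _ si pcB pci).
have := size_transduce i false (rcons cs (blank_col B)); rewrite size_rcons => <-.
by rewrite (run_left _ _ _ _ _ si pcB pci z0) /sweep /= -map_comp.
Qed.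

(** The head stands behind the word written so far; [z] lists the cells to the left
    of this word, where rewinding has to meet a blank first. *)
Definition qtape (w : word) (z : seq sym) (k : nat) : tape col :=
  tape_right (map letsym (rev w) ++ z) (blanks k).

Lemma qtape_write w z k a :
  write_move (qtape w z k) (letsym a, MoveRight) = qtape (rcons w a) z k.-1.
Proof. by rewrite /qtape rev_rcons; case: k. Qed.

Lemma run_emit_right x sep pc (cs : seq col) z k b c : pc <= B ->
  nth IStop code pc = IEmit x sep ->
  iter (size cs).+1 mstep
    (cfg (goto pc) (tape_right z (map colsym cs ++ blanks k)) b c) =
  cfg (inord pc, (true, false, false))
    (tape_left (map colsym (rev cs) ++ z) (None :: blanks k.-1)) b c.
Proof.
move=> pcB pci; rewrite /goto; elim: cs z => [|y cs IH] z.
  rewrite /= (step_at _ _ _ pcB pci erefl).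
  case: k => [|k] /=; by rewrite !write_stay.
rewrite [size _]/= iterSr (step_at _ _ _ pcB pci erefl).
rewrite /= !write_stay [write_move _ _](_ : _ =
  tape_right (colsym y :: z) (map colsym cs ++ blanks k)) //.
have /= -> := IH (colsym y :: z).
by rewrite rev_cons map_rcons cat_rcons.
Qed.

Lemma run_emit_left x sep pc (cs : seq col) z t b s w zq k : pc <= B ->
  nth IStop code pc = IEmit x sep -> head None z = None ->
  exists2 n, n <= (size cs).+2 & exists k',
  iter n mstep
    (cfg (inord pc, (true, false, s)) (tape_left (map colsym (rev cs) ++ z) t) b (qtape w zq k)) =
  cfg (goto pc.+1) (tape_right (None :: behead z) (map colsym cs ++ t)) b
   (qtape (w ++ [seq Some d | d <- emitted s (rev (track x cs))] ++ nseq sep None) zq k').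
Proof.
move=> pcB pci z0; elim/last_ind: cs t s w k => [|cs y IH] t s w k.
  have last1 w' k1 : exists k',
    iter 1 mstep
    (cfg (inord pc, (true, false, true)) (tape_left z t) b (qtape w' zq k1)) =
    cfg (goto pc.+1) (tape_right (None :: behead z) t) b
      (qtape (w' ++ nseq sep None) zq k').
    exists (if sep then k1.-1 else k1).
    rewrite /= (step_at _ _ _ pcB pci erefl).
    rewrite /= z0 /= !write_stay; case: (sep) => /=.
      by rewrite (qtape_write _ _ _ None) cats1.
    by rewrite write_stay cats0.
  case: s; first by exists 1 => //; exact: last1.
  exists 2 => //; have [k' E] := last1 (rcons w (Some false)) k.-1; exists k'.
  move: E; rewrite cat_rcons => /= <-; congr step.
  rewrite /= (step_at _ _ _ pcB pci erefl).
  rewrite [cur (tape_left z t)]z0 /= !write_stay (qtape_write _ _ _ (Some false)).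
  by rewrite [write_move _ _](_ : _ = tape_left z t) // /tape_left z0.
have E0 : track x (rcons cs y) = rcons (track x cs) (y (inord x)) by exact: map_rcons.
rewrite size_rcons {}E0 !rev_rcons [map _ (_ :: _)]/=.
have [n n_le H] : exists2 n, n <= (size cs).+2 & exists k', iter n mstep
    (cfg (inord pc, (true, false, s || y (inord x)))
      (tape_left (map colsym (rev cs) ++ z) (colsym y :: t)) b
      (qtape (if s || y (inord x) then rcons w (Some (y (inord x))) else w) zq
        (if s || y (inord x) then k.-1 else k))) =
    cfg (goto pc.+1) (tape_right (None :: behead z) (map colsym (rcons cs y) ++ t)) b
     (qtape (w ++ [seq Some d | d <- emitted s (y (inord x) :: rev (track x cs))] ++
       nseq sep None) zq k').
  have [n n_le [k' E]] := IH (colsym y :: t) (s || y (inord x))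
    (if s || y (inord x) then rcons w (Some (y (inord x))) else w)
    (if s || y (inord x) then k.-1 else k).
  exists n => //; exists k'; rewrite E map_rcons cat_rcons /=.
  by case: (s || _) {E} => //=; rewrite cat_rcons.
exists n.+1 => //; case: H => k' E; exists k'.
rewrite iterSr (step_at _ _ _ pcB pci erefl) -{}E /=.
case: (s || y _) => /=; rewrite !write_stay; last by [].
by rewrite (qtape_write _ _ _ (Some (y (inord x)))).
Qed.

Lemma run_rewind i pc a b w z k : pc <= B -> nth IStop code pc = i ->
  (forall q s, instr_prog i pc false q s = rewind_prog pc q) -> head None z = None ->
  iter (size w).+2 mstep (cfg (goto pc) a b (qtape w z k)) =
  cfg (inord pc, (true, false, false)) a b
    (tape_right (None :: behead z) (map letsym w ++ None :: blanks k.-1)).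
Proof.
move=> pcB pci iE z0.
have E t : iter (size w).+1 mstep (cfg (inord pc, (false, true, false)) a b
      (tape_left (map letsym (rev w) ++ z) t)) =
    cfg (inord pc, (true, false, false)) a b
      (tape_right (None :: behead z) (map letsym w ++ t)).
  elim/last_ind: w t => [|w x IH] t.
    rewrite /= (step_at _ _ _ pcB pci (iE true _)).
    by rewrite [cur (tape_left z t)]z0 /= !write_stay.
  rewrite size_rcons iterSr (step_at _ _ _ pcB pci (iE true _)) rev_rcons /= !write_stay.
  by rewrite map_rcons cat_rcons; have /= <- := IH (Some (inl x) :: t).
rewrite iterSr (step_at _ _ _ pcB pci (iE false _)) /= !write_stay -[RHS]E.
by case: k.
Qed.

Lemma word_tape_right l w t : word_of_tape (tape_right l (map letsym w ++ None :: t)) = w.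
Proof. by case: w => //= a w; congr cons; elim: w => //= ? ? ->. Qed.

(** The query is erased from the left, so the next one starts further to the
    right, again next to a blank. *)
Lemma run_ask pc yes no a b w z k : pc <= B -> nth IStop code pc = IAsk yes no ->
  head None z = None ->
  exists z', head None z' = None /\ exists k',
  iter ((size w).*2 + 4) mstep (cfg (goto pc) a b (qtape w z k)) =
  cfg (goto (if A w then yes else no)) a b (qtape [::] z' k').
Proof.
move=> pcB pci z0.
have E s l t : iter (size w).+1 mstep (cfg (inord pc, (true, true, s)) a b
      (tape_right l (map letsym w ++ None :: t))) =
    cfg (goto (if s then yes else no)) a b (tape_right (blanks (size w) ++ l) (None :: t)).
  elim: w l => [|x w IH] l; first by rewrite /= (@step_at _ _ true true s _ _ _ _ pcB pci
      erefl) /= !write_stay.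
  rewrite [size _]/= iterSr (@step_at _ _ true true s _ _ _ _ pcB pci erefl) /= !write_stay.
  have /= := IH (None :: l); rewrite -[(None :: l)]/(blanks 1 ++ l) catA.
  by rewrite -nseqD addn1 => <-.
exists (blanks (size w) ++ None :: behead z); split; first by case: (w).
exists k.-1.+1; rewrite (_ : _ + 4 = (size w).+1 + (1 + (size w).+2)); last by lia.
rewrite iterD iterD (run_rewind _ _ _ _ pcB pci _ z0) //.
rewrite [iter 1 _ _](_ : _ = cfg (inord pc, (true, true, A w)) a b
   (tape_right (None :: behead z) (map letsym w ++ None :: blanks k.-1))) ?E //.
rewrite /= /step /= inordK // pci /= word_tape_right.
by case: (A w).
Qed.

(** [W] and [Q] bound the lengths of the work tape and of the query. *)
Definition represents (s : astate) (W Q : nat) (c : config machine) : Prop :=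
  exists cs z k zi ki zq kq,
    [/\ c = cfg (goto (apc s)) (tape_right z (map colsym cs ++ blanks k))
          (tape_right zi (map letsym (ainput s) ++ blanks ki)) (qtape (aquery s) zq kq),
      head None z = None, head None zq = None & 
      [/\ size cs <= W, size (aquery s) <= Q, apc s <= B &
       forall x, x <= B -> bitval (track x cs) = aenv s x]].

(** Sweeping takes time linear in the two lengths, and an instruction adds one
    column to the work tape and at most a number and a separator to the query. *)
Lemma run_instr s W Q c : represents s W Q c ->
  exists2 n, n <= W.*2 + Q.*2 + 8 &
    represents (astep A code s) W.+1 (Q + W + 2) (iter n mstep c).
Proof.
case: s => pc e q w; case=> cs [z [k [zi [ki [zq [kq [/= -> z0 zq0 [csW qQ pcB csE]]]]]]]].
have [N NE] : exists N, N = size cs by exists (size cs).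
have NW : N <= W by rewrite NE.
have := instr_max_le code pc.
have pcS : nth IStop code pc <> IStop -> pc.+1 <= B.
  move=> H; have [lt|ge] := ltnP pc (size code); last by case: H; rewrite nth_default.
  by rewrite (leq_trans lt) // leq_addr.
case pci : (nth IStop code pc) pcS => [d v|d x y|d x y|x y l1 l2|x sep|l1 l2|l0 l1 l2|] /= pcS iB;
  try (have {}pcS : pc.+1 <= B by exact: pcS).
- exists (N.*2 + 3); first lia.
  rewrite NE (run_sweep _ _ _ _ _ pcB pci z0) //.
  do 7 eexists; split; first by []; rewrite ?zq0 //=.
  split; rewrite ?size_sweep //; try lia.
  by move=> u uB; rewrite /upd; case: eqP => [->|/eqP ud];
    rewrite ?sweep_set ?sweep_frame ?csE //=; rewrite (inj_eq (@Some_inj _)) eq_sym.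
- exists (N.*2 + 3); first lia.
  rewrite NE (run_sweep _ _ _ _ _ pcB pci z0) //.
  do 7 eexists; split; first by []; rewrite ?zq0 //=.
  split; rewrite ?size_sweep //; try lia.
  move=> u uB; rewrite /upd; case: eqP => [->|/eqP ud].
    by rewrite sweep_add ?csE //; lia.
  by rewrite sweep_frame ?csE //=; rewrite (inj_eq (@Some_inj _)) eq_sym.
- exists (N.*2 + 3); first lia.
  rewrite NE (run_sweep _ _ _ _ _ pcB pci z0) //.
  do 7 eexists; split; first by []; rewrite ?zq0 //=.
  split; rewrite ?size_sweep //; try lia.
  move=> u uB; rewrite /upd; case: eqP => [->|/eqP ud].
    by rewrite sweep_sub ?csE //; lia.
  by rewrite sweep_frame ?csE //=; rewrite (inj_eq (@Some_inj _)) eq_sym.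
- exists (N.*2 + 3); first lia.
  rewrite NE (run_sweep _ _ _ _ _ pcB pci z0) //.
  rewrite /exit_label sweep_lt !csE; try lia.
  do 7 eexists; split; first by []; rewrite ?zq0 //=.
  split; rewrite ?size_sweep //; try lia.
    by case: ifP => _; lia.
  by move=> u uB; rewrite sweep_frame ?csE.
- have [n n_le [k' E]] := run_emit_left cs (None :: blanks k.-1)
    (tape_right zi (map letsym w ++ blanks ki)) false q zq kq pcB pci z0.
  exists (n + N.+1); first (move: n_le; rewrite -NE; lia).
  rewrite NE iterD (run_emit_right _ _ _ _ _ pcB pci) E.
  have Ex : [seq Some d | d <- emitted false (rev (track x cs))] = binary (e x).
    by rewrite emitted_digits2 csE // binaryE.
  exists cs, (None :: behead z), k.-1.+1, zi, ki, zq, k'; split => //=.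
    by rewrite -Ex.
  split => //; first lia.
  rewrite !size_cat size_nseq -Ex size_map.
  have F b bs : size (emitted b bs) <= (size bs).+1.
    elim: bs b => [[]|a bs IH b] //=.
    by have := IH true; have := IH false; case: ifP => _ /=; lia.
  by have := F false (rev (track x cs)); rewrite size_rev size_track; case: (sep) => /=; lia.
- have [z' [z'0 [k' E]]] := run_ask (tape_right z (map colsym cs ++ blanks k))
    (tape_right zi (map letsym w ++ blanks ki)) q kq pcB pci zq0.
  have [L LE] : exists L, L = size q by exists (size q).
  have LQ : L <= Q by rewrite LE.
  exists (L.*2 + 4); first lia.
  rewrite LE E; exists cs, z, k, zi, ki, z', k'; split => //=; split => //=; try lia.
  by case: ifP; lia.
- exists 1; first lia.
  rewrite /= {1}/goto (step_at _ _ _ pcB pci erefl) /= !write_stay.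
  have -> : write_move (tape_right zi (map letsym w ++ blanks ki))
     (cur (tape_right zi (map letsym w ++ blanks ki)), MoveRight) =
     tape_right (cur (tape_right zi (map letsym w ++ blanks ki)) :: zi)
      (map letsym (behead w) ++ blanks (if w is [::] then ki.-1 else ki)).
    by case: (w) => //=; case: (ki).
  exists cs, z, k, (cur (tape_right zi (map letsym w ++ blanks ki)) :: zi),
    (if w is [::] then ki.-1 else ki), zq, kq; split.
  + by case: (w) => [|[[]|] w'] //=; case: (ki).
  + by [].
  + by [].
  + split => //=; try lia.
    by case: (head _ _) => [[]|]; lia.
- exists 0; first lia.
  exists cs, z, k, zi, ki, zq, kq; split => //; split => //=; lia.
Qed.

End Machine.

Section MachineOutput.
Variables (A : word -> bool) (code : seq instr).
Notation B := (code_max code).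
Notation mstep := (step A (Z := machine code)).

(** After [T] instructions the work tape has at most [T] columns and the query at
    most [T * (T + 2)] letters, which bounds every single instruction. *)
Definition machine_time (T : nat) : nat :=
  T * (T.*2 + (T * (T + 2)).*2 + 8) + T * (T + 2) + 3.

Lemma run_code T w : exists2 k,
  k <= T * (T.*2 + (T * (T + 2)).*2 + 8) &
  represents (code := code) (iter T (astep A code) (AState 0 (fun=> 0) [::] w))
    T (T * (T + 2)) (iter k mstep (initial_config (machine code) w)).
Proof.
suff H t : t <= T -> exists2 k,
    k <= t * (T.*2 + (T * (T + 2)).*2 + 8) &
    represents (code := code) (iter t (astep A code) (AState 0 (fun=> 0) [::] w))
      t (t * (t + 2)) (iter k mstep (initial_config (machine code) w)) by exact: H.
elim: t => [_|t IH tT].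
  exists 0 => //; exists [::], [::], 0, [::], 0, [::], 0; split=> //.
  rewrite /= /initial_config /cfg /= cats0; congr Config.
  by apply: funext => -[[]|].
have [k kle /(@run_instr A) [k' k'le H]] := IH (ltnW tT); exists (k' + k); last first.
  rewrite iterD iterS; case: H => cs [z [k1 [zi [ki [zq [kq [E z0 zq0 [h1 h2 h3 h4]]]]]]]].
  exists cs, z, k1, zi, ki, zq, kq; split => //; split => //.
  by rewrite (leq_trans h2) //; nia.
suff : t.*2 + (t * (t + 2)).*2 <= T.*2 + (T * (T + 2)).*2 by nia.
by apply: leq_add; rewrite leq_double ?leq_mul //; lia.
Qed.

Lemma machine_outputs T N w (s := iter T (astep A code) (AState 0 (fun=> 0) [::] w)) :
  nth IStop code (apc s) = IStop -> machine_time T <= N ->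
  outputs_within A (machine code) w N (aquery s).
Proof.
move=> stop TN; rewrite /outputs_within.
have [k kle [cs [z [k1 [zi [ki [zq [kq [E z0 zq0 [_ qle pcB _]]]]]]]]]] := run_code T w.
rewrite -/s in E qle pcB.
have [L LE] : exists L, L = size (aquery s) by exists (size (aquery s)).
have LQ : L <= T * (T + 2) by rewrite LE.
rewrite (_ : N = (N - (L.+2 + k)) + ((size (aquery s)).+2 + k)); last first.
  by rewrite -LE; move: TN; rewrite /machine_time; lia.
rewrite iterD iterD E (run_rewind _ _ _ _ _ pcB stop _ zq0) //.
set c := cfg _ _ _ _.
have ch : program (cstate c) = Halt _ _ _.
  by rewrite /= inordK // stop.
have -> : iter (N - (L.+2 + k)) mstep c = c.
  by elim: (N - _) => //= j ->; rewrite /step ch.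
split; first by rewrite /halted ch.
by rewrite /c /= word_tape_right.
Qed.

End MachineOutput.

(** * A functional language *)

Definition scons (v : nat) (env : nat -> nat) : nat -> nat :=
  fun i => if i is j.+1 then env j else v.

(** Variables are de Bruijn indices.  [Size] is the parameter [n] in which time is
    measured.  [Iter b a e] starts from [a] and executes [e] as often as [b] says,
    with the value so far as variable 0 and the number of the round as variable 1.
    [Ask vs] is the oracle at [n] followed by the variables [vs], and [Ren]
    renames variables. *)
Inductive exp :=
  | Var of nat
  | Size
  | Cst of bool
  | Add of exp & exp
  | Sub of exp & exp
  | IfLt of exp & exp & exp & exp
  | Let of exp & exp
  | Iter of exp & exp & exp
  | Ask of seq nat
  | Ren of (nat -> nat) & exp.

Section Compile.
Variable (S : seq nat -> bool) (n : nat).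

Fixpoint eval (e : exp) (env : nat -> nat) : nat :=
  match e with
  | Var x => env x
  | Size => n
  | Cst b => b
  | Add a b => eval a env + eval b env
  | Sub a b => eval a env - eval b env
  | IfLt a b e1 e2 => if eval a env < eval b env then eval e1 env else eval e2 env
  | Let a b => eval b (scons (eval a env) env)
  | Iter b a e =>
      iteri (eval b env) (fun i acc => eval e (scons acc (scons i env))) (eval a env)
  | Ask vs => S (n :: [seq env v | v <- vs])
  | Ren r e => eval e (env \o r)
  end.

(** An upper bound for the number of instructions of the compiled program. *)
Fixpoint cost (e : exp) (env : nat -> nat) : nat :=
  match e with
  | Var _ | Size => 2
  | Cst _ => 1
  | Add a b | Sub a b => cost a env + cost b env + 1
  | IfLt a b e1 e2 => cost a env + cost b env + cost e1 env + cost e2 env + 2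
  | Let a b => cost a env + cost b (scons (eval a env) env) + 2
  | Iter b a e =>
      cost b env + cost a env + 4 +
      \sum_(i < eval b env)
        (cost e (scons (iteri i (fun i acc => eval e (scons acc (scons i env)))
           (eval a env)) (scons i env)) + 6)
  | Ask vs => size vs + 4
  | Ren r e => cost e (env \o r)
  end.

Definition copy (d x : nat) : seq instr := [:: ISet d false; IAdd d x d].
(* No number is less than itself. *)
Definition jump (l : nat) : instr := ILt 0 0 l l.

(** The result goes to register [d], registers below [d] are kept and those above
    are scratch; [vars] says where the variables are, and [off] is the address of
    the first instruction.  Register 0 holds [n].  Since nesting is static, finitely
    many registers suffice. *)
Fixpoint compile (e : exp) (vars : nat -> nat) (d off : nat) : seq instr :=
  match e with
  | Var x => copy d (vars x)
  | Size => copy d 0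
  | Cst b => [:: ISet d b]
  | Add a b =>
      let ca := compile a vars d off in
      ca ++ compile b vars d.+1 (off + size ca) ++ [:: IAdd d d d.+1]
  | Sub a b =>
      let ca := compile a vars d off in
      ca ++ compile b vars d.+1 (off + size ca) ++ [:: ISub d d d.+1]
  | IfLt a b e1 e2 =>
      let ca := compile a vars d off in
      let ob := off + size ca in
      let cb := compile b vars d.+1 ob in
      let o2 := (ob + size cb).+1 in
      let c2 := compile e2 vars d o2 in
      let o1 := (o2 + size c2).+1 in
      let c1 := compile e1 vars d o1 in
      ca ++ cb ++ ILt d d.+1 o1 o2 :: c2 ++ jump (o1 + size c1) :: c1
  | Let a b =>
      let ca := compile a vars d off in
      ca ++ compile b (scons d vars) d.+1 (off + size ca) ++ copy d d.+1
  | Iter b a e =>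
      let cb := compile b vars d off in
      let oa := off + size cb in
      let ca := compile a vars d.+1 oa in
      let l := (oa + size ca).+1 in
      let ce := compile e (scons d.+1 (scons d.+2 vars)) d.+3 l.+1 in
      let oe := l.+1 + size ce in
      cb ++ ca ++ ISet d.+2 false :: ILt d.+2 d l.+1 (oe + 5) :: ce ++
        copy d.+1 d.+3 ++
        [:: ISet d.+3 true; IAdd d.+2 d.+2 d.+3; jump l] ++ copy d d.+1
  | Ask vs =>
      let o := (off + size vs).+1 in
      IEmit 0 true :: [seq IEmit (vars v) true | v <- vs] ++
        [:: IAsk o.+1 o.+3; ISet d true; jump o.+4; ISet d false]
  | Ren r e => compile e (vars \o r) d off
  end.

Variables (A : word -> bool) (code : seq instr).
Hypothesis A_encode : forall s, A (encode s) = S s.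

Definition runs_within (s s' : astate) (N : nat) : Prop :=
  exists2 k, k <= N & iter k (astep A code) s = s'.

Lemma runs_within_trans s1 s2 s3 N1 N2 :
  runs_within s1 s2 N1 -> runs_within s2 s3 N2 -> runs_within s1 s3 (N1 + N2).
Proof.
move=> [k1 k1N E1] [k2 k2N E2]; exists (k2 + k1); first lia.
by rewrite iterD E1.
Qed.

Lemma runs_within_refl s : runs_within s s 0. Proof. by exists 0. Qed.

Lemma runs_within_le s s' N N' : N <= N' -> runs_within s s' N -> runs_within s s' N'.
Proof. by move=> NN' [k kN E]; exists k => //; apply: leq_trans NN'. Qed.

Definition code_at (off : nat) (c : seq instr) : Prop :=
  forall j, j < size c -> nth IStop code (off + j) = nth IStop c j.

Lemma code_at_cat off c1 c2 :
  code_at off (c1 ++ c2) -> code_at off c1 /\ code_at (off + size c1) c2.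
Proof.
move=> H; split=> j jlt.
  by rewrite H ?nth_cat ?jlt // size_cat ltn_addr.
rewrite -addnA H ?size_cat ?ltn_add2l // nth_cat ifN ?addKn //; lia.
Qed.

Lemma code_at_cons off i c :
  code_at off (i :: c) -> nth IStop code off = i /\ code_at off.+1 c.
Proof.
move=> H; split; first by have := H 0 isT; rewrite addn0.
by move=> j jlt; have := H j.+1 jlt; rewrite addnS.
Qed.

Lemma run_set d b pc e q w : nth IStop code pc = ISet d b ->
  runs_within (AState pc e q w) (AState pc.+1 (upd e d b) q w) 1.
Proof. by move=> E; exists 1 => //=; rewrite E. Qed.

Lemma run_add d x y pc e q w : nth IStop code pc = IAdd d x y ->
  runs_within (AState pc e q w) (AState pc.+1 (upd e d (e x + e y)) q w) 1.
Proof. by move=> E; exists 1 => //=; rewrite E. Qed.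

Lemma run_sub d x y pc e q w : nth IStop code pc = ISub d x y ->
  runs_within (AState pc e q w) (AState pc.+1 (upd e d (e x - e y)) q w) 1.
Proof. by move=> E; exists 1 => //=; rewrite E. Qed.

Lemma run_lt x y yes no pc e q w : nth IStop code pc = ILt x y yes no ->
  runs_within (AState pc e q w) (AState (if e x < e y then yes else no) e q w) 1.
Proof. by move=> E; exists 1 => //=; rewrite E. Qed.

Lemma run_jump l pc e q w : nth IStop code pc = jump l ->
  runs_within (AState pc e q w) (AState l e q w) 1.
Proof. by move=> E; exists 1 => //=; rewrite E /=; case: ifP. Qed.

Lemma updE e d v x : upd e d v x = if x == d then v else e x. Proof. by []. Qed.

Lemma run_copy d x pc e q w : code_at pc (copy d x) -> x != d ->
  exists e', [/\ runs_within (AState pc e q w) (AState (pc + 2) e' q w) 2,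
    e' d = e x & forall y, y != d -> e' y = e y].
Proof.
move=> /code_at_cons [c1] /code_at_cons [c2 _] xd.
eexists; split.
- rewrite addn2; exact: runs_within_trans (run_set _ _ _ c1) (run_add _ _ _ c2).
- by rewrite !updE !eqxx (negbTE xd) addn0.
- by move=> y yd; rewrite !updE (negbTE yd).
Qed.

Definition correct (e : exp) : Prop :=
  forall vars d off env rho w,
  (forall i, vars i < d) -> (forall i, env (vars i) = rho i) -> 0 < d -> env 0 = n ->
  code_at off (compile e vars d off) ->
  exists env', [/\
    runs_within (AState off env [::] w)
      (AState (off + size (compile e vars d off)) env' [::] w) (cost e rho),
    env' d = eval e rho & forall x, x < d -> env' x = env x].

(** The second operand is computed above the first, which it cannot overwrite. *)
Lemma correct_pair a b : correct a -> correct b ->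
  forall vars d off env rho w,
  (forall i, vars i < d) -> (forall i, env (vars i) = rho i) -> 0 < d -> env 0 = n ->
  let ca := compile a vars d off in
  let cb := compile b vars d.+1 (off + size ca) in
  code_at off ca -> code_at (off + size ca) cb ->
  exists env', [/\
    runs_within (AState off env [::] w) (AState (off + size ca + size cb) env' [::] w)
      (cost a rho + cost b rho),
    env' d = eval a rho, env' d.+1 = eval b rho & forall x, x < d -> env' x = env x].
Proof.
move=> ha hb vars d off env rho w vd ve d0 e0 ca cb ata atb.
have [e1 [r1 v1 f1]] := ha vars d off env rho w vd ve d0 e0 ata.
have [e2 [r2 v2 f2]] : exists env', [/\ runs_within (AState (off + size ca) e1 [::] w)
      (AState (off + size ca + size cb) env' [::] w) (cost b rho),
      env' d.+1 = eval b rho & forall x, x < d.+1 -> env' x = e1 x].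
  apply: hb => //; first by move=> i; rewrite ltnW // ltnS vd.
    by move=> i; rewrite f1 ?vd.
  by rewrite f1.
exists e2; split => //; first exact: runs_within_trans r1 r2.
  by rewrite f2.
by move=> x xd; rewrite f2 ?f1 // ltnW.
Qed.

Lemma compile_correct e : correct e.
Proof.
elim: e => [x||b|a ha b hb|a ha b hb|a ha b hb e1 h1 e2 h2|a ha b hb|b hb a ha e he|vs|r e he]
  vars d off env rho w vd ve d0 e0; rewrite /compile -/compile.
- move=> /run_copy - /(_ env [::] w) [|e' [r1 v f]]; first by rewrite neq_ltn vd.
  exists e'; split => //; first by rewrite v ve.
  by move=> y yd; rewrite f // neq_ltn yd.
- move=> /run_copy - /(_ env [::] w) [|e' [r1 v f]]; first by rewrite neq_ltn d0.
  exists e'; split => //; first by rewrite v e0.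
  by move=> y yd; rewrite f // neq_ltn yd.
- move=> /code_at_cons [c1 _]; eexists; split; first by rewrite addn1; exact: run_set c1.
    by rewrite updE eqxx.
  by move=> y yd; rewrite updE ltn_eqF.
- move=> /code_at_cat [cA /code_at_cat [cB /code_at_cons [c _]]].
  have [e' [r1 va vb f]] := correct_pair ha hb w vd ve d0 e0 cA cB.
  eexists; split.
  + rewrite !size_cat !addnA addn1; apply: runs_within_trans r1 (run_add _ _ _ c).
  + by rewrite updE eqxx va vb.
  + by move=> x xd; rewrite updE ltn_eqF ?f.
- move=> /code_at_cat [cA /code_at_cat [cB /code_at_cons [c _]]].
  have [e' [r1 va vb f]] := correct_pair ha hb w vd ve d0 e0 cA cB.
  eexists; split.
  + rewrite !size_cat !addnA addn1; apply: runs_within_trans r1 (run_sub _ _ _ c).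
  + by rewrite updE eqxx va vb.
  + by move=> x xd; rewrite updE ltn_eqF ?f.
- set ca := compile a _ _ _; set cb := compile b _ _ _; set c2 := compile e2 _ _ _.
  set c1 := compile e1 _ _ _.
  move=> /code_at_cat [cA /code_at_cat [cB /code_at_cons [cl /code_at_cat [C2 /code_at_cons
      [cj C1]]]]].
  have [e' [r1 va vb f]] := correct_pair ha hb w vd ve d0 e0 cA cB.
  have := runs_within_trans r1 (run_lt _ _ _ cl); rewrite va vb /=.
  have ve' i : e' (vars i) = rho i by rewrite f ?ve.
  have e'0 : e' 0 = n by rewrite f.
  have sz : off + size (ca ++ cb ++ ILt d d.+1 ((off + size ca + size cb).+1 + size c2).+1
        (off + size ca + size cb).+1 :: c2 ++
        jump (((off + size ca + size cb).+1 + size c2).+1 + size c1) :: c1) =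
      ((off + size ca + size cb).+1 + size c2).+1 + size c1.
    by rewrite !size_cat /= !size_cat /=; lia.
  case: ltnP => ab r2.
    have [e'' [r3 v3 f3]] := h1 _ _ _ _ _ w vd ve' d0 e'0 C1.
    exists e''; split=> //; last by move=> x xd; rewrite f3 ?f.
    by rewrite sz; apply: runs_within_le (runs_within_trans r2 r3); lia.
  have [e'' [r3 v3 f3]] := h2 _ _ _ _ _ w vd ve' d0 e'0 C2.
  exists e''; split=> //; last by move=> x xd; rewrite f3 ?f.
  rewrite sz; apply: runs_within_le (runs_within_trans (runs_within_trans r2 r3) (run_jump _ _
      _ cj)); lia.
- move=> /code_at_cat [cA /code_at_cat [cB cC]].
  have [e1 [r1 v1 f1]] := ha vars d off env rho w vd ve d0 e0 cA.
  have [||||e2 [r2 v2 f2]] := hb (scons d vars) d.+1 _ e1 (scons (eval a rho) rho) w _ _ _ _ cB.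
  + by case=> //= i; rewrite ltnW // ltnS vd.
  + by case=> //= i; rewrite f1 ?vd.
  + by [].
  + by rewrite f1.
  have [|e3 [r3 v3 f3]] := run_copy e2 [::] w cC; first by lia.
  exists e3; split.
  + by rewrite !size_cat !addnA; apply: runs_within_trans (runs_within_trans r1 r2) r3.
  + by rewrite v3.
  + by move=> x xd; rewrite f3 ?f2 ?f1 //; lia.
- set cb := compile b _ _ _; set ca := compile a _ _ _; set ce := compile e _ _ _.
  set l := (off + size cb + size ca).+1.
  move=> /code_at_cat [cB /code_at_cat [cA /code_at_cons [ci /code_at_cons [cl]]]].
  rewrite -/l => /code_at_cat [cE /code_at_cat [cC /code_at_cons [c1 /code_at_cons [c2
      /code_at_cons [cj cD]]]]].
  have [e1 [r1 vb va f1]] := correct_pair hb ha w vd ve d0 e0 cB cA.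
  have := runs_within_trans r1 (run_set _ _ _ ci); rewrite -/l.
  set e2 := upd _ _ _ => r2.
  pose F i acc := eval e (scons acc (scons i rho)).
  (* The loop invariant: the bound, the value so far and the number of the round
     are in three adjacent registers. *)
  have loop k : k <= eval b rho -> exists e', [/\
      runs_within (AState l e2 [::] w) (AState l e' [::] w)
        (\sum_(i < k) (cost e (scons (iteri i F (eval a rho)) (scons i rho)) + 6)),
      e' d = eval b rho, e' d.+1 = iteri k F (eval a rho), e' d.+2 = k &
      forall x, x < d -> e' x = env x].
    elim: k => [_|k IH kb].
      exists e2; rewrite big_ord0; split; first exact: runs_within_refl.
      - by rewrite /e2 updE ltn_eqF.
      - by rewrite /e2 updE ltn_eqF.
      - by rewrite /e2 updE eqxx.
      by move=> x xd; rewrite /e2 updE ltn_eqF ?f1 //; lia.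
    have [e3 [r3 vb3 va3 vi3 f3]] := IH (ltnW kb).
    have := runs_within_trans r3 (run_lt _ _ _ cl); rewrite vb3 vi3 kb => r4.
    have [||||e4 [r5 v5 f5]] := he (scons d.+1 (scons d.+2 vars)) d.+3 _ e3
      (scons (iteri k F (eval a rho)) (scons k rho)) w _ _ _ _ cE.
    + by case=> [|[|i]] //=; have := vd i; lia.
    + by case=> [|[|i]] //=; rewrite f3 ?vd.
    + by [].
    + by rewrite f3.
    have [|e5 [r6 v6 f6]] := run_copy e4 [::] w cC; first by lia.
    have r7 := runs_within_trans (run_set e5 [::] w c1) (run_add _ _ _ c2).
    have r8 := runs_within_trans r7 (run_jump _ _ _ cj).
    eexists; split.
    + rewrite big_ord_recr /=.
      apply: runs_within_le (runs_within_trans (runs_within_trans (runs_within_trans r4 r5)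
          r6) r8).
      by rewrite -!addnA leq_add2l; lia.
    + have n2 : (d == d.+2) = false by lia.
      have n3 : (d == d.+3) = false by lia.
      have n1 : d != d.+1 by lia.
      by rewrite updE n2 updE n3 f6 // f5 //; lia.
    + have n2 : (d.+1 == d.+2) = false by lia.
      have n3 : (d.+1 == d.+3) = false by lia.
      by rewrite updE n2 updE n3 v6 v5.
    + have n2 : d.+2 != d.+1 by lia.
      have n3 : (d.+2 == d.+3) = false by lia.
      by rewrite updE eqxx updE n3 updE eqxx f6 // f5 // vi3 addn1.
    + move=> x xd; have n2 : (x == d.+2) = false by lia.
      have n3 : (x == d.+3) = false by lia.
      have n1 : x != d.+1 by lia.
      by rewrite updE n2 updE n3 f6 // f5 ?f3 //; lia.
  have [e3 [r3 vb3 va3 vi3 f3]] := loop _ (leqnn _).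
  have := runs_within_trans (runs_within_trans r2 r3) (run_lt _ _ _ cl).
  rewrite vb3 vi3 ltnn => r4.
  have oe : l.+1 + size ce + size (copy d.+1 d.+3) + 3 = l.+1 + size ce + 5 by rewrite /=; lia.
  rewrite -/ce -[_.+3]addn3 oe in cD.
  have [|e4 [r5 v5 f5]] := run_copy e3 [::] w cD; first by lia.
  exists e4; split.
  + rewrite (_ : off + _ = l.+1 + size ce + 5 + 2); last first.
      by rewrite !size_cat /= !size_cat /= /l; lia.
    by apply: runs_within_le (runs_within_trans r4 r5); rewrite /= -/F; lia.
  + by rewrite v5.
  + by move=> x xd; rewrite f5 ?f3 //; lia.
- move=> /code_at_cons [cz /code_at_cat [cE]].
  rewrite size_map -[off.+1 + _]/((off + size vs).+1).
  set o := (off + size vs).+1.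
  move=> /code_at_cons [cA /code_at_cons [c1 /code_at_cons [cj /code_at_cons [c2 _]]]].
  have r1 : runs_within (AState off env [::] w) (AState off.+1 env (encode [:: n]) w) 1.
    by exists 1 => //=; rewrite cz /= e0 /encode /= cats0 cats1.
  have H us pc q : code_at pc [seq IEmit (vars v) true | v <- us] ->
     runs_within (AState pc env q w)
       (AState (pc + size us) env (q ++ encode [seq rho v | v <- us]) w) (size us).
    elim: us pc q => [|u us IH] pc q /=; first by rewrite addn0 cats0 => _;
        exact: runs_within_refl.
    move=> /code_at_cons [cu /IH r].
    have r0 : runs_within (AState pc env q w) (AState pc.+1 env (q ++ rcons (binary (rho u))
        None) w) 1.
      by exists 1 => //=; rewrite cu ve /= cats1.
    by have := runs_within_trans r0 (r _); rewrite -catA addSn addnS.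
  have := runs_within_trans r1 (H vs off.+1 _ cE).
  have -> : encode [:: n] ++ encode [seq rho v | v <- vs] = encode (n :: [seq rho v | v <- vs]).
    by rewrite /encode /= cats0.
  rewrite -[off.+1 + _]/o => r2.
  have [b bE] : exists b, b = S (n :: [seq rho v | v <- vs]) by eexists.
  have r3 : runs_within (AState o env (encode (n :: [seq rho v | v <- vs])) w)
      (AState (if b then o.+1 else o.+3) env [::] w) 1.
    by exists 1 => //=; rewrite cA /= A_encode bE.
  exists (upd env d b); split; last by move=> x xd; rewrite updE ltn_eqF.
    rewrite (_ : off + _ = o.+4); last by rewrite /= size_cat size_map /= /o; lia.
    have r4 : runs_within (AState (if b then o.+1 else o.+3) env [::] w) (AState o.+4 (upd env
        d b) [::] w) 2.
      case: (b); last by apply: runs_within_le (run_set _ _ _ c2).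
      exact: runs_within_trans (run_set _ _ _ c1) (run_jump _ _ _ cj).
    by apply: runs_within_le (runs_within_trans (runs_within_trans r2 r3) r4); rewrite /=; lia.
  by rewrite updE eqxx /= bE.
- by move=> H; apply: (he (vars \o r)) H => //= i; rewrite ?vd ?ve.
Qed.

End Compile.

(** * Definable functions and polynomial time *)

(** Horner's rule: the input comes most significant digit first. *)
Definition load (r off : nat) : seq instr :=
  [:: IGet off.+1 (off + 3) (off + 7);
      IAdd r r r; jump off;
      IAdd r r r; ISet 3 true; IAdd r r 3; jump off].

Lemma run_load A code r off bs w env : r < 3 -> code_at code off (load r off) ->
  exists env', [/\
    runs_within A code (AState off env [::] ([seq Some b | b <- bs] ++ None :: w))
      (AState (off + 7) env' [::] w) (5 * size bs + 1),
    env' r = read_bits bs (env r) &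
    forall x, x != r -> x != 3 -> env' x = env x].
Proof.
move=> r3 /code_at_cons [cg /code_at_cons [c1 /code_at_cons [c2 /code_at_cons [c3
    /code_at_cons [c4 /code_at_cons [c5 /code_at_cons [c6 _]]]]]]].
elim: bs env => [|b bs IH] env.
  by exists env; split => //; exists 1 => //=; rewrite cg.
set w' := [seq Some b | b <- bs] ++ None :: w.
have [env1 [r1 v1 f1]] : exists env', [/\
    runs_within A code (AState off env [::] (Some b :: w')) (AState off env' [::] w') 5,
    env' r = b + (env r).*2 & forall x, x != r -> x != 3 -> env' x = env x].
  have r0 : runs_within A code (AState off env [::] (Some b :: w'))
      (AState (if b then off + 3 else off.+1) env [::] w') 1 by exists 1 => //=; rewrite cg.
  case: b r0 => r0.
    have := runs_within_trans r0 (run_add A env [::] w' (_ : nth IStop code (off + 3) = _)).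
    rewrite addn3 => /(_ _ _ _ c3) r1.
    eexists; split.
    - exact: runs_within_trans (runs_within_trans (runs_within_trans r1 (run_set _ _ _ _ c4))
        (run_add _ _ _ _ c5))
       (run_jump _ _ _ _ c6).
    - by rewrite !updE !eqxx !ltn_eqF // addnn addnC.
    - by move=> x xr x3; rewrite !updE (negbTE xr) (negbTE x3).
  eexists; split.
  - apply: runs_within_le (runs_within_trans (runs_within_trans r0 (run_add _ _ _ _ c1))
      (run_jump _ _ _ _ c2)).
    by [].
  - by rewrite !updE !eqxx // addnn.
  - by move=> x xr x3; rewrite !updE (negbTE xr).
have [env2 [r2 v2 f2]] := IH env1.
exists env2; split.
- by apply: runs_within_le (runs_within_trans r1 r2); rewrite /=; lia.
- by rewrite v2 v1.
- by move=> x xr x3; rewrite f2 ?f1.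
Qed.

(* The input triple is loaded into the registers 0, 1, 2; register 3 is scratch
   for [load] and then receives the result. *)
Definition program_vars (x : nat) : nat :=
  match x with 0 => 1 | 1 => 2 | _ => 0 end.

Definition program_of (e : exp) : seq instr :=
  load 0 0 ++ load 1 7 ++ load 2 14 ++ compile e program_vars 3 21 ++ [:: IEmit 3 false].

Lemma run_program (S : seq nat -> bool) A e n i l :
  (forall s, A (encode s) = S s) ->
  let rho := scons i (scons l (fun=> n)) in
  let code := program_of e in
  exists env pc, nth IStop code pc = IStop /\
    runs_within A code (AState 0 (fun=> 0) [::] (encode [:: n; i; l]))
      (AState pc env (binary (eval S n e rho)) [::])
      (5 * size (encode [:: n; i; l]) + cost S n e rho + 4).
Proof.
move=> A_encode rho code.
have /code_at_cat [L0 /code_at_cat [L1 /code_at_cat [L2 /code_at_cat [C /code_at_cons [Em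
    _]]]]] :=
  ((fun j _ => erefl (nth IStop code j)) : code_at code 0 code).
rewrite -[0 + _]/7 -[7 + _]/14 -[14 + _]/21 in L1 L2 C Em.
have [e1 [r1 v1 f1]] := run_load A (digits2 n) (encode [:: i; l]) (fun=> 0) (isT : 0 < 3) L0.
have [e2 [r2 v2 f2]] := run_load A (digits2 i) (encode [:: l]) e1 (isT : 1 < 3) L1.
have [e3 [r3 v3 f3]] := run_load A (digits2 l) (encode [::]) e2 (isT : 2 < 3) L2.
rewrite -[0 + 7]/7 -[7 + 7]/14 -[14 + 7]/21 in r1 r2 r3.
rewrite -binaryE -encode_cons in r1.
rewrite -binaryE -encode_cons in r2.
rewrite -binaryE -encode_cons in r3.
have {}v1 : e1 0 = n by rewrite v1 digits2K.
have {}v2 : e2 1 = i by rewrite v2 f1 // digits2K.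
have {}v3 : e3 2 = l by rewrite v3 f2 // f1 // digits2K.
have he : correct S n A code e by exact: compile_correct.
have [||||e4 [r4 v4 f4]] := he program_vars 3 21 e3 rho [::] _ _ _ _ C.
- by case=> [|[|]].
- by case=> [|[|x]] /=; [rewrite f3 // v2 | | rewrite f3 // f2].
- by [].
- by rewrite f3 // f2.
exists e4, (21 + size (compile e program_vars 3 21)).+1; split.
  by rewrite nth_default // /code /program_of !size_cat /= !addn1.
have r5 : runs_within A code (AState (21 + size (compile e program_vars 3 21)) e4 [::] [::])
   (AState (21 + size (compile e program_vars 3 21)).+1 e4 (binary (eval S n e rho)) [::]) 1.
  exists 1 => //; rewrite /iter /astep.
  by rewrite (Em : nth IStop code (21 + size (compile e program_vars 3 21)) = _) v4 cats0.
have := runs_within_trans (runs_within_trans (runs_within_trans (runs_within_trans r1 r2) r3)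
    r4) r5.
apply: runs_within_le.
rewrite !encode_cons !binaryE !size_cat /= !size_cat /= !size_cat /= !size_map; lia.
Qed.

(** Definable within polynomially many instructions, uniformly in the
    environment: this is what makes the notion closed under substitution and
    iteration. *)
Definition definable (S : seq nat -> bool) (f : nat -> (nat -> nat) -> nat) : Prop :=
  exists e d, forall n env,
    eval S n e env = f n env /\ cost S n e env <= (n + 2) ^ d.

Lemma machine_time_le T : machine_time T <= (T + 3) ^ 5.
Proof. rewrite /machine_time !expnS expn0; nia. Qed.

(** The number of instructions is at most a multiple of the length of the input plus
    the cost of the program; [machine_time] turns it into a number of steps. *)
Theorem definable_ptime (As : set (seq nat)) (dom : set (seq nat)) f
    (g : nat -> (nat -> nat) -> nat) d :
  (forall s, dom s -> exists n i l, [/\ s = [:: n; i; l],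
     size (encode s) <= (n + 2) ^ d & f s = g n (scons i (scons l (fun=> n)))]) ->
  definable (fun s => `[< As s >]) g -> ptime_relative As dom f.
Proof.
move=> hdom [e [d' he]].
have A_encode s : oracle As (encode s) = `[< As s >].
  apply/asboolP/asboolP; first by move=> [s' As' /encode_inj ->].
  by exists s.
exists (machine (program_of e)).
exists ((5%:P * ('X + 2%:P) ^+ d + ('X + 2%:P) ^+ d' + 7%:P) ^+ 5)%R =>
    s /hdom [n [i [l [sE sz fE]]]].
set p := (_.[_])%R.
have -> : p = (5 * (n + 2) ^ d + (n + 2) ^ d' + 7) ^ 5.
  rewrite /p sE horner_exp !hornerD hornerM !horner_exp hornerD hornerX !hornerC.
  by rewrite !natrXE !natn.
have [env [pc [stop [k kle E]]]] := run_program e n i l A_encode.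
have := @machine_outputs (oracle As) (program_of e) k.
move=> /(_ ((5 * (n + 2) ^ d + (n + 2) ^ d' + 7) ^ 5) (encode [:: n; i; l])).
rewrite E /= => /(_ stop) H; rewrite fE sE.
have [<- ce] := he n (scons i (scons l (fun=> n))).
apply: H; apply: leq_trans (machine_time_le _) _.
rewrite leq_exp2r //; rewrite sE in sz; lia.
Qed.

Section Definability.
Variable S : seq nat -> bool.
Implicit Types (f g a b c : nat -> (nat -> nat) -> nat).

Local Notation definable := (definable S).

(** A base of at least 2 lets the sum of two bounds be absorbed by a larger
    exponent. *)
Definition pbounded b := exists d, forall n env, b n env <= (n + 2) ^ d.

Lemma pbounded_le b b' : pbounded b' -> (forall n env, b n env <= b' n env) -> pbounded b.
Proof. by move=> [d H] bb'; exists d => n env; apply: leq_trans (H n env). Qed.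

Lemma pbounded_const k : pbounded (fun _ _ => k).
Proof.
exists k => n _; apply: leq_trans (_ : 2 ^ k <= _); first exact/ltnW/ltn_expl.
by case: k => // k; rewrite leq_exp2r // leq_addl.
Qed.

Lemma pbounded_add a b : pbounded a -> pbounded b -> pbounded (fun n env => a n env + b n env).
Proof.
move=> [d Hd] [e He]; exists (maxn d e).+1 => n env.
have Ha : a n env <= (n + 2) ^ maxn d e.
  by apply: leq_trans (Hd n env) _; rewrite leq_exp2l ?leq_maxl //; lia.
have Hb : b n env <= (n + 2) ^ maxn d e.
  by apply: leq_trans (He n env) _; rewrite leq_exp2l ?leq_maxr //; lia.
by rewrite expnS; move: Ha Hb; nia.
Qed.

Lemma pbounded_mul a b : pbounded a -> pbounded b -> pbounded (fun n env => a n env * b n env).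
Proof. by move=> [d Hd] [e He]; exists (d + e) => n env; rewrite expnD leq_mul. Qed.

Lemma pbounded_size : pbounded (fun n _ => n).
Proof. by exists 1 => n _; rewrite expn1 leq_addr. Qed.

Lemma pbounded_exp d : pbounded (fun n _ => (n + 2) ^ d).
Proof. by exists d. Qed.

Lemma pbounded_minr a b : pbounded b -> pbounded (fun n env => minn (a n env) (b n env)).
Proof. by move=> H; apply: pbounded_le H _ => n env; exact: geq_minr. Qed.

Lemma definable_intro e f : (forall n env, eval S n e env = f n env) ->
  pbounded (fun n env => cost S n e env) -> definable f.
Proof. by move=> ef [d ed]; exists e, d => n env; split. Qed.

Lemma definable_elim f : definable f -> exists2 e, (forall n env, eval S n e env = f n env) &
  pbounded (fun n env => cost S n e env).
Proof. by move=> [e [d H]]; exists e; [move=> n env; case: (H n env) | exists d => n env;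
    case: (H n env)]. Qed.

Lemma definable_var x : definable (fun _ env => env x).
Proof. by apply: (@definable_intro (Var x)) => //; exact: pbounded_const. Qed.

Lemma definable_size : definable (fun n _ => n).
Proof. by apply: (@definable_intro Size) => //; exact: pbounded_const. Qed.

Lemma definable_add a b : definable a -> definable b -> definable (fun n env =>
    a n env + b n env).
Proof.
move=> /definable_elim [ea Ea Ca] /definable_elim [eb Eb Cb].
apply: (@definable_intro (Add ea eb)) => [n env|] /=; first by rewrite Ea Eb.
by do 2 ?apply: pbounded_add => //; exact: pbounded_const.
Qed.

Lemma definable_sub a b : definable a -> definable b -> definable (fun n env =>
    a n env - b n env).
Proof.
move=> /definable_elim [ea Ea Ca] /definable_elim [eb Eb Cb].
apply: (@definable_intro (Sub ea eb)) => [n env|] /=; first by rewrite Ea Eb.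
by do 2 ?apply: pbounded_add => //; exact: pbounded_const.
Qed.

Lemma definable_const k : definable (fun _ _ => k).
Proof.
have definable_b (b : bool) : definable (fun _ _ => b).
  by apply: (@definable_intro (Cst b)) => //; exact: pbounded_const.
elim: k => [|k IH]; first exact: (definable_b false).
exact: (definable_add (definable_b true) IH).
Qed.

Lemma definable_iflt a b f g : definable a -> definable b -> definable f -> definable g ->
  definable (fun n env => if a n env < b n env then f n env else g n env).
Proof.
move=> /definable_elim [ea Ea Ca] /definable_elim [eb Eb Cb] /definable_elim [ef Ef Cf]
    /definable_elim [eg Eg Cg].
apply: (@definable_intro (IfLt ea eb ef eg)) => [n env|] /=; first by rewrite Ea Eb Ef Eg.
by do 4 ?apply: pbounded_add => //; exact: pbounded_const.
Qed.

Lemma definable_let a f : definable a -> definable f ->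
  definable (fun n env => f n (scons (a n env) env)).
Proof.
move=> /definable_elim [ea Ea Ca] /definable_elim [ef Ef [d Cf]].
apply: (@definable_intro (Let ea ef)) => [n env|] /=; first by rewrite Ea Ef.
by do 2 ?apply: pbounded_add => //; [exists d => n env; exact: Cf | exact: pbounded_const].
Qed.

Lemma definable_ren r f : definable f -> definable (fun n env => f n (env \o r)).
Proof.
move=> /definable_elim [ef Ef [d Cf]].
by apply: (@definable_intro (Ren r ef)) => [n env|] /=; [rewrite Ef | exists d => n env;
    exact: Cf].
Qed.

Lemma definable_ask vs : definable (fun n env => S (n :: [seq env v | v <- vs])).
Proof. by apply: (@definable_intro (Ask vs)) => //; exact: pbounded_const. Qed.

(** The bound on the number of rounds must not depend on the environment, in which
    the values may be exponentially large. *)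
Lemma definable_iter b a (g : nat -> nat -> nat -> (nat -> nat) -> nat) :
  pbounded b -> definable b -> definable a ->
  definable (fun n env => g n (env 1) (env 0) (fun x => env x.+2)) ->
  definable (fun n env => iteri (b n env) (fun i acc => g n i acc env) (a n env)).
Proof.
move=> Pb /definable_elim [eb Eb Cb] /definable_elim [ea Ea Ca] /definable_elim [eg Eg [d Cg]].
apply: (@definable_intro (Iter eb ea eg)) => [n env|] /=.
  rewrite Ea Eb; elim: (b n env) => //= k ->; exact: Eg.
apply: pbounded_add; first by do 2 ?apply: pbounded_add => //; exact: pbounded_const.
apply: pbounded_le (pbounded_mul Pb (pbounded_add (pbounded_exp d) (pbounded_const 6))) _ =>
    n env.
rewrite -(Eb n) -[X in _ <= X * _]card_ord -sum_nat_const.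
by apply: leq_sum => i _; rewrite leq_add2r Cg.
Qed.

(* Renaming hides the accumulated value from the summand. *)
Lemma definable_sum b (g : nat -> nat -> (nat -> nat) -> nat) :
  pbounded b -> definable b ->
  definable (fun n env => g n (env 0) (fun x => env x.+1)) ->
  definable (fun n env => \sum_(i < b n env) g n i env).
Proof.
move=> Pb Db Dg.
have [e [d H]] := definable_iter (g := fun n i acc env =>
    acc + g n i env) Pb Db (definable_const 0)
  (definable_add (definable_var 0) (definable_ren succn Dg)).
exists e, d => n env; have [-> ?] := H n env; split => //.
by elim: (b n env) => /= [|k ->]; rewrite ?big_ord0 // big_ord_recr.
Qed.

(** Substitution, through [Let], for the first variables. *)
Lemma definable_comp1 (F : nat -> nat -> nat) a : definable (fun n env => F n (env 0)) ->
  definable a -> definable (fun n env => F n (a n env)).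
Proof. by move=> DF Da; exact: (definable_let Da DF). Qed.

Lemma definable_comp2 (F : nat -> nat -> nat -> nat) a b :
  definable (fun n env => F n (env 0) (env 1)) ->
  definable a -> definable b -> definable (fun n env => F n (a n env) (b n env)).
Proof. by move=> DF Da Db; exact: (definable_let Db (definable_let (definable_ren succn Da)
    DF)). Qed.

Lemma definable_comp3 (F : nat -> nat -> nat -> nat -> nat) a b c :
  definable (fun n env => F n (env 0) (env 1) (env 2)) ->
  definable a -> definable b -> definable c ->
  definable (fun n env => F n (a n env) (b n env) (c n env)).
Proof.
move=> DF Da Db Dc.
exact: (definable_let Dc (definable_let (definable_ren succn Db) (definable_let (definable_ren
    succn (definable_ren succn Da)) DF))).
Qed.

Lemma definable_min a b : definable a -> definable b ->
  definable (fun n env => minn (a n env) (b n env)).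
Proof. by move=> Da Db; rewrite /minn; exact: definable_iflt. Qed.

Lemma definable_eq a b f g : definable a -> definable b -> definable f -> definable g ->
  definable (fun n env => if a n env == b n env then f n env else g n env).
Proof.
move=> Da Db Df Dg.
have [e [d H]] := definable_iflt Da Db Dg (definable_iflt Db Da Dg Df).
by exists e, d => n env; have [-> ?] := H n env; split=> //; case: ltngtP.
Qed.

End Definability.

(** * The algorithm *)

(** Repeated addition, polynomial because the second factor is truncated to
    [n + K]; the algorithm only multiplies by numbers below this bound. *)
Definition smul (K n x y : nat) : nat := x * minn y (n + K).

Lemma definable_smul S K a b : definable S a -> definable S b ->
  definable S (fun n env => smul K n (a n env) (b n env)).
Proof.
apply: definable_comp2.
have [||||e [d H]] := @definable_iter S (fun n env => minn (env 1) (n + K)) (fun _ _ => 0)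
  (fun n i acc env => acc + env 0).
- by apply: pbounded_minr; apply: pbounded_add; [exact: pbounded_size | exact: pbounded_const].
- by apply: definable_min; [exact: definable_var | apply: definable_add;
    [exact: definable_size | exact: definable_const]].
- exact: definable_const.
- by apply: definable_add; exact: definable_var.
exists e, d => n env; have [-> ?] := H n env; split=> //; rewrite /smul.
by elim: (minn _ _) => /= [|k ->]; rewrite ?muln0 // mulnS addnC.
Qed.

Lemma definable_exp S D : definable S (fun n _ => (n + 2) ^ D).
Proof.
elim: D => [|D IH]; first exact: definable_const.
have [e [d H]] := definable_smul 2 IH (definable_add (definable_size S) (definable_const S 2)).
by exists e, d => n env; have [-> ?] := H n env; split=> //; rewrite /smul minnn expnSr.
Qed.

Lemma definable_pow2 S b : definable S b -> pbounded b -> definable S (fun n env => 2 ^ b n env).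
Proof.
move=> Db Pb.
have [||e [d H]] := @definable_iter S b (fun _ _ => 1) (fun n i acc env => acc + acc) Pb Db.
- exact: definable_const.
- by apply: definable_add; exact: definable_var.
exists e, d => n env; have [-> ?] := H n env; split=> //.
by elim: (b n env) => //= k ->; rewrite expnS mul2n addnn.
Qed.

(** Binary search for the greatest [x < 2 ^ E] with a downward closed property,
    determining its bits from the highest one on. *)
Definition bsearch (E : nat) (P : nat -> bool) : nat :=
  iteri E (fun i acc => if P (acc + 2 ^ (E - i.+1)) then acc + 2 ^ (E - i.+1) else acc) 0.

Lemma bsearchP E P u : u < 2 ^ E -> (forall x, x < 2 ^ E -> P x = (x <= u)) ->
  bsearch E P = u.
Proof.
move=> uE HP; rewrite /bsearch.
have H k : k <= E -> let acc := iteri k (fun i acc =>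
    if P (acc + 2 ^ (E - i.+1)) then acc + 2 ^ (E - i.+1) else acc) 0 in
    acc <= u < acc + 2 ^ (E - k) /\ acc + 2 ^ (E - k) <= 2 ^ E.
  elim: k => [_|k IH kE] /=; first by rewrite subn0.
  have [] := IH (ltnW kE); set acc := iteri _ _ _.
  rewrite (_ : E - k = (E - k.+1).+1); last by lia.
  rewrite expnS; have : 0 < 2 ^ (E - k.+1) by rewrite expn_gt0.
  move: (2 ^ (E - k.+1)) => w w0 /andP [au uw] aE.
  rewrite HP; last by lia.
  by case: (leqP (acc + w) u) => ?; split; lia.
have [/andP [H1 H2] _] := H E (leqnn E); move: H1 H2; rewrite subnn; lia.
Qed.

Lemma definable_bsearch S b r (c : nat -> nat -> (nat -> nat) -> nat) :
  definable S b -> pbounded b -> definable S r ->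
  definable S (fun n env => c n (env 0) (fun x => env x.+1)) ->
  definable S (fun n env => bsearch (b n env) (fun x => c n x env <= r n env)).
Proof.
move=> Db Pb Dr Dc.
have Dw : definable S (fun n env => 2 ^ (minn (b n (fun x => env x.+2) - (env 1).+1)
     (b n (fun x => env x.+2)))).
  apply: definable_pow2.
    apply: definable_min; last exact: (definable_ren _ (definable_ren succn Db)).
    apply: definable_sub; first exact: (definable_ren succn (definable_ren succn Db)).
    exact: (definable_add (definable_const S 1) (definable_var S 1)).
  by apply: pbounded_minr; case: Pb => d Hd; exists d => n env; exact: Hd.
have [||e [d H]] := @definable_iter S b (fun _ _ => 0) (fun n i acc env =>
    let x := acc + 2 ^ (minn (b n env - i.+1) (b n env)) in
    if r n env < c n x env then acc else x) Pb Db.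
- exact: definable_const.
- apply: definable_iflt.
  + exact: (definable_ren succn (definable_ren succn Dr)).
  + have Dc' := definable_ren (fun x => if x is y.+1 then y.+3 else 0) Dc.
    exact: (definable_let (definable_add (definable_var S 0) Dw) Dc').
  + exact: definable_var.
  + by apply: definable_add => //; exact: definable_var.
exists e, d => n env; have [-> ?] := H n env; split=> //.
rewrite /bsearch; set f := fun i acc => _; set g := fun i acc => _.
suff fg : f = g by rewrite fg.
apply: funext => i; apply: funext => acc; rewrite /f /g /=.
have -> : minn (b n env - i.+1) (b n env) = b n env - i.+1 by apply/minn_idPl; lia.
by case: ltnP.
Qed.

(** Division by a small number, as a search for the quotient; the exponent [D]
    only has to be large enough for the dividends that occur. *)
Definition sdiv (K D n x y : nat) : nat :=
  bsearch ((n + 2) ^ D) (fun q => smul K n q y <= x).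

Lemma sdivE K D n x y : 0 < y <= n + K -> x < 2 ^ (n + 2) ^ D -> sdiv K D n x y = x %/ y.
Proof.
move=> /andP [y0 yK] xD; apply: bsearchP => [|q _].
  by apply: leq_ltn_trans xD; exact: leq_div.
by rewrite /smul (minn_idPl yK) leq_divRL.
Qed.

Lemma definable_sdiv S K D a b : definable S a -> definable S b ->
  definable S (fun n env => sdiv K D n (a n env) (b n env)).
Proof.
apply: definable_comp2; apply: (@definable_bsearch S _ _ (fun n q env => smul K n q (env 1))).
- exact: definable_exp.
- exact: pbounded_exp.
- exact: definable_var.
- by apply: definable_smul; exact: definable_var.
Qed.

Lemma definable_bigsum S k (f : nat -> nat -> (nat -> nat) -> nat) :
  (forall i, definable S (f i)) -> definable S (fun n env => \sum_(i < k) f i n env).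
Proof.
move=> Df; elim: k => [|k IH].
  by have [e [d H]] := definable_const S 0; exists e, d => n env; rewrite big_ord0; exact: H.
have [e [d H]] := definable_add IH (Df k).
by exists e, d => n env; rewrite big_ord_recr; exact: H.
Qed.

Lemma definable_nth S (s : seq nat) a : definable S a ->
  definable S (fun n env => nth 0 s (a n env)).
Proof.
elim: s a => [|x s IH] a Da.
  by have [e [d H]] := definable_const S 0; exists e, d => n env; rewrite nth_nil; exact: H.
have [e [d H]] := definable_iflt Da (definable_const S 1) (definable_const S x) (IH _
    (definable_sub Da (definable_const S 1))).
exists e, d => n env; have [-> ?] := H n env; split => //.
by case: (a n env) => //= k; rewrite subn1.
Qed.

(** The summation over all vectors of length [j] with entries at most [n], which
    become the first [j] variables. *)
Fixpoint boxsum (j : nat) (f : nat -> (nat -> nat) -> nat) (n : nat) (env : nat -> nat) :=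
  if j is j'.+1 then \sum_(a < n.+1) boxsum j' f n (scons a env) else f n env.

Lemma definable_boxsum S j f : definable S f -> definable S (boxsum j f).
Proof.
move=> Df; elim: j => [|j IH] //=.
apply: (@definable_sum S (fun n _ => n.+1) (fun n a env => boxsum j f n (scons a env))).
- exact: (pbounded_add (pbounded_const 1) pbounded_size).
- exact: (definable_add (definable_const S 1) (definable_size S)).
- have [e [d H]] := IH; exists e, d => n env; have [-> ?] := H n env; split => //.
  by congr boxsum; apply: funext => -[].
Qed.

(** Words are numbers in base [m], [t] is the index of a value of
    the sum, [p] is a prefix and [j] its length, and [order] lists the digits in
    the order in which the oracle expects their counts. *)
Section Algorithm.
Variables (S : seq nat -> bool) (m M1 D : nat) (order tbl : seq nat).

Let K := m.+1.

Definition shift_digits n b e := iteri (minn e n) (fun _ acc => sdiv K D n acc m) b.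

Definition digit n b e :=
  shift_digits n b e - smul K n (sdiv K D n (shift_digits n b e) m) m.

Definition count_digit n p j d := \sum_(i < minn j n) (if digit n p i == d then 1 else 0).

(** [x * 'C(a, b)], by [b] multiplications and divisions; all quotients are
    exact. *)
Definition mulbin n x a b :=
  iteri (minn b n) (fun i acc => sdiv K D n (smul K n acc (a - i)) i.+1) x.

(** The variables are the letter counts [k], followed by [t], [p] and [j].  With
    [c] the counts of the prefix, this is the number of words with the counts
    [k - c], provided that the oracle accepts [k] and that [c <= k]: the multinomial
    coefficient as a product of binomial coefficients. *)
Fixpoint weight (s n : nat) (env : nat -> nat) : nat :=
  let c d := count_digit n (env m.+1) (env m.+2) d in
  if s is s'.+1 then
    if env s' < c s' then 0
    else mulbin n (weight s' n env) (\sum_(d < s) (env d - c d)) (env s' - c s')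
  else S (n :: [seq env v | v <- rcons order m]).

(** The number of words of length [n] that begin with [p] and have the sum number
    [t], as [blockE] shows. *)
Definition block n t p j :=
  boxsum m (weight m) n (fun x => if x is x'.+1 then if x' is 0 then p else j else t).

(** A word below [b] has a first digit in which it differs from [b]. *)
Definition count_below n t b :=
  \sum_(j < n) \sum_(d < m) (if d < digit n b (n - j.+1) then
     block n t (smul K n (shift_digits n b (n - j)) m + d) j.+1 else 0).

Definition smaller_words n t := \sum_(t' < minn t ((n + 2) ^ m)) block n t' 0 0.

(** The ranks [t] with [smaller_words n t.+1 <= l] are those below the wanted one. *)
Definition find_rank n l := \sum_(t' < (n + 2) ^ m) (if l < smaller_words n t'.+1 then 0 else 1).

Definition find_word n l :=
  bsearch (smul K n M1 n)
    (fun b => count_below n (find_rank n l) b <= l - smaller_words n (find_rank n l)).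

Definition find_digit n i l := nth 0 tbl (digit n (find_word n l) (n - i)).

Local Notation definable := (definable S).
Local Notation Dv := (definable_var S).
Local Notation Dc := (definable_const S).

Lemma definable_shift_digits a b : definable a -> definable b ->
  definable (fun n env => shift_digits n (a n env) (b n env)).
Proof.
apply: definable_comp2; apply: (@definable_iter S (fun n env => minn (env 1) n) (fun _ env =>
    env 0)
  (fun n _ acc _ => sdiv K D n acc m)).
- exact/pbounded_minr/pbounded_size.
- exact: (definable_min (Dv 1) (definable_size S)).
- exact: Dv.
- exact: (definable_sdiv _ _ (Dv 0) (Dc m)).
Qed.

Lemma definable_digit a b : definable a -> definable b ->
  definable (fun n env => digit n (a n env) (b n env)).
Proof.
move=> Da Db; have Ds := definable_shift_digits Da Db.
exact: (definable_sub Ds (definable_smul _ (definable_sdiv _ _ Ds (Dc m)) (Dc m))).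
Qed.

Lemma definable_count_digit a b c : definable a -> definable b -> definable c ->
  definable (fun n env => count_digit n (a n env) (b n env) (c n env)).
Proof.
apply: definable_comp3; apply: (@definable_sum S (fun n env => minn (env 1) n)
  (fun n i env => if digit n (env 0) i == env 2 then 1 else 0)).
- exact/pbounded_minr/pbounded_size.
- exact: (definable_min (Dv 1) (definable_size S)).
- exact: (definable_eq (definable_digit (Dv 1) (Dv 0)) (Dv 3) (Dc 1) (Dc 0)).
Qed.

Lemma definable_mulbin a b c : definable a -> definable b -> definable c ->
  definable (fun n env => mulbin n (a n env) (b n env) (c n env)).
Proof.
apply: definable_comp3; apply: (@definable_iter S (fun n env => minn (env 2) n) (fun _ env =>
    env 0)
  (fun n i acc env => sdiv K D n (smul K n acc (env 1 - i)) i.+1)).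
- exact/pbounded_minr/pbounded_size.
- exact: (definable_min (Dv 2) (definable_size S)).
- exact: Dv.
- exact: (definable_sdiv _ _ (definable_smul _ (Dv 0) (definable_sub (Dv 3) (Dv 1)))
    (definable_add (Dc 1) (Dv 1))).
Qed.

Lemma definable_weight s : definable (weight s).
Proof.
have Dd d : definable (fun n env => count_digit n (env m.+1) (env m.+2) d).
  exact: (definable_count_digit (Dv _) (Dv _) (Dc d)).
elim: s => [|s IH]; first exact: definable_ask.
apply: (definable_iflt (Dv s) (Dd s) (Dc 0)).
apply: (definable_mulbin IH _ (definable_sub (Dv s) (Dd s))).
by apply: (@definable_bigsum S s.+1 (fun d n env =>
    env d - count_digit n (env m.+1) (env m.+2) d)) => d;
  exact: (definable_sub (Dv d) (Dd d)).
Qed.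

Lemma definable_block a b c : definable a -> definable b -> definable c ->
  definable (fun n env => block n (a n env) (b n env) (c n env)).
Proof.
apply: definable_comp3.
have [e [d H]] := definable_ren (minn^~ 2) (definable_boxsum m (definable_weight m)).
exists e, d => n env; have [-> ?] := H n env; split => //; rewrite /block.
by congr boxsum; apply: funext => -[|[|[|x]]].
Qed.

Lemma definable_count_below a b : definable a -> definable b ->
  definable (fun n env => count_below n (a n env) (b n env)).
Proof.
apply: definable_comp2; apply: (@definable_sum S (fun n _ => n) (fun n j env => \sum_(d < m)
    (if d < digit n (env 1) (n - j.+1) then
     block n (env 0) (smul K n (shift_digits n (env 1) (n - j)) m + d) j.+1 else 0))).
- exact: pbounded_size.
- exact: definable_size.
apply: (@definable_bigsum S m (fun d n env => if d < digit n (env 2) (n - (env 0).+1) then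
     block n (env 1) (smul K n (shift_digits n (env 2) (n - env 0)) m + d) (env 0).+1 else 0))
         => d.
apply: (definable_iflt (Dc d) _ _ (Dc 0)).
  exact: (definable_digit (Dv 2) (definable_sub (definable_size S) (definable_add (Dc 1) (Dv
      0)))).
apply: (definable_block (Dv 1) _ (definable_add (Dc 1) (Dv 0))).
exact: (definable_add (definable_smul _ (definable_shift_digits (Dv 2) (definable_sub
    (definable_size S) (Dv 0))) (Dc m)) (Dc d)).
Qed.

Lemma definable_smaller_words a : definable a -> definable (fun n env =>
    smaller_words n (a n env)).
Proof.
apply: definable_comp1; apply: (@definable_sum S (fun n env => minn (env 0) ((n + 2) ^ m))
  (fun n t env => block n t 0 0)).
- exact/pbounded_minr/pbounded_exp.
- exact: (definable_min (Dv 0) (definable_exp S m)).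
- exact: (definable_block (Dv 0) (Dc 0) (Dc 0)).
Qed.

Lemma definable_find_rank a : definable a -> definable (fun n env => find_rank n (a n env)).
Proof.
apply: definable_comp1; apply: (@definable_sum S (fun n env => (n + 2) ^ m)
  (fun n t env => if env 0 < smaller_words n t.+1 then 0 else 1)).
- exact: pbounded_exp.
- exact: definable_exp.
- exact: (definable_iflt (Dv 1) (definable_smaller_words (definable_add (Dc 1) (Dv 0))) (Dc 0)
    (Dc 1)).
Qed.

Lemma definable_find_word a : definable a -> definable (fun n env => find_word n (a n env)).
Proof.
apply: definable_comp1; apply: (@definable_bsearch S (fun n _ => smul K n M1 n)
  (fun n env => env 0 - smaller_words n (find_rank n (env 0)))
  (fun n b env => count_below n (find_rank n (env 0)) b)).
- exact: (definable_smul _ (Dc M1) (definable_size S)).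
- apply: pbounded_le (pbounded_mul (pbounded_const M1) pbounded_size) _ => n _.
  by rewrite /smul leq_mul2l geq_minl orbT.
- exact: (definable_sub (Dv 0) (definable_smaller_words (definable_find_rank (Dv 0)))).
- exact: (definable_count_below (definable_find_rank (Dv 1)) (Dv 0)).
Qed.

Lemma definable_find_digit : definable (fun n env => find_digit n (env 0) (env 1)).
Proof.
exact: (definable_nth _ (definable_digit (definable_find_word (Dv 1)) (definable_sub
    (definable_size S) (Dv 0)))).
Qed.

End Algorithm.

(** * Counting words with given letter counts *)

Lemma sum_nat_mul (f : nat -> nat) a m :
  \sum_(0 <= x < a * m) f x = \sum_(y < a) \sum_(d < m) f (y * m + d).
Proof.
elim: a => [|a IH]; first by rewrite mul0n big_nil big_ord0.
rewrite mulSn addnC (big_cat_nat (n := a * m)) ?leq_addr //= IH big_ord_recr /=.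
congr (_ + _); rewrite -{1}[a * m]add0n big_addn addKn big_mkord.
by apply: eq_bigr => i _; rewrite addnC.
Qed.

Section Words.
Variable m : nat.
Hypothesis m1 : 1 < m.

Definition digit_count (q x d : nat) : nat := \sum_(i < q) ((x %/ m ^ i) %% m == d).

Lemma digit_count_cat q j x p d : x < m ^ q ->
  digit_count (q + j) (p * m ^ q + x) d = digit_count q x d + digit_count j p d.
Proof.
move=> xq; rewrite /digit_count -(big_mkord xpredT (fun i =>
    nat_of_bool (((p * m ^ q + x) %/ m ^ i) %% m == d))).
rewrite (big_cat_nat (n := q)) ?leq_addr //= !big_mkord; congr (_ + _).
  apply: eq_bigr => i _; have iq := ltn_ord i.
  have -> : m ^ q = m ^ (q - i) * m ^ i by rewrite -expnD subnK // ltnW.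
  rewrite mulnA divnMDl ?expn_gt0 ?(ltnW m1) //.
  rewrite (_ : q - i = (q - i.+1).+1); last by lia.
  by rewrite expnSr mulnA modnMDl.
rewrite -{1}[q]add0n big_addn addKn big_mkord; apply: eq_bigr => i _.
by rewrite [_ + q]addnC expnD divnMA divnMDl ?expn_gt0 ?(ltnW m1) // (divn_small xq) addn0.
Qed.

Lemma digit_count_le q x d : digit_count q x d <= q.
Proof.
rewrite -[X in _ <= X]card_ord -sum1_card; apply: leq_sum => i _; exact: leq_b1.
Qed.

Lemma sum_digit_count q x : \sum_(d < m) digit_count q x d = q.
Proof.
rewrite exchange_big /= -[RHS]card_ord -sum1_card; apply: eq_bigr => i _.
have lt : (x %/ m ^ i) %% m < m by rewrite ltn_mod ltnW.
rewrite (bigD1 (Ordinal lt)) //= eqxx big1 // => j.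
by rewrite -val_eqE /= eq_sym => /negbTE ->.
Qed.

Definition has_counts q x (u : nat -> nat) : bool :=
  [forall d : 'I_m, digit_count q x d == u d].

Definition nwords q u := \sum_(0 <= x < m ^ q) has_counts q x u.

(** Removing the last letter [d] lowers the count of [d] by one. *)
Lemma has_countsS q y (d : 'I_m) u :
  has_counts q.+1 (y * m + d) u =
  (0 < u d) && has_counts q y (fun e => u e - (e == d)).
Proof.
have E e : digit_count q.+1 (y * m + d) e = ((d : nat) == e) + digit_count q y e.
  rewrite -add1n -[y * m]/(y * m ^ 1) digit_count_cat ?expn1 //.
  by rewrite /digit_count big_ord1 expn0 divn1 modn_small.
apply/forallP/andP => [H|[ud /forallP H] e].
  split; first by have := H d; rewrite E eqxx; lia.
  by apply/forallP => e; have := H e; rewrite E (eq_sym (e : nat)); lia.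
rewrite E (eqP (H e)) (eq_sym (e : nat)).
by case: ((d : nat) =P e) ud => [-> | _]; lia.
Qed.

(** Multiplying by the factorials turns the recursion over the last letter, which
    contributes [u d] of the [q + 1] summands of the total count, into
    [(q + 1)! = q! * (q + 1)]. *)
Lemma nwords_fact q u :
  nwords q u * \prod_(d < m) (u d)`! = if \sum_(d < m) u d == q then q`! else 0.
Proof.
elim: q u => [|q IH] u.
  rewrite /nwords expn0 big_nat1 /has_counts.
  have -> : [forall d : 'I_m, digit_count 0 0 d == u d] = (\sum_(d < m) u d == 0).
    rewrite sum_nat_eq0; apply/forallP/forallP => H d; have := H d;
      by rewrite /digit_count big_ord0 eq_sym.
  case: eqP => [/eqP|_]; last by rewrite mul0n.
  by rewrite sum_nat_eq0 => /forallP H; rewrite mul1n big1 // => d _; rewrite (eqP (H d)).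
rewrite /nwords expnSr sum_nat_mul exchange_big big_distrl /=.
have E (d : 'I_m) : (\sum_(y < m ^ q) has_counts q.+1 (y * m + d) u) * \prod_(e < m) (u e)`! =
    u d * (if \sum_(e < m) u e == q.+1 then q`! else 0).
  have [u0|ud] := posnP (u d).
    by rewrite u0 mul0n big1 // => y _; rewrite has_countsS u0.
  have E1 (i : 'I_m) : i != d -> u i - (val i == val d) = u i.
    by move=> /negbTE; rewrite -val_eqE /= => ->; rewrite subn0.
  have /= := IH (fun e => u e - (e == d)).
  have -> : \sum_(e < m) (u e - (e == d :> nat)) = (u d).-1 + \sum_(e < m | e != d) u e.
    by rewrite (bigD1 d) //= eqxx subn1; congr (_ + _); exact: eq_bigr.
  have -> : \prod_(e < m) (u e - (e == d :> nat))`! = (u d).-1`! * \prod_(e < m | e != d) (u e)`!.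
    by rewrite (bigD1 d) //= eqxx subn1; congr (_ * _); apply: eq_bigr => e /E1 ->.
  have -> : \prod_(e < m) (u e)`! = (u d)`! * \prod_(e < m | e != d) (u e)`! by exact: bigD1.
  have -> : \sum_(e < m) u e = u d + \sum_(e < m | e != d) u e by exact: bigD1.
  have -> : nwords q (fun e => u e - (e == d)) = \sum_(y < m ^ q) has_counts q.+1 (y * m + d) u.
    by rewrite /nwords big_mkord; apply: eq_bigr => y _; rewrite has_countsS ud.
  move: ud; case: (u d) => // w _; rewrite factS /= addSn eqSS => H.
  rewrite -[_.+1 * _ * _]mulnA mulnCA H.
  by [].
rewrite (eq_bigr _ (fun d _ => E d)) -big_distrl /=.
by case: eqP => [->|_]; rewrite ?muln0 // factS.
Qed.

(** The multinomial coefficient of the first [j] counts. *)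
Definition binprod (j : nat) (u : nat -> nat) : nat :=
  \prod_(s < j) 'C(\sum_(d < s.+1) u d, u s).

Lemma binprod_fact j u : binprod j u * \prod_(s < j) (u s)`! = (\sum_(d < j) u d)`!.
Proof.
elim: j => [|j IH]; first by rewrite /binprod !big_ord0.
rewrite /binprod !big_ord_recr /= -/(binprod j u).
rewrite mulnACA IH -(bin_fact (leq_addl (\sum_(i < j) u i) (u j))) addnK.
by rewrite mulnC mulnA.
Qed.

Lemma nwordsE q u : nwords q u = if \sum_(d < m) u d == q then binprod m u else 0.
Proof.
have p0 : 0 < \prod_(d < m) (u d)`! by rewrite prodn_gt0 // => d; exact: fact_gt0.
apply/eqP; rewrite -(eqn_pmul2r p0) nwords_fact.
by case: ifP => [/eqP <-|_] //; rewrite binprod_fact.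
Qed.

End Words.

(** * Correctness of the algorithm *)

Lemma boxsum_ext j f g n env :
  (forall env', (forall d, d < j -> env' d <= n) -> (forall d, env' (j + d) = env d) ->
     f n env' = g n env') ->
  boxsum j f n env = boxsum j g n env.
Proof.
elim: j env => [|j IH] env H /=; first by apply: H.
apply: eq_bigr => a _; apply: IH => env' le' tl; apply: H => [d|d].
  rewrite ltnS leq_eqVlt => /orP [/eqP ->|]; last exact: le'.
  by rewrite -[j]addn0 tl /= -ltnS.
by rewrite addSnnS tl.
Qed.

Lemma forall_ord_recr j (P : pred nat) :
  [forall d : 'I_j.+1, P d] = [forall d : 'I_j, P d] && P j.
Proof.
apply/forallP/andP => [H|[/forallP H e] d].
  split; last exact: (H ord_max).
  by apply/forallP => d; exact: (H (widen_ord (leqnSn j) d)).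
have := ltn_ord d; rewrite ltnS leq_eqVlt => /orP [/eqP ->|dj] //.
exact: (H (Ordinal dj)).
Qed.

(** Summing the indicator of a vector over all vectors evaluates at this vector. *)
Lemma boxsum_delta j (g : (nat -> nat) -> nat) (v : nat -> nat) n env :
  (forall d, d < j -> v d <= n) ->
  boxsum j (fun _ env' => [forall d : 'I_j, env' d == v d] * g env') n env =
  g (fun x => if x < j then v x else env (x - j)).
Proof.
elim: j g env => [|j IH] g env vn /=.
  rewrite (_ : [forall d : 'I_0, _]) ?mul1n; last by apply/forallP => -[].
  by congr g; apply: funext => x; rewrite subn0.
have vj : v j < n.+1 by rewrite ltnS vn.
(* The first variable to be summed is the last one of the new environment. *)
have E a : boxsum j (fun _ env' => [forall d : 'I_j.+1, env' d == v d] * g env') n (scons a env) =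
    (a == v j) * g (fun x => if x < j then v x else scons a env (x - j)).
  transitivity (boxsum j (fun _ env' => [forall d : 'I_j, env' d == v d] *
      ((env' j == v j) * g env')) n (scons a env)).
    apply: boxsum_ext => env' _ _; rewrite mulnA; congr (_ * _).
    by rewrite mulnb (forall_ord_recr j (fun d => env' d == v d)).
  rewrite IH => [|d dj]; last by rewrite vn // ltnW.
  by rewrite ltnn subnn.
rewrite (bigD1 (Ordinal vj)) //= E eqxx mul1n big1 ?addn0 => [|a ne].
  congr g; apply: funext => x.
  rewrite ltnS; case: (ltngtP x j) => [//|jx|->]; last by rewrite subnn.
  by rewrite -(subnK jx) addnK addnS -addSn addnK.
rewrite E (_ : (a : nat) == v j = false) //.
by apply: contraNF ne => /eqP H; apply/eqP/val_inj.
Qed.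

Lemma boxsum_sum (I : Type) (r : seq I) j (f : I -> nat -> (nat -> nat) -> nat) n env :
  boxsum j (fun n env => \sum_(i <- r) f i n env) n env =
  \sum_(i <- r) boxsum j (f i) n env.
Proof.
elim: j env => //= j IH env; rewrite exchange_big /=.
by apply: eq_bigr => a _.
Qed.

Lemma binprodS s u : binprod s.+1 u = binprod s u * 'C(\sum_(d < s.+1) u d, u s).
Proof. by rewrite /binprod big_ord_recr. Qed.

Section Correctness.
Variables (S : seq nat -> bool) (m M1 : nat) (order tbl : seq nat) (n : nat).
Hypothesis m1 : 1 < m.
Hypothesis order_lt : all (fun d => d < m) order.

(* All dividends that occur are at most [2 ^ (n * (m + 2))]: a product of at most [m]
   binomial coefficients, one more, and a factor of at most [n]. *)
Let D := m.+2.
Let E := (n + 2) ^ D.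

Definition accepts (k : nat -> nat) (t : nat) : bool :=
  S (n :: rcons [seq k d | d <- order] t).

(* Only with the right sum do the counts of the completions add up to their length. *)
Hypothesis accepts_sum : forall k t, accepts k t -> \sum_(d < m) k d = n.

Lemma accepts_ext k k' t : (forall d, d < m -> k d = k' d) -> accepts k t = accepts k' t.
Proof.
move=> kk; congr (S (n :: rcons _ t)); apply/eq_in_map => d /(allP order_lt); exact: kk.
Qed.

Lemma exponent_bound : n * m.+2 < E.
Proof.
rewrite /E /D expnS; have : m.+2 <= (n + 2) ^ m.+1; last by nia.
apply: leq_trans (_ : 2 ^ m.+1 <= _); first exact: ltn_expl.
by rewrite leq_exp2r // leq_addl.
Qed.

Lemma pow_bound k : k <= n * m.+2 -> 2 ^ k < 2 ^ E.
Proof. by move=> H; rewrite ltn_exp2l // (leq_ltn_trans H exponent_bound). Qed.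

Lemma word_bound b : b < m ^ n -> b < 2 ^ E.
Proof.
move=> H; apply: leq_trans H _; apply: ltnW.
apply: leq_ltn_trans (_ : 2 ^ (m * n) < _); last by apply: pow_bound; lia.
by rewrite expnM; case: (n) => // k; rewrite leq_exp2r // ltnW // ltn_expl.
Qed.

Lemma shift_digitsE b p : b < m ^ n -> p <= n -> shift_digits m D n b p = b %/ m ^ p.
Proof.
move=> bm pn; rewrite /shift_digits (minn_idPl pn); elim: p pn => [_|p IH pn] /=.
  by rewrite expn0 divn1.
rewrite IH; last exact: ltnW.
rewrite sdivE; first by rewrite expnSr divnMA.
  lia.
by apply: leq_ltn_trans (word_bound bm); exact: leq_div.
Qed.

Lemma digitE b p : b < m ^ n -> p <= n -> digit m D n b p = (b %/ m ^ p) %% m.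
Proof.
move=> bm pn; rewrite /digit shift_digitsE // sdivE; first last.
- by apply: leq_ltn_trans (word_bound bm); exact: leq_div.
- lia.
rewrite /smul (minn_idPl _); last lia.
by rewrite {1}(divn_eq (b %/ m ^ p) m) addKn.
Qed.

Lemma count_digitE j p d : j <= n -> p < m ^ n -> count_digit m D n p j d = digit_count m j p d.
Proof.
move=> jn pm; rewrite /count_digit (minn_idPl jn); apply: eq_bigr => i _.
have ij := ltn_ord i; by rewrite digitE //; lia.
Qed.

Lemma mulbin0 a b : mulbin m D n 0 a b = 0.
Proof.
rewrite /mulbin; elim: (minn b n) (geq_minr b n) => //= k IH kn.
by rewrite IH ?(ltnW kn) // /smul mul0n sdivE ?div0n ?expn_gt0 //; lia.
Qed.

Lemma bin_le_exp2 a b : 'C(a, b) <= 2 ^ a.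
Proof.
have [ba|] := leqP b a; last by move=> /bin_small ->.
rewrite -[2]/(1 + 1) expnDn (bigD1 (Ordinal (ba : b < a.+1))) //= !exp1n !muln1.
exact: leq_addr.
Qed.

Lemma mulbinE x a b : x <= 2 ^ (n * m) -> a <= n -> b <= n ->
  mulbin m D n x a b = x * 'C(a, b).
Proof.
move=> xm an bn; rewrite /mulbin (minn_idPl bn); elim: b bn => [_|b IH bn] /=.
  by rewrite bin0 muln1.
rewrite IH ?(ltnW bn) // /smul (minn_idPl _); last lia.
have ab : x * 'C(a, b) * (a - b) = x * 'C(a, b.+1) * b.+1.
  by rewrite -!mulnA (mulnC 'C(a, b)) -mul_bin_left (mulnC b.+1).
rewrite ab sdivE ?mulnK //; first lia.
rewrite -ab; apply: leq_ltn_trans (_ : 2 ^ (n * m) * 2 ^ n * 2 ^ n < _).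
  rewrite !leq_mul //; last by rewrite (leq_trans (leq_subr _ _)) // (leq_trans an) // ltnW //
      ltn_expl.
  by apply: leq_trans (bin_le_exp2 a b) _; rewrite leq_exp2l.
by rewrite -!expnD; apply: pow_bound; lia.
Qed.

(** The partial products stay below the bound under which the divisions are exact,
    since the partial sums of the counts are at most [n]. *)
Lemma weightE s env : s <= m -> (forall d, d < m -> env d <= n) ->
  let u d := env d - digit_count m (env m.+2) (env m.+1) d in
  env m.+2 <= n -> env m.+1 < m ^ n ->
  weight S m D order s n env =
    if accepts env (env m) && [forall d : 'I_s, digit_count m (env m.+2) (env m.+1) d <= env d]
    then binprod s u else 0.
Proof.
move=> sm envn u jn pn; have [sat|nsat] /= := boolP (accepts env (env m)); last first.
  suff -> : weight S m D order s n env = 0 by [].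
  elim: s {sm} => [|s IH] /=; last by rewrite IH mulbin0; case: ifP.
  by move: nsat; rewrite /accepts map_rcons => /negbTE ->.
elim: s sm => [_|s IH sm] /=.
  rewrite (_ : [forall d : 'I_0, _]); last by apply/forallP => -[].
  by move: sat; rewrite /accepts map_rcons /binprod big_ord0 => ->.
rewrite count_digitE // IH ?(ltnW sm) //.
rewrite (forall_ord_recr s (fun d => digit_count m (env m.+2) (env m.+1) d <= env d)).
rewrite ltnNge; case: (digit_count _ _ _ s <= _) => /=; last by rewrite andbF.
rewrite andbT; case: ifP => _; last exact: mulbin0.
rewrite (eq_bigr (fun d : 'I_s.+1 => u d)) => [|d _]; last by rewrite count_digitE.
rewrite binprodS.
have usum k : k <= m -> \sum_(d < k) u d <= n.
  move=> km; rewrite -(accepts_sum sat) -[X in _ <= X](big_mkord xpredT).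
  rewrite (big_cat_nat (n := k)) //= big_mkord; apply: leq_trans (leq_addr _ _).
  by apply: leq_sum => d _; exact: leq_subr.
apply: mulbinE; first last.
- exact: leq_trans (leq_subr _ _) (envn _ sm).
- exact: usum.
apply: leq_trans (_ : 2 ^ (n * s) <= _); last first.
  by rewrite leq_exp2l // leq_mul2l (ltnW sm) orbT.
elim: s {IH} sm => [_|s IH sm]; first by rewrite muln0 /binprod big_ord0.
rewrite binprodS mulnSr expnD leq_mul //; first exact: IH (ltnW sm).
apply: leq_trans (bin_le_exp2 _ _) _.
by rewrite leq_exp2l // usum // ltnW.
Qed.

Definition accepted (t l : nat) : bool := accepts (digit_count m n l) t.

(** The completions are classified by the letter counts of the whole word: the
    vector of counts of a word occurs exactly once in the summation. *)
Lemma blockE t p j : j <= n -> p < m ^ j ->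
  block S m D order n t p j = \sum_(0 <= q < m ^ (n - j)) accepted t (p * m ^ (n - j) + q).
Proof.
move=> jn pm; rewrite /block; set env0 := fun x => _.
have pn : p < m ^ n by rewrite (leq_trans pm) // leq_exp2l.
have E2 q d : q < m ^ (n - j) ->
    digit_count m n (p * m ^ (n - j) + q) d = digit_count m (n - j) q d + digit_count m j p d.
  by move=> qm; rewrite -(digit_count_cat m1 j p d qm) subnK.
transitivity (boxsum m (fun _ env => \sum_(0 <= q < m ^ (n - j))
    [forall d : 'I_m, env d == digit_count m n (p * m ^ (n - j) + q) d] * accepts env (env m))
        n env0).
  apply: boxsum_ext => env' le' tl.
  have [tm pm1 jm2] : [/\ env' m = t, env' m.+1 = p & env' m.+2 = j].
    by rewrite -[m]addn0 tl -addnS tl -addnS tl.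
  rewrite weightE ?jm2 ?pm1 ?tm //.
  have [sat|nsat] := boolP (accepts env' t); last by rewrite big1 // => q _; rewrite muln0.
  rewrite /= (eq_bigr _ (fun q _ => muln1 _)) /=.
  case: ifP => [/forallP le|/forallP nle]; last first.
    rewrite big_nat big1 // => q /= qm; apply/eqP; rewrite eqb0; apply: contraPN nle.
    move=> /forallP H H'; apply: H' => d.
    by rewrite (eqP (H d)) E2 // leq_addl.
  set u := fun d => env' d - _.
  have us : \sum_(d < m) u d = n - j.
    have : \sum_(d < m) u d + \sum_(d < m) digit_count m j p d = \sum_(d < m) env' d.
      by rewrite -big_split; apply: eq_bigr => d _ /=; rewrite /u subnK.
    by rewrite sum_digit_count // (accepts_sum sat) => <-; rewrite addnK.
  have := nwordsE m1 (n - j) u; rewrite us eqxx => <-.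
  rewrite /nwords !big_nat; apply: eq_bigr => q /= qm; congr (nat_of_bool _).
  apply/forallP/forallP => H d; have := H d; rewrite E2 // /u.
    by have := le d; lia.
  by have := le d; lia.
rewrite boxsum_sum; apply: eq_bigr => q _.
rewrite (boxsum_delta (fun env => accepts env (env m)) (v := digit_count m n _)) => [|d _].
  rewrite ltnn subnn /accepted /=; congr (nat_of_bool _); apply: accepts_ext => d dm.
  by rewrite dm.
exact: digit_count_le.
Qed.

(** By induction on the length of the prefix of [b]: the words below the prefix
    filled up with zeros are those below the prefix without its last digit,
    filled up with zeros, and the blocks for the smaller values of this digit. *)
Lemma count_belowE t b : b < m ^ n ->
    count_below S m D order n t b = \sum_(0 <= l < b) accepted t l.
Proof.
move=> bm; rewrite /count_below.
suff H J : J <= n -> \sum_(j < J) \sum_(d < m) (if d < digit m D n b (n - j.+1) then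
     block S m D order n t (smul m.+1 n (shift_digits m D n b (n - j)) m + d) j.+1 else 0) =
    \sum_(0 <= l < b %/ m ^ (n - J) * m ^ (n - J)) accepted t l.
  by rewrite H // subnn expn0 divn1 muln1.
elim: J => [_|J IH Jn].
  by rewrite big_ord0 subn0 divn_small // mul0n big_nil.
rewrite big_ord_recr /= IH; last exact: ltnW.
have e1 : n - J = (n - J.+1).+1 by lia.
set e := n - J.+1; set B := b %/ m ^ (n - J).
rewrite digitE ?shift_digitsE //; [|lia|lia]; rewrite -/e -/B.
set g := (b %/ m ^ e) %% m.
have gm : g < m by rewrite ltn_mod; lia.
have BE : b %/ m ^ e = B * m + g.
  by rewrite /B e1 expnSr divnMA -divn_eq.
have Bm : B < m ^ J.
  by rewrite /B ltn_divLR ?expn_gt0 ?(ltnW m1) // -expnD subnKC // ltnW.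
rewrite [in RHS]BE mulnDl [RHS](big_cat_nat (n := B * m * m ^ e)) ?leq_addr //=.
congr (_ + _); first by rewrite e1 expnS mulnA.
rewrite -{1}[B * m * m ^ e]add0n big_addn addKn sum_nat_mul -big_mkcond /=.
rewrite (big_ord_widen_cond m xpredT (fun d =>
    \sum_(i < m ^ e) accepted t (d * m ^ e + i + B * m * m ^ e))) ?(ltnW gm) //=.
apply: eq_bigr => d dg; rewrite /smul (minn_idPl _); last lia.
rewrite blockE //; last first.
  by rewrite expnSr; have := ltn_ord d; move: Bm; nia.
rewrite -/e big_mkord; apply: eq_bigr => i _; congr (nat_of_bool (accepted t _)).
by rewrite mulnDl; lia.
Qed.

Definition rank_words (t : nat) := \sum_(0 <= l < m ^ n) accepted t l.

Lemma smaller_wordsE t : t <= (n + 2) ^ m ->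
    smaller_words S m D order n t = \sum_(t' < t) rank_words t'.
Proof.
move=> tm; rewrite /smaller_words (minn_idPl tm); apply: eq_bigr => t' _.
rewrite blockE ?expn0 // subn0; apply: eq_bigr => l _.
by rewrite mul0n.
Qed.

Lemma leq_sum_rank_words t t' : t <= t' ->
    \sum_(i < t) rank_words i <= \sum_(i < t') rank_words i.
Proof.
move=> tt; rewrite -!(big_mkord xpredT rank_words) [X in _ <= X](big_cat_nat (n := t)) //=.
exact: leq_addr.
Qed.

Lemma find_rankE t l : t < (n + 2) ^ m ->
  \sum_(t' < t) rank_words t' <= l < \sum_(t' < t.+1) rank_words t' ->
  find_rank S m D order n l = t.
Proof.
move=> tB /andP [tl lt]; rewrite /find_rank.
rewrite -[RHS]card_ord -sum1_card (big_ord_widen _ (fun=> 1) (ltnW tB)) [RHS]big_mkcond /=.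
apply: eq_bigr => t' _; rewrite smaller_wordsE //.
have [t't|tt'] := ltnP t' t; last by rewrite (leq_trans lt) // leq_sum_rank_words.
by rewrite ltnNge (leq_trans _ tl) // leq_sum_rank_words.
Qed.

Hypothesis mE : m = 2 ^ M1.

(** The count of the words below a bound exceeds that of [b] as soon as the bound
    exceeds [b], because [b] itself is counted then. *)
Lemma find_wordE t b l : find_rank S m D order n l = t -> b < m ^ n -> accepted t b ->
  \sum_(0 <= x < b) accepted t x = l - smaller_words S m D order n t ->
  find_word S m M1 D order n l = b.
Proof.
move=> ft bm gb bl; rewrite /find_word ft /smul (minn_idPl (leq_addr _ _)).
have mn : m ^ n = 2 ^ (M1 * n) by rewrite mE -expnM.
apply: bsearchP => [|x]; rewrite -mn // => xm; rewrite count_belowE // -bl.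
have [xb|bx] := leqP x b.
  by rewrite [X in _ <= X](big_cat_nat (n := x)) //= leq_addr.
apply/negbTE; rewrite -ltnNge [X in _ < X](big_cat_nat (n := b.+1)) //=.
by rewrite big_nat_recr //= gb addn1 leq_addr.
Qed.

Lemma find_digitE t b i l : find_rank S m D order n l = t -> b < m ^ n -> accepted t b ->
  \sum_(0 <= x < b) accepted t x = l - smaller_words S m D order n t ->
  find_digit S m M1 D order tbl n i l = nth 0 tbl ((b %/ m ^ (n - i)) %% m).
Proof.
by move=> ft bm gb bl; rewrite /find_digit (find_wordE ft bm gb bl) digitE // leq_subr.
Qed.

End Correctness.

Import Order.TTheory.

(** * The order of the coordinates *)

(** The last position of row [p + 1]: the coordinate [p], as [jcol_row_end] shows. *)
Definition row_end (M p : nat) : nat := \sum_(1 <= q < p.+2) rowlen M q.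

(** Row [i * (M + 1) + k + 1] with [k <= M] has length [i + 1], so its entry in
    column [i + 1] is its last one. *)
Lemma jcol_row_end M i k : k < M.+1 -> jcol M i.+1 k.+1 = row_end M (i * M.+1 + k).
Proof.
move=> kM; rewrite /jcol /entry /row_end [_ + k.+1]addnS [RHS]big_nat_recr //=; congr (_ + _).
by rewrite /rowlen /= divnMDl // divn_small ?addn0.
Qed.

Lemma row_end_mono M p q : p < q -> row_end M p < row_end M q.
Proof.
move=> pq; rewrite /row_end [X in _ < X](big_cat_nat (n := p.+2)) //=.
rewrite -[X in X < _]addn0 ltn_add2l.
  by rewrite (big_ltn (m := p.+2)) // ltn_addr.
by rewrite ltnS ltnW.
Qed.

Lemma row_end_inj M : injective (row_end M).
Proof.
move=> p q E; case: (ltngtP p q) => // /(row_end_mono M); by rewrite E ltnn.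
Qed.

Lemma row_end_gt0 M p : 0 < row_end M p.
Proof. by rewrite /row_end big_nat_recr //= addnC. Qed.

(** Hence listing the coordinates column by column is listing them increasingly. *)
Lemma JbarE M n : Jbar M n = [seq row_end M p | p <- iota 0 (nbits M n)].
Proof.
have E : [seq jcol M i k | i <- iota 1 n, k <- iota 1 M.+1] =
    [seq row_end M p | p <- iota 0 (nbits M n)].
  rewrite /nbits; elim: n => [|n IH]; first by rewrite mul0n.
  rewrite -[n.+1]addn1 iotaD map_cat flatten_cat IH mulnDl mul1n (iotaD 0) map_cat;
      congr (_ ++ _).
  have F t : flatten [seq [seq jcol M i k | k <- t] | i <- iota (1 + n) 1] =
      [seq jcol M n.+1 k | k <- t] by rewrite /= cats0 add1n.
  rewrite F add0n -[in RHS](addn0 (n * M.+1)) iotaDl.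
  rewrite (iotaDl 1 0 M.+1 : iota 1 M.+1 = _) -!map_comp.
  by apply/eq_in_map => k; rewrite mem_iota /= => kM; rewrite add1n jcol_row_end // addn0.
rewrite /Jbar E sorted_sort //; first exact: leq_trans.
rewrite sorted_map; apply: (sub_sorted (e := ltn)); last exact: iota_ltn_sorted.
by move=> p q pq; exact/ltnW/row_end_mono.
Qed.

Lemma mem_Jbar M n p : p < nbits M n -> row_end M p \in Jbar M n.
Proof. by move=> pn; rewrite JbarE map_f // mem_iota. Qed.

Lemma index_Jbar M n p : p < nbits M n -> index (row_end M p) (Jbar M n) = p.
Proof.
move=> pn; rewrite JbarE index_map; last exact: row_end_inj.
by rewrite -{1}[p]add0n -(nth_iota 0 0 pn) index_uniq ?size_iota ?iota_uniq.
Qed.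

(** * Lexicographic order of bit vectors *)

(** Most significant bit first; higher bits of [l] are ignored. *)
Fixpoint bits (N l : nat) : seq bool :=
  if N is N'.+1 then odd (l %/ 2 ^ N') :: bits N' l else [::].

Lemma size_bits N l : size (bits N l) = N.
Proof. by elim: N => //= N ->. Qed.

Lemma nth_bits N l p : p < N -> nth false (bits N l) p = odd (l %/ 2 ^ (N - p.+1)).
Proof.
elim: N p => // N IH [|p] pN /=; first by rewrite subn1.
by rewrite IH // subSS.
Qed.

Lemma modn_top N l : l %% 2 ^ N.+1 = odd (l %/ 2 ^ N) * 2 ^ N + l %% 2 ^ N.
Proof.
rewrite {1}(divn_eq l (2 ^ N)) -{1}(odd_double_half (l %/ 2 ^ N)).
rewrite mulnDl -muln2 -mulnA -expnS addnAC addnC modnMDl modn_small //.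
have : l %% 2 ^ N < 2 ^ N by rewrite ltn_mod expn_gt0.
by rewrite expnS; case: odd; lia.
Qed.

Lemma bits_mod N l : bits N (l %% 2 ^ N) = bits N l.
Proof.
have H k c : k <= N -> bits k (c * 2 ^ N + l %% 2 ^ N) = bits k (l %% 2 ^ N).
  elim: k => //= k IH kN; rewrite IH ?(ltnW kN) //; congr (_ :: _).
  rewrite -{1}(subnK (ltnW kN)) expnD mulnA divnMDl ?expn_gt0 // oddD.
  by rewrite (_ : N - k = (N - k.+1).+1) ?expnS ?mulnA ?oddM ?andbF //; lia.
by rewrite [in RHS](divn_eq l (2 ^ N)) H.
Qed.

Lemma bits_inj N l l' : bits N l = bits N l' -> l %% 2 ^ N = l' %% 2 ^ N.
Proof.
elim: N => [|N IH] /=; first by rewrite !modn1.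
by case=> E /IH E'; rewrite !modn_top E E'.
Qed.

Lemma bits_surj (s : seq bool) : exists2 l, l < 2 ^ size s & bits (size s) l = s.
Proof.
elim: s => [|b s [l lN E]]; first by exists 0.
exists (b * 2 ^ size s + l); first by rewrite /= expnS; case: b; lia.
rewrite /= divnMDl ?expn_gt0 // divn_small // addn0 oddb; congr (_ :: _).
by rewrite -bits_mod modnMDl modn_small.
Qed.

Lemma bits_le N l l' : l %% 2 ^ N <= l' %% 2 ^ N ->
  ((bits N l : seqlexi bool) <= (bits N l' : seqlexi bool))%O.
Proof.
elim: N l l' => // N IH l l'; rewrite !modn_top /= lexi_cons => H.
have r : l %% 2 ^ N < 2 ^ N by rewrite ltn_mod expn_gt0.
have r' : l' %% 2 ^ N < 2 ^ N by rewrite ltn_mod expn_gt0.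
case: (odd (l %/ 2 ^ N)) (odd (l' %/ 2 ^ N)) H => [] [] //= H; try (apply: IH; lia).
by exfalso; lia.
Qed.

(** The binary expansions of [0], [1], ... are strictly increasing and exhaust the
    bit vectors, and a sorted list is determined by its members. *)
Lemma lexvecE M n l : l < 2 ^ nbits M n -> lexvec M n l = bits (nbits M n) l.
Proof.
move=> lN; rewrite /lexvec; set N := nbits M n in lN *.
pose t l : N.-tuplelexi bool := Tuple (introT eqP (size_bits N l)).
have -> : sort <=%O (enum [set: N.-tuplelexi bool]%SET) = [seq t l | l <- iota 0 (2 ^ N)].
  apply: le_sorted_eq; first exact: sort_le_sorted.
    rewrite sorted_map; apply: (sub_in_sorted (e := ltn) (P := fun l => l < 2 ^ N)).
    - by move=> a b aN bN ab; apply: bits_le; rewrite !modn_small // ltnW.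
    - by apply/allP => a; rewrite mem_iota.
    - exact: iota_ltn_sorted.
  rewrite perm_sort; apply: uniq_perm; first exact: enum_uniq.
    rewrite map_inj_in_uniq ?iota_uniq // => a b; rewrite !mem_iota /= => aN bN [] /bits_inj.
    by rewrite !modn_small.
  move=> w; rewrite mem_enum inE; apply/esym/mapP.
  have [a aN E] := bits_surj w; rewrite size_tuple in aN E.
  by exists a; [rewrite mem_iota | apply/val_inj].
by rewrite -map_comp (nth_map 0) ?size_iota // nth_iota.
Qed.

Import GRing.Theory Num.Theory.
Import numFieldNormedType.Exports.
Local Open Scope classical_set_scope.
Local Open Scope ring_scope.

(** * Binary digits of real numbers *)

Section Digits.
Variable R : realType.
Implicit Types (x : R) (e : nat -> bool) (N : nat).

Let natS (a : nat) : a.+1%:R = a%:R + 1 :> R. Proof. by rewrite natr1. Qed.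

Definition scaled x N : nat := Num.truncn (x * 2 ^+ N).

Lemma scaledP x N : 0 <= x -> (scaled x N)%:R <= x * 2 ^+ N < (scaled x N).+1%:R.
Proof. by move=> x0; apply: truncn_itv; rewrite mulr_ge0 // exprn_ge0. Qed.

Lemma scaled0 x : 0 <= x < 1 -> scaled x 0 = 0%N.
Proof. by move=> /andP [x0 x1]; apply: truncn_def; rewrite expr0 mulr1 x0 x1. Qed.

Lemma scaled_half x N : 0 <= x -> (scaled x N.+1)./2 = scaled x N.
Proof.
move=> x0; apply/esym/truncn_def.
have := scaledP N.+1 x0; set T := scaled x N.+1; rewrite exprSr mulrA.
have TE : T%:R = (odd T)%:R + T./2%:R * 2 :> R.
  by rewrite -natrM -natrD muln2 odd_double_half.
rewrite (natS T) TE (natS T./2); set y := x * 2 ^+ N => /andP [H1 H2].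
have : ((odd T)%:R : R) <= 1 by rewrite lern1 leq_b1.
have : 0 <= ((odd T)%:R : R) by [].
by move=> b0 b1; apply/andP; split; lra.
Qed.

Lemma scaled_div x N k : 0 <= x -> scaled x N = (scaled x (N + k) %/ 2 ^ k)%N.
Proof.
move=> x0; elim: k => [|k IH]; first by rewrite addn0 expn0 divn1.
by rewrite expnS divnMA divn2 addnS scaled_half.
Qed.

Lemma scaledS x N : 0 <= x -> scaled x N.+1 = (odd (scaled x N.+1) + (scaled x N).*2)%N.
Proof. by move=> x0; rewrite -(scaled_half N x0) odd_double_half. Qed.

Lemma scaled_lt x N : 0 <= x < 1 -> (scaled x N < 2 ^ N)%N.
Proof.
move=> x01; elim: N => [|N IH]; first by rewrite scaled0.
case/andP: (x01) => x0 _; rewrite scaledS // expnS; case: odd; lia.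
Qed.

Definition partial e N : R := \sum_(1 <= i < N.+1) (e i)%:R * 2^-1 ^+ i.

Lemma partialS e N : partial e N.+1 = partial e N + (e N.+1)%:R * 2^-1 ^+ N.+1.
Proof. by rewrite /partial big_nat_recr. Qed.

Lemma partial_scaled x N : 0 <= x < 1 ->
  partial (fun i => odd (scaled x i)) N = (scaled x N)%:R * 2^-1 ^+ N.
Proof.
move=> x01; elim: N => [|N IH]; first by rewrite scaled0 // mul0r /partial big_nil.
case/andP: (x01) => x0 _.
rewrite partialS IH [in RHS]scaledS // natrD -muln2 natrM mulrDl addrC; congr (_ + _).
by rewrite -mulrA exprS mulrA mulrA mulfK.
Qed.

(** The partial sum is [x] rounded down to [N] digits.  If all digits from some
    place on were 1, then from there on [x] rounded up would not depend on the
    number of digits; this number exceeds [x], but by less than any [2 ^- N]. *)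
Lemma binary_expansion_scaled x : 0 <= x < 1 ->
  binary_expansion x (fun i => odd (scaled x i)).
Proof.
move=> x01; case/andP: (x01) => x0 x1; split.
  apply/cvgrPdist_le => eps eps0.
  have h : `|2^-1 : R| < 1 by rewrite ger0_norm //; lra.
  have /cvgrPdist_le /(_ _ eps0) [N _ HN] := cvg_expr h.
  exists N => // k kN /=.
  have := HN k kN; rewrite sub0r normrN ger0_norm ?exprn_ge0 ?invr_ge0 //.
  apply: le_trans.
  rewrite -/(partial _ k) partial_scaled //.
  have := scaledP k x0; set T := (scaled x k)%:R; rewrite (natS (scaled x k)) -/T.
  have p0 : 0 < 2^-1 ^+ k :> R by rewrite exprn_gt0 // invr_gt0.
  have pE : x = x * 2 ^+ k * 2^-1 ^+ k.
    by rewrite -mulrA -exprMn divff ?expr1n ?mulr1 // pnatr_eq0.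
  move=> /andP [H1 H2]; rewrite {1}pE -mulrBl normrM (gtr0_norm p0) ger0_norm ?subr_ge0 //.
  by rewrite ler_piMl ?(ltW p0) // lerBlDl ltW.
move=> N; apply: contrapT => H.
have odd1 i : (N < i)%N -> odd (scaled x i).
  by move=> Ni; apply: contrapT => /negP /negbTE E; apply: H; exists i.
have step k : (scaled x (N + k)).+1%:R * 2^-1 ^+ (N + k) = (scaled x N).+1%:R * 2^-1 ^+ N :> R.
  elim: k => [|k IH]; first by rewrite addn0.
  rewrite -IH addnS [in LHS]scaledS // odd1; last by rewrite ltnS leq_addr.
  rewrite (_ : (true + _).+1 = (scaled x (N + k)).+1 * 2)%N; last by rewrite /=; lia.
  by rewrite natrM exprS mulrA mulfK.
set y := (scaled x N).+1%:R * 2^-1 ^+ N in step.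
have xy : x < y.
  have /andP [_ H2] := scaledP N x0; rewrite /y exprVn ltr_pdivlMr // exprn_gt0 //.
have h : `|2^-1 : R| < 1 by rewrite ger0_norm //; lra.
have d0 : 0 < (y - x) / 2 by rewrite divr_gt0 // subr_gt0.
have /cvgrPdist_le /(_ _ d0) [K _ HK] := cvg_expr h.
have := HK (N + K)%N (leq_addl _ _).
rewrite /= sub0r normrN ger0_norm ?exprn_ge0 ?invr_ge0 // => hb.
have p0 : 0 < 2^-1 ^+ (N + K) :> R by rewrite exprn_gt0 // invr_gt0.
have /andP [H1 _] := scaledP (N + K) x0.
have pE : x = x * 2 ^+ (N + K) * 2^-1 ^+ (N + K).
  by rewrite -mulrA -exprMn divff ?expr1n ?mulr1 // pnatr_eq0.
have ax : (scaled x (N + K))%:R * 2^-1 ^+ (N + K) <= x.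
  by rewrite [leRHS]pE ler_wpM2r // ltW.
have := step K; rewrite (natS (scaled x (N + K))) mulrDl mul1r => st.
by rewrite -st in xy d0 hb; lra.
Qed.

(** A later digit 0 makes the tail of the expansion strictly smaller than the last
    place of the partial sum, which is therefore [x] rounded down. *)
Lemma binary_expansion_unique x e N : binary_expansion x e ->
  (0 < N)%N -> e N = odd (scaled x N).
Proof.
move=> [ecvg ezero].
have lo k : partial e k <= x.
  have nd : nondecreasing_seq (partial e).
    apply/nondecreasing_seqP => i; rewrite partialS lerDl.
    by rewrite mulr_ge0 ?exprn_ge0 ?invr_ge0.
  rewrite -(cvg_lim (@Rhausdorff R) ecvg); apply: nondecreasing_cvgn_le => //.
  by apply/cvg_ex; exists x.
have hi_step k : partial e k.+1 + 2^-1 ^+ k.+1 <= partial e k + 2^-1 ^+ k.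
  rewrite partialS [2^-1 ^+ k.+1]exprS -addrA lerD2l.
  have p0 : 0 < 2^-1 ^+ k :> R by rewrite exprn_gt0 // invr_gt0.
  by case: (e _) => /=; rewrite ?mul1r ?mul0r; lra.
have hi_mono k j : partial e (k + j) + 2^-1 ^+ (k + j) <= partial e k + 2^-1 ^+ k.
  elim: j => [|j IH]; first by rewrite addn0.
  by rewrite addnS (le_trans (hi_step _)).
have hi k : x < partial e k + 2^-1 ^+ k.
  have [[|i] // ki ei] := ezero k.
  have p0 : 0 < 2^-1 ^+ i :> R by rewrite exprn_gt0 // invr_gt0.
  have : x <= partial e i.+1 + 2^-1 ^+ i.+1.
    rewrite -(cvg_lim (@Rhausdorff R) ecvg); apply: limr_le.
      by apply/cvg_ex; exists x.
    exists i.+1 => // j /= ij; rewrite -(subnKC ij).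
    apply: le_trans (hi_mono i.+1 (j - i.+1)%N).
    by rewrite lerDl exprn_ge0 ?invr_ge0.
  have := hi_mono k (i - k)%N; rewrite subnKC; last by rewrite -ltnS.
  rewrite partialS ei mul0r addr0 exprS; lra.
have [P HP] : exists P : nat -> nat, forall k, (P k)%:R = partial e k * 2 ^+ k /\
    P k.+1 = (e k.+1 + (P k).*2)%N.
  exists (fun k => iteri k (fun i a => (e i.+1 + a.*2)%N) 0%N) => k; split => //.
  elim: k => [|k IH] /=; first by rewrite /partial big_nil mul0r.
  rewrite natrD -muln2 natrM IH partialS mulrDl addrC -!mulrA -exprSr; congr (_ + _).
  by rewrite -exprMn mulVf ?expr1n ?mulr1 // pnatr_eq0.
have SP k : scaled x k = P k.
  apply: truncn_def; rewrite (natS (P k)) (HP k).1.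
  have p0 : 0 < 2 ^+ k :> R by rewrite exprn_gt0.
  rewrite ler_pM2r // lo /=.
  by have := hi k; rewrite -(ltr_pM2r p0) mulrDl -exprMn mulVf ?expr1n ?pnatr_eq0.
case: N => // N _; rewrite SP (HP N).2 oddD odd_double addbF.
by case: (e _).
Qed.

Lemma epsE x j : 0 <= x < 1 -> (0 < j)%N -> eps x j = odd (scaled x j).
Proof.
move=> x01 j0; apply: binary_expansion_unique => //.
apply: (@xgetPex _ _ [set e | binary_expansion x e]).
by exists (fun i => odd (scaled x i)); exact: binary_expansion_scaled.
Qed.

End Digits.

(** * Dyadic cells *)

Section Cells.
Variable R : realType.
Implicit Types (x : R).

(** The cell of the quantile for [N] bits. *)
Definition dcell (N l : nat) : set R :=
  let u : R := 2^-1 ^+ N in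
  if l == 0%N then [set` `]0, u[] else [set` `[l%:R * u, l.+1%:R * u[].

Lemma scaled_itv N l x : 0 < x ->
  (scaled x N == l) = (l%:R * 2^-1 ^+ N <= x < l.+1%:R * 2^-1 ^+ N).
Proof.
move=> x0; rewrite /scaled truncn_eq; last by rewrite mulr_ge0 ?exprn_ge0 // ltW.
by rewrite exprVn ler_pdivrMr ?ltr_pdivlMr ?exprn_gt0.
Qed.

Lemma dcellP N l x : (l < 2 ^ N)%N -> dcell N l x <-> 0 < x < 1 /\ scaled x N = l.
Proof.
move=> lN; have u0 : 0 < 2^-1 ^+ N :> R by rewrite exprn_gt0 // invr_gt0.
have u1 : l.+1%:R * 2^-1 ^+ N <= 1 :> R.
  by rewrite exprVn ler_pdivrMr ?exprn_gt0 // mul1r -natrX ler_nat.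
have -> : dcell N l x <-> 0 < x /\ l%:R * 2^-1 ^+ N <= x < l.+1%:R * 2^-1 ^+ N.
  rewrite /dcell; case: eqP => [->|/eqP l0] /=; rewrite in_itv /=.
    rewrite mul0r mul1r; split => [/andP [x0 xu]|[x0 /andP [_ ->]]]; last by rewrite x0.
    by rewrite x0 ltW.
  split => [H|[]//]; split => //; case/andP: H => H _; apply: lt_le_trans H.
  by rewrite mulr_gt0 // ltr0n lt0n.
split => [[x0 H]|[/andP [x0 _] /eqP H]].
  split; last by apply/eqP; rewrite scaled_itv.
  by rewrite x0 /=; case/andP: H => _ H; apply: lt_le_trans H u1.
by split => //; rewrite -scaled_itv.
Qed.

Lemma dcell_measurable N l : measurable (dcell N l).
Proof. by rewrite /dcell; case: ifP => _; exact: measurable_itv. Qed.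

Lemma dcell_measure N l : lebesgue_measure (dcell N l) = (2^-1 ^+ N)%:E :> \bar R.
Proof.
have u0 : 0 < 2^-1 ^+ N :> R by rewrite exprn_gt0 // invr_gt0.
rewrite /dcell; have [_|l0] := eqVneq l 0%N; rewrite lebesgue_measure_itv /= lte_fin.
  by rewrite u0 sube0.
by rewrite ltr_pM2r // ltr_nat ltnSn -EFinB -mulrBl -natrB // subSnn mul1r.
Qed.

Definition midpoint (N l : nat) : R := (l%:R + 2^-1) * 2^-1 ^+ N.

Lemma dcell_midpoint N l : (l < 2 ^ N)%N -> dcell N l (midpoint N l).
Proof.
have u0 : 0 < 2^-1 ^+ N :> R by rewrite exprn_gt0 // invr_gt0.
have h0 : 0 < 2^-1 :> R by rewrite invr_gt0.
have h1 : 2^-1 < 1 :> R by lra.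
have m0 : 0 < midpoint N l by rewrite mulr_gt0 // ltr_wpDl.
move=> lN; apply/dcellP => //.
have lS : l.+1%:R = l%:R + 1 :> R by rewrite natr1.
have H : scaled (midpoint N l) N == l.
  by rewrite scaled_itv // ler_pM2r // ltr_pM2r // lerDl ltW //= lS ltrD2l.
split; last exact/eqP.
rewrite m0 /=; rewrite scaled_itv // in H; case/andP: H => _ H; apply: lt_le_trans H _.
by rewrite exprVn ler_pdivrMr ?exprn_gt0 // mul1r -natrX ler_nat.
Qed.

Lemma eps_bits x J : 0 < x < 1 -> bits J (scaled x J) = [seq eps x j | j <- iota 1 J].
Proof.
move=> /andP [x0 x1]; have x01 : 0 <= x < 1 by rewrite ltW.
apply: (@eq_from_nth _ false); rewrite size_bits ?size_map ?size_iota // => p pJ.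
rewrite nth_bits // (nth_map 0%N) ?size_iota // nth_iota // add1n epsE //.
by rewrite -{1}(subnKC pJ) -scaled_div // ltW.
Qed.

Lemma exists_eps (J : nat) (f : nat -> bool) :
  exists2 x : R, 0 < x < 1 & forall j, (1 <= j <= J)%N -> eps x j = f j.
Proof.
have [l] := bits_surj [seq f j | j <- iota 1 J]; rewrite size_map size_iota => lJ E.
have /(dcellP _ lJ) [x01 xl] := dcell_midpoint lJ.
exists (midpoint J l) => // j /andP [j0 jJ].
have := eps_bits J x01; rewrite xl E => /esym/eq_in_map; apply.
by rewrite mem_iota; lia.
Qed.

End Cells.

(** The number whose binary digits are those binary digits of [a] whose positions,
    counted from 1 at the most significant of [J] digits, satisfy [keep]. *)
Fixpoint keep_bits (keep : pred nat) (J a : nat) : nat :=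
  if J is J'.+1 then
    let r := keep_bits keep J' a./2 in if keep J then (odd a + r.*2)%N else r
  else 0%N.

Lemma bits_double N r (b : bool) : bits N.+1 (b + r.*2) = rcons (bits N r) b.
Proof.
apply: (@eq_from_nth _ false); rewrite ?size_rcons !size_bits // => p pN.
rewrite nth_bits // nth_rcons size_bits.
move: pN; rewrite ltnS leq_eqVlt => /orP [/eqP ->|pN].
  by rewrite ltnn eqxx subnn expn0 divn1 oddD odd_double addbF oddb.
rewrite pN nth_bits // (_ : N.+1 - p.+1 = (N - p.+1).+1)%N; last by lia.
by rewrite expnS divnMA (_ : (b + r.*2) %/ 2 = r)%N //; lia.
Qed.

Lemma count_iotaS (keep : pred nat) J :
  count keep (iota 1 J.+1) = (count keep (iota 1 J) + keep J.+1)%N.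
Proof. by rewrite -{1}[J.+1]addn1 iotaD count_cat /= addn0. Qed.

Lemma keep_bits_lt keep J a : (keep_bits keep J a < 2 ^ count keep (iota 1 J))%N.
Proof.
elim: J a => // J IH a; rewrite count_iotaS /=.
have := IH a./2; case: (keep J.+1) => /=; rewrite ?addn0 // addn1 expnS.
by case: odd => /=; lia.
Qed.

Lemma bits_keep keep J a : bits (count keep (iota 1 J)) (keep_bits keep J a) =
  mask [seq keep j | j <- iota 1 J] (bits J a).
Proof.
elim: J a => // J IH a; rewrite count_iotaS [keep_bits _ _ _]/=.
rewrite -[in RHS](odd_double_half a) bits_double.
have -> : [seq keep j | j <- iota 1 J.+1] = rcons [seq keep j | j <- iota 1 J] (keep J.+1).
  by rewrite -[J.+1]addn1 iotaD map_cat /= cats1 add1n addn1.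
rewrite mask_rcons ?size_map ?size_iota ?size_bits // -IH.
by case: (keep J.+1) => /=; rewrite ?addn1 ?addn0 ?bits_double ?cats1 ?cats0.
Qed.

(** Every value is taken equally often, once for each choice of the other digits. *)
Lemma sum_keep_bits keep J (F : nat -> nat) :
  (\sum_(a < 2 ^ J) F (keep_bits keep J a) =
   2 ^ (J - count keep (iota 1 J)) * \sum_(l < 2 ^ count keep (iota 1 J)) F l)%N.
Proof.
have split_sum N (G : nat -> nat) : (\sum_(a < 2 ^ N.+1) G a =
    \sum_(a < 2 ^ N) (G (a.*2) + G (a.*2.+1)))%N.
  rewrite -(big_mkord xpredT G) expnS mul2n; elim: (2 ^ N)%N => [|k IHk];
      first by rewrite big_geq // big_ord0.
  by rewrite doubleS !big_nat_recr // big_ord_recr /= IHk addnA.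
elim: J F => [|J IH] F; first by rewrite /= !expn0 !big_ord1 mul1n.
have cJ : (count keep (iota 1 J) <= J)%N by rewrite -{2}(size_iota 1 J) count_size.
rewrite !count_iotaS (split_sum J (fun a => F (keep_bits keep J.+1 a))) /=;
    case: (keep J.+1) => /=.
  rewrite addn1 (split_sum _ F) subSS -(IH (fun l => F l.*2 + F l.*2.+1)%N);
      apply: eq_bigr => a _.
  by rewrite odd_double uphalf_double doubleK.
rewrite addn0 subSn // expnS -mulnA -IH big_distrr /=; apply: eq_bigr => a _.
by rewrite uphalf_double doubleK mul2n addnn.
Qed.

(** * The sums of all words and the quantile *)

Section Words.
Variables (R : realType) (M : nat) (O : R -> R) (o : 'I_(nout M) -> R)
  (vsig : 'I_(nout M) -> M.+1.-tuple bool) (decode : M.+1.-tuple bool -> 'I_(nout M)).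
Hypotheses (hO : outcomes O o vsig) (vsigK : cancel vsig decode) (decodeK : cancel decode vsig).
Implicit Types (n i l t : nat) (x r : R).

Definition bit_tuple (d : nat) : M.+1.-tuple bool := Tuple (introT eqP (size_bits M.+1 d)).

Definition digit_outcome (d : nat) : 'I_(nout M) := decode (bit_tuple d).

Definition word_outcome n l i := digit_outcome (l %/ nout M ^ (n - i)).

Definition word_sum n l : R := \sum_(1 <= i < n.+1) o (word_outcome n l i).

Lemma nout_exp k : (nout M ^ k = 2 ^ (k * M.+1))%N.
Proof. by rewrite /nout -expnM mulnC. Qed.

(** A number with the prescribed first [M + 1] digits exists, so the auxiliary point
    in the definition of the column variable is one. *)
Lemma Rcol_digits i x d :
  (forall k, (k < M.+1)%N -> eps x (jcol M i k.+1) = nth false (bits M.+1 d) k) ->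
  Rcol M O i x = o (digit_outcome d).
Proof.
move=> H; have [/andP [y0 y1] Hy] : 0 < Pcol M i x < 1 /\
    forall k, (1 <= k <= M.+1)%N -> eps (Pcol M i x) k = eps x (jcol M i k).
  apply: (@xgetPex _ 0 [set y | 0 < y < 1 /\ forall k, (1 <= k <= M.+1)%N ->
    eps y k = eps x (jcol M i k)]).
  have [y y01 Hy] := exists_eps R M.+1 (fun k => eps x (jcol M i k)).
  by exists y.
rewrite /Rcol; apply/(outcomesP hO); first by rewrite y0 y1.
rewrite /digit_outcome decodeK; apply: eq_from_tnth => k.
by rewrite tnth_mktuple (tnth_nth false) Hy ?H //= ltn_ord.
Qed.

Lemma cellEP n l x : (l < 2 ^ nbits M n)%N -> cellE M n l x <->
  0 < x < 1 /\ [seq eps x j | j <- Jbar M n] = bits (nbits M n) l.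
Proof.
move=> lN; have E p : (p < nbits M n)%N ->
   nth 0%N (Jbar M n) p = row_end M p /\ index (row_end M p) (Jbar M n) = p.
  move=> pN; split; last exact: index_Jbar.
  by rewrite JbarE (nth_map 0%N) ?size_iota // nth_iota.
have sJ : size (Jbar M n) = nbits M n by rewrite JbarE size_map size_iota.
rewrite /cellE /= lexvecE //; split=> -[x01 H]; split => //.
  apply: (@eq_from_nth _ false); rewrite ?size_map ?sJ ?size_bits // => p pN.
  rewrite (nth_map 0%N) ?sJ //; have [Ep Ei] := E _ pN.
  by rewrite H ?Ep ?Ei // mem_Jbar.
move=> j jJ; rewrite -H (nth_map 0%N) ?index_mem // nth_index //.
Qed.

Lemma cellE_Rcol n l i x : (l < 2 ^ nbits M n)%N -> (1 <= i <= n)%N ->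
  cellE M n l x -> Rcol M O i x = o (word_outcome n l i).
Proof.
case: i => // i lN /= iN [x01 H]; apply: Rcol_digits => k kM.
have pN : (i * M.+1 + k < nbits M n)%N.
  rewrite /nbits; apply: leq_trans (_ : i.+1 * M.+1 <= _)%N; first by rewrite mulSn; lia.
  by rewrite leq_mul2r iN orbT.
rewrite jcol_row_end // H ?mem_Jbar // index_Jbar // lexvecE // !nth_bits //.
rewrite nout_exp -divnMA -expnD; congr (odd (_ %/ 2 ^ _)).
rewrite mulnBl /nbits mulSn.
have : (i.+1 * M.+1 <= n * M.+1)%N by rewrite leq_mul2r iN orbT.
rewrite mulSn; lia.
Qed.

Lemma Ssum_cellE n l x : (l < 2 ^ nbits M n)%N -> cellE M n l x ->
  Ssum M O n x = word_sum n l.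
Proof.
move=> lN xl; rewrite /Ssum /word_sum !big_nat; apply: eq_bigr => i iN.
by apply: cellE_Rcol.
Qed.

Lemma Jbar_gt0 n j : j \in Jbar M n -> (0 < j)%N.
Proof. by rewrite JbarE => /mapP [p _ ->]; exact: row_end_gt0. Qed.

(* Any common bound of the coordinates would do. *)
Definition depth n := (\sum_(j <- Jbar M n) j)%N.

Lemma Jbar_depth n j : j \in Jbar M n -> (j <= depth n)%N.
Proof. by move=> jJ; rewrite /depth (big_rem j) //= leq_addr. Qed.

Lemma filter_Jbar n : [seq j <- iota 1 (depth n) | j \in Jbar M n] = Jbar M n.
Proof.
apply: (irr_sorted_eq ltn_trans ltnn).
- exact/(sorted_filter ltn_trans)/iota_ltn_sorted.
- rewrite JbarE sorted_map; apply: (sub_sorted (e := ltn)); last exact: iota_ltn_sorted.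
  by move=> p q; exact: row_end_mono.
move=> j; rewrite mem_filter mem_iota andb_idr // => jJ.
by rewrite (Jbar_gt0 jJ) /= add1n ltnS Jbar_depth.
Qed.

Lemma count_Jbar n : count [in Jbar M n] (iota 1 (depth n)) = nbits M n.
Proof. by rewrite -size_filter filter_Jbar JbarE size_map size_iota. Qed.

Definition project n (a : nat) : nat := keep_bits [in Jbar M n] (depth n) a.

Lemma project_lt n a : (project n a < 2 ^ nbits M n)%N.
Proof. by rewrite -count_Jbar keep_bits_lt. Qed.

Lemma cellE_project n x : 0 < x < 1 -> cellE M n (project n (scaled x (depth n))) x.
Proof.
move=> x01; apply/cellEP; first exact: project_lt.
split=> //; rewrite -[in RHS]count_Jbar bits_keep eps_bits // -map_mask -filter_mask.
by rewrite filter_Jbar.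
Qed.

Lemma cellE_exists n l : (l < 2 ^ nbits M n)%N -> exists x, @cellE R M n l x.
Proof.
move=> lN; have [x x01 Hx] := exists_eps R (depth n)
  (fun j => nth false (lexvec M n l) (index j (Jbar M n))).
by exists x; split=> // j jJ; rewrite Hx // Jbar_depth // (Jbar_gt0 jJ).
Qed.

Definition below_count n r := (\sum_(l < 2 ^ nbits M n) (word_sum n l <= r)%R)%N.

(** The sum is constant on the dyadic intervals of length [2 ^- depth n].  They all
    have the same measure, and equally many of them lie in each of the cells. *)
Lemma cdfSE n r : cdfS M O n r = (below_count n r)%:R * 2^-1 ^+ nbits M n.
Proof.
set J := depth n; pose P (a : 'I_(2 ^ J)) := word_sum n (project n a) <= r.
have NJ : (nbits M n <= J)%N.
  by rewrite -count_Jbar -[leqRHS](size_iota 1 J) count_size.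
have E : [set x : R | 0 < x < 1 /\ Ssum M O n x <= r] =
    \big[setU/set0]_(a < 2 ^ J | P a) (dcell J a : set R).
  rewrite -bigcup_seq_cond; apply/seteqP; split => x /=.
    move=> [x01 Sr].
    have aJ : (scaled x J < 2 ^ J)%N by apply: scaled_lt; case/andP: x01 => /ltW -> ->.
    exists (Ordinal aJ); last by apply/dcellP.
    rewrite /= mem_index_enum /= /P /=.
    by rewrite -(Ssum_cellE (project_lt n _) (cellE_project n x01)).
  move=> [a /andP [_ Pa] /dcellP [//|x01 xa]]; split=> //.
  by rewrite (Ssum_cellE (project_lt n _) (cellE_project n x01)) -/J xa.
rewrite /cdfS E measure_bigsetU_ord; first last.
- move=> a b _ _ [x [/dcellP [//|_ xa] /dcellP [//|_ xb]]].
  by apply/val_inj; rewrite /= -xa -xb.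
- by move=> a; exact: dcell_measurable.
rewrite (eq_bigr (fun=> (2^-1 ^+ J)%:E)) => [|a _]; last exact: dcell_measure.
rewrite sumEFin /= sumr_const.
have -> : #|P| = (2 ^ (J - nbits M n) * below_count n r)%N.
  rewrite -sum1_card big_mkcond /= /below_count.
  have := sum_keep_bits [in Jbar M n] (depth n) (fun l => (word_sum n l <= r)%R : nat).
  rewrite count_Jbar => <-.
  by apply: eq_bigr => a _; rewrite unfold_in /P; case: ifP.
rewrite -[LHS]mulr_natl natrM natrX -{2}(subnK NJ) exprD mulrACA -exprMn divff ?pnatr_eq0 //.
by rewrite expr1n mul1r.
Qed.

Definition sorted_sums n : seq R :=
  sort <=%R [seq word_sum n l | l <- iota 0 (2 ^ nbits M n)].

Lemma size_sorted_sums n : size (sorted_sums n) = (2 ^ nbits M n)%N.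
Proof. by rewrite size_sort size_map size_iota. Qed.

Lemma count_sorted_sums n (P : pred R) :
  count P (sorted_sums n) = (\sum_(l < 2 ^ nbits M n) P (word_sum n l))%N.
Proof.
rewrite (permP (permEl (perm_sort _ _))) count_map -sum1_count big_mkcond /=.
rewrite -[in LHS](subn0 (2 ^ _)%N) big_mkord; apply: eq_bigr => l _ /=; by case: (P _).
Qed.

(** For [x] in the cell [l], the distribution function at [r] exceeds [x] iff more
    than [l] sums are at most [r], that is, iff the [l]-th smallest sum is. *)
Lemma SstarE n l x : (l < 2 ^ nbits M n)%N -> cellD M n l x ->
  Sstar M O n x = nth 0 (sorted_sums n) l.
Proof.
move=> lN /(dcellP x lN) [/andP [x0 x1] /eqP]; rewrite scaled_itv // => /andP [lx xl].
have u0 : 0 < 2^-1 ^+ nbits M n :> R by rewrite exprn_gt0 // invr_gt0.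
rewrite /Sstar.
have -> : [set r | x < cdfS M O n r] = [set` `[nth 0 (sorted_sums n) l, +oo[].
  apply/seteqP; split => r /=; rewrite in_itv /= andbT cdfSE /below_count
     -(count_sorted_sums n (<= r)) => H.
    apply: (nth_count_le _ (sort_le_sorted _)).
    rewrite -(ltr_nat R) -(ltr_pM2r u0); exact: le_lt_trans H.
  apply: lt_le_trans xl _; rewrite ler_pM2r // ler_nat ltnNge; apply/negP => cl.
  have : r < nth 0 (sorted_sums n) l.
    by apply: (nth_count_gt _ (sort_le_sorted _)); rewrite cl size_sorted_sums.
  by rewrite ltNge H.
by rewrite inf_itv.
Qed.

End Words.

(** * The permutation *)

Section Perm.
Variables (R : realType) (M : nat) (O : R -> R) (o : 'I_(nout M) -> R)
  (vsig : 'I_(nout M) -> M.+1.-tuple bool) (decode : M.+1.-tuple bool -> 'I_(nout M)).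
Hypotheses (hO : outcomes O o vsig) (vsigK : cancel vsig decode) (decodeK : cancel decode vsig).
Implicit Types (n i l t : nat) (x r : R).

Notation m := (nout M).
Notation digit_outcome := (digit_outcome decode).
Notation word_sum := (word_sum o decode).

Lemma nout_gt1 : (1 < m)%N. Proof. by rewrite /nout -{1}(expn0 2) ltn_exp2l. Qed.

Lemma digit_outcome_mod d : digit_outcome (d %% m) = digit_outcome d.
Proof. by congr decode; apply/val_inj; exact: bits_mod. Qed.

(* The inverse of [digit_outcome] on the digits below [m]. *)
Definition outcome_digit (s : 'I_m) : nat := find (fun d => digit_outcome d == s) (iota 0 m).

Lemma has_outcome_digit s : has (fun d => digit_outcome d == s) (iota 0 m).
Proof.
have [d dm E] := bits_surj (vsig s); rewrite size_tuple in dm E.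
apply/hasP; exists d; first by rewrite mem_iota.
by apply/eqP; rewrite -(vsigK s); congr decode; exact/val_inj.
Qed.

Lemma outcome_digit_lt s : (outcome_digit s < m)%N.
Proof. by have := has_outcome_digit s; rewrite has_find size_iota. Qed.

Lemma outcome_digitK s : digit_outcome (outcome_digit s) = s.
Proof.
by have /eqP := nth_find 0%N (has_outcome_digit s); rewrite nth_iota ?add0n //;
    exact: outcome_digit_lt.
Qed.

Lemma digit_outcomeK d : (d < m)%N -> outcome_digit (digit_outcome d) = d.
Proof.
move=> dm; have : bits M.+1 (outcome_digit (digit_outcome d)) = bits M.+1 d.
  by have /(congr1 (fun s => tval (vsig s))) := outcome_digitK (digit_outcome d);
      rewrite /digit_outcome !decodeK.
by move/bits_inj; rewrite !modn_small //; exact: outcome_digit_lt.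
Qed.

Lemma digit_outcome_bij : bijective (fun d : 'I_m => digit_outcome d).
Proof.
exists (fun s => Ordinal (outcome_digit_lt s)) => [d|s]; last exact: outcome_digitK.
by apply/val_inj; rewrite /= digit_outcomeK.
Qed.

Lemma word_sumE n l : word_sum n l = \sum_s (digit_count m n l (outcome_digit s))%:R * o s.
Proof.
have -> : word_sum n l = \sum_(i < n) o (digit_outcome (l %/ m ^ i)).
  rewrite /word_sum big_add1 /= big_mkord (reindex_inj rev_ord_inj) /=.
  by apply: eq_bigr => i _; rewrite /word_outcome; congr (o (digit_outcome (_ %/ _ ^ _)));
      have := ltn_ord i; lia.
under [RHS]eq_bigr do rewrite natr_sum big_distrl /=.
rewrite exchange_big /=; apply: eq_bigr => i _.
rewrite -digit_outcome_mod; set d := (_ %% _)%N.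
have dm : (d < m)%N by rewrite ltn_mod; have := nout_gt1; lia.
rewrite (bigD1 (digit_outcome d)) //= digit_outcomeK // eqxx mul1r big1 ?addr0 // => s sd.
rewrite (_ : (d == outcome_digit s) = false) ?mul0r //; apply/negbTE; apply: contraNneq sd => ->.
by rewrite outcome_digitK.
Qed.

Definition word_counts n l : {ffun 'I_m -> 'I_n.+1} :=
  [ffun s => inord (digit_count m n l (outcome_digit s))].

Lemma word_countsE n l s : word_counts n l s = digit_count m n l (outcome_digit s) :> nat.
Proof. by rewrite ffunE inordK // ltnS digit_count_le. Qed.

Lemma sum_outcome_digit (F : nat ->
    nat) : (\sum_(s : 'I_m) F (outcome_digit s) = \sum_(d < m) F d)%N.
Proof.
rewrite (reindex (fun d : 'I_m => digit_outcome d)) /=; last exact/onW_bij/digit_outcome_bij.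
by apply: eq_bigr => d _; rewrite digit_outcomeK.
Qed.

Lemma word_counts_Kset n l : word_counts n l \in Kset M n.
Proof.
rewrite inE; under eq_bigr do rewrite word_countsE.
by rewrite (sum_outcome_digit (digit_count m n l)) sum_digit_count // nout_gt1.
Qed.

Lemma dotp_word_counts n l : dotp o (word_counts n l) = word_sum n l.
Proof. by rewrite word_sumE; apply: eq_bigr => s _; rewrite word_countsE. Qed.

(** Both sides multiplied by the factorials are [n!]. *)
Lemma multinomE n (k : {ffun 'I_m -> 'I_n.+1}) : k \in Kset M n ->
  multinom k = (\sum_(l < m ^ n) (word_counts n l == k))%N.
Proof.
rewrite inE => /eqP kn; rewrite /multinom.
have := nwords_fact nout_gt1 n (fun d => k (digit_outcome d) : nat).
have -> : (\sum_(d < m) k (digit_outcome d) = n)%N.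
  rewrite -{}[RHS]kn [RHS](reindex (fun d : 'I_m => digit_outcome d)) //=.
  exact/onW_bij/digit_outcome_bij.
have -> : (\prod_(d < m) (k (digit_outcome d))`! = \prod_s (k s)`!)%N.
  rewrite [RHS](reindex (fun d : 'I_m => digit_outcome d)) //=.
  exact/onW_bij/digit_outcome_bij.
rewrite eqxx => <-; rewrite mulnK; last first.
  by rewrite prodn_gt0 // => s; exact: fact_gt0.
rewrite /nwords big_mkord; apply: eq_bigr => l _; congr nat_of_bool.
apply/forallP/eqP => [H|<- d].
  apply/ffunP => s; apply/val_inj; rewrite /= word_countsE.
  by have := H (Ordinal (outcome_digit_lt s)); rewrite /= outcome_digitK => /eqP.
by rewrite word_countsE digit_outcomeK.
Qed.

Lemma word_sum_values n l : word_sum n l \in values o n.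
Proof.
rewrite /values mem_sort mem_undup -dotp_word_counts; apply: map_f.
by rewrite mem_enum word_counts_Kset.
Qed.

Lemma values_lt_sorted n : sorted <%R (values o n).
Proof. by rewrite lt_sorted_uniq_le sort_uniq undup_uniq sort_le_sorted. Qed.

Lemma size_values n : (0 < size (values o n))%N.
Proof. by have := word_sum_values n 0; case: (values o n). Qed.

Lemma leq_Tmax n t : (t <= Tmax o n)%N = (t < size (values o n))%N.
Proof. by rewrite /Tmax; have := size_values n; case: (size _). Qed.

Lemma Svalue_lt n t t' : (t <= Tmax o n)%N -> (t' <= Tmax o n)%N ->
  (Svalue o n t < Svalue o n t') = (t < t')%N.
Proof. by rewrite !leq_Tmax => tT t'T; rewrite (lt_sorted_ltn_nth 0 (values_lt_sorted n)). Qed.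

Lemma Svalue_inj n t t' : (t <= Tmax o n)%N -> (t' <= Tmax o n)%N ->
  Svalue o n t = Svalue o n t' -> t = t'.
Proof.
move=> tT t'T E; have := Svalue_lt tT t'T; have := Svalue_lt t'T tT.
by rewrite E ltxx; case: ltngtP.
Qed.

Lemma word_sum_Svalue n l : exists2 t, (t <= Tmax o n)%N & word_sum n l = Svalue o n t.
Proof.
exists (index (word_sum n l) (values o n)).
  by rewrite leq_Tmax index_mem word_sum_values.
by rewrite /Svalue nth_index // word_sum_values.
Qed.

Lemma SMC_E n t : SMC o n t = (\sum_(l < m ^ n) (word_sum n l < Svalue o n t)%R)%N.
Proof.
rewrite /SMC; transitivity (\sum_(k in Kset M n | (dotp o k < Svalue o n t)%R)
    \sum_(l < m ^ n) (word_counts n l == k))%N.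
  by apply: eq_bigr => k /andP [kn _]; rewrite multinomE.
rewrite exchange_big /=; apply: eq_bigr => l _; rewrite -dotp_word_counts.
have [lt|ge] := boolP (dotp o (word_counts n l) < Svalue o n t).
  rewrite (bigD1 (word_counts n l)) ?word_counts_Kset //= eqxx big1 // => k /andP [_].
  by rewrite eq_sym => /negbTE ->.
by rewrite big1 // => k /andP [_ kt]; case: eqP => // E; rewrite E kt in ge.
Qed.

Definition order := [seq outcome_digit s | s <- enum 'I_m].

Notation tau := (fun a => `[< tau1 o a >]).

Lemma order_lt : all (fun d => (d < m)%N) order.
Proof. by apply/allP => d /mapP [s _ ->]; exact: outcome_digit_lt. Qed.

Lemma acceptsP n (k : nat -> nat) t : (0 < n)%N -> reflect
  [/\ (\sum_(d < m) k d = n)%N, (t <= Tmax o n)%N &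
      \sum_s (k (outcome_digit s))%:R * o s = Svalue o n t]
  (accepts tau order n k t).
Proof.
move=> n0; rewrite /accepts /=;
    apply: (iffP (asboolP _)) => [[n' [t' [k' [[nn E] _ tT kK kt]]]]|[kn tT kt]].
  subst n'.
  move: E; rewrite /order -map_comp -cats1 => E.
  have sE : size [seq k (outcome_digit s) | s <- enum 'I_m] = size [seq k' s : nat | s <- enum
      'I_m].
    by rewrite !size_map.
  move/eqP: E; rewrite eqseq_cat; last exact: sE.
  move=> /andP [/eqP /eq_in_map E /eqP [tt]].
  have kE s : k (outcome_digit s) = k' s by apply: E; rewrite mem_enum.
  rewrite tt; split=> //; last by rewrite -kt; apply: eq_bigr => s _; rewrite kE.
  move: kK; rewrite inE => /eqP kn; rewrite -(sum_outcome_digit k) -[RHS]kn.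
  by apply: eq_bigr => s _; rewrite kE.
have kle s : (k (outcome_digit s) < n.+1)%N.
  by rewrite ltnS -[leqRHS]kn (bigD1 (Ordinal (outcome_digit_lt s))) //= leq_addr.
pose k' : {ffun 'I_m -> 'I_n.+1} := [ffun s => Ordinal (kle s)].
have kE s : k' s = k (outcome_digit s) :> nat by rewrite ffunE.
exists n, t, k'; split=> //.
- rewrite /order -map_comp -cats1; congr (_ :: (_ ++ _)).
  by apply: eq_map => s; rewrite /= kE.
- rewrite inE -[X in _ == X]kn -(sum_outcome_digit k); apply/eqP.
  by apply: eq_bigr => s _; rewrite kE.
- by rewrite -kt; apply: eq_bigr => s _; rewrite kE.
Qed.

Section Fixed_n.
Variable n : nat.
Hypothesis n0 : (0 < n)%N.

Notation N := (nbits M n).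

Lemma words_bits : (m ^ n = 2 ^ N)%N. Proof. exact: nout_exp. Qed.

Lemma acceptedE t l : (t <= Tmax o n)%N ->
  accepted tau m order n t l = (word_sum n l == Svalue o n t).
Proof.
move=> tT; apply/(acceptsP _ _ n0)/eqP => [[_ _ <-]|E]; first exact: word_sumE.
by rewrite tT -word_sumE sum_digit_count // nout_gt1.
Qed.

Lemma rank_wordsE t : (t <= Tmax o n)%N ->
  rank_words tau m order n t = (\sum_(l < m ^ n) (word_sum n l == Svalue o n t))%N.
Proof. by move=> tT; rewrite /rank_words big_mkord; apply: eq_bigr => l _; rewrite acceptedE. Qed.

(** Every sum is one of the increasing values, so a sum is less than the value
    number [t] iff it is one of the values with a smaller number. *)
Lemma SMC_rank_words t : (t <= Tmax o n)%N ->
  SMC o n t = (\sum_(t' < t) rank_words tau m order n t')%N.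
Proof.
move=> tT; rewrite SMC_E.
under [RHS]eq_bigr => t' _ do rewrite rank_wordsE ?(leq_trans (ltnW (ltn_ord t'))) //.
rewrite exchange_big /=; apply: eq_bigr => l _.
have [u uT ->] := word_sum_Svalue n l; rewrite Svalue_lt //.
have [ut|tu] := ltnP u t.
  rewrite (bigD1 (Ordinal ut)) //= eqxx big1 // => t' t'u.
  case: eqP => // /Svalue_inj E; move: t'u; rewrite -val_eqE /= -E ?eqxx //.
  by rewrite (leq_trans (ltnW (ltn_ord t'))).
rewrite big1 // => t' _; case: eqP => // /Svalue_inj E.
have := ltn_ord t'; rewrite -E ?ltnNge ?tu //.
by rewrite (leq_trans (ltnW (ltn_ord t'))).
Qed.

Definition cell_rank l := index (nth 0 (sorted_sums o decode n) l) (values o n).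

Lemma sorted_sums_values l : (l < 2 ^ N)%N -> nth 0 (sorted_sums o decode n) l \in values o n.
Proof.
move=> lN; have : nth 0 (sorted_sums o decode n) l \in sorted_sums o decode n.
  by rewrite mem_nth // size_sorted_sums.
by rewrite mem_sort => /mapP [l' _ ->]; exact: word_sum_values.
Qed.

Lemma cell_rank_le l : (l < 2 ^ N)%N -> (cell_rank l <= Tmax o n)%N.
Proof. by move=> lN; rewrite leq_Tmax index_mem sorted_sums_values. Qed.

Lemma Svalue_cell_rank l : (l < 2 ^ N)%N ->
    Svalue o n (cell_rank l) = nth 0 (sorted_sums o decode n) l.
Proof. by move=> lN; rewrite /Svalue nth_index // sorted_sums_values. Qed.

Lemma IStepE l : (l < 2 ^ N)%N -> IStep O o n l = cell_rank l.
Proof.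
move=> lN; apply: xget_unique => [|t [tT H]].
  split; first exact: cell_rank_le.
  by move=> x xl; rewrite Svalue_cell_rank // (SstarE hO decodeK lN xl).
apply: (@Svalue_inj n) => //; first exact: cell_rank_le.
have xl := dcell_midpoint R lN.
by rewrite -(H _ xl) (SstarE hO decodeK lN xl) Svalue_cell_rank.
Qed.

Lemma IBE t : IB O o n t = [seq l <- iota 0 (2 ^ N) | word_sum n l == Svalue o n t].
Proof.
apply: eq_in_filter => l; rewrite mem_iota /= => lN; apply/asboolP/eqP => [H|E x xl].
  by have [x xl] := cellE_exists R lN; rewrite -(H _ xl) (Ssum_cellE hO decodeK lN xl).
by rewrite (Ssum_cellE hO decodeK lN xl).
Qed.

Definition words_below t b := (\sum_(0 <= l < b) (word_sum n l == Svalue o n t))%N.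

Lemma size_IB t : (t <= Tmax o n)%N -> size (IB O o n t) = rank_words tau m order n t.
Proof.
move=> tT; rewrite IBE rank_wordsE // size_filter -sum1_count big_mkcond /= words_bits.
by rewrite -[in LHS](subn0 (2 ^ _)%N) big_mkord; apply: eq_bigr => l _; case: eqP.
Qed.

(** In an increasing list the position of an entry is the number of smaller
    entries. *)
Lemma nth_IB t (r : nat) : (r < size (IB O o n t))%N ->
  let b := nth 0%N (IB O o n t) r in
  [/\ (b < 2 ^ N)%N, word_sum n b = Svalue o n t & words_below t b = r].
Proof.
move=> rI b; have : b \in IB O o n t by exact: mem_nth.
rewrite {1}IBE mem_filter mem_iota /= => /andP [/eqP bt bN]; split => //.
have sI : sorted ltn (IB O o n t).
  by rewrite IBE; exact/(sorted_filter ltn_trans)/iota_ltn_sorted.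
have := count_lt_nth 0%N sI rI; rewrite -/b => <-.
rewrite IBE count_filter -sum1_count /words_below.
rewrite [RHS]big_mkcond /= -[in RHS](subn0 (2 ^ _)%N) -/(index_iota 0 (2 ^ N)).
rewrite [RHS](big_cat_nat (n := b)) ?(ltnW bN) //= [X in _ = (_ + X)%N]big_nat_cond.
rewrite [X in _ = (_ + X)%N]big1 ?addn0 => [|l /andP [/andP [bl _] _]]; last first.
  by rewrite /= ltEnat /= ltnNge bl.
rewrite !big_nat; apply: eq_bigr => l /= lb.
by rewrite ltEnat /= lb /=; case: eqP.
Qed.

Lemma index_IB b t : (b < 2 ^ N)%N -> word_sum n b = Svalue o n t ->
  (words_below t b < size (IB O o n t))%N /\ nth 0%N (IB O o n t) (words_below t b) = b.
Proof.
move=> bN bt; have bI : b \in IB O o n t by rewrite IBE mem_filter bt eqxx mem_iota.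
have iI : (index b (IB O o n t) < size (IB O o n t))%N by rewrite index_mem.
have [_ _] := nth_IB iI; rewrite nth_index // => ->.
by rewrite nth_index.
Qed.

Lemma SMC_count t : SMC o n t = count (< Svalue o n t) (sorted_sums o decode n).
Proof. by rewrite SMC_E count_sorted_sums words_bits. Qed.

Lemma SMC_IB_count t : (t <= Tmax o n)%N ->
  (SMC o n t + size (IB O o n t))%N = count (<= Svalue o n t) (sorted_sums o decode n).
Proof.
move=> tT; rewrite size_IB // rank_wordsE // SMC_E count_sorted_sums words_bits -big_split /=.
by apply: eq_bigr => i _; rewrite le_eqVlt; case: ltgtP.
Qed.

(** The cells on which the quantile has the value number [t] are numbered from the
    number of smaller sums on. *)
Lemma cell_rankP l : (l < 2 ^ N)%N ->
  (SMC o n (cell_rank l) <= l < SMC o n (cell_rank l) + size (IB O o n (cell_rank l)))%N.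
Proof.
move=> lN; rewrite SMC_IB_count ?cell_rank_le // SMC_count; apply/andP; split.
  rewrite leqNgt; apply/negP => /(nth_count_lt 0 (sort_le_sorted _)).
  by rewrite -/(sorted_sums o decode n) Svalue_cell_rank // ltxx.
rewrite ltnNge; apply/negP => H.
have : Svalue o n (cell_rank l) < nth 0 (sorted_sums o decode n) l.
  by apply: (nth_count_gt _ (sort_le_sorted _)); rewrite H size_sorted_sums.
by rewrite Svalue_cell_rank // ltxx.
Qed.

Lemma cell_rank_unique l t : (l < 2 ^ N)%N -> (t <= Tmax o n)%N ->
  (SMC o n t <= l < SMC o n t + size (IB O o n t))%N -> cell_rank l = t.
Proof.
move=> lN tT H; apply: (@Svalue_inj n) => //; first exact: cell_rank_le.
rewrite Svalue_cell_rank //; apply: (nth_count_eq _ (sort_le_sorted _)).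
by rewrite -SMC_count -SMC_IB_count.
Qed.

Lemma FpermP l : (l < 2 ^ N)%N -> let t := cell_rank l in let b := Fperm O o n l in
  [/\ (b < 2 ^ N)%N, word_sum n b = Svalue o n t & words_below t b = (l - SMC o n t)%N].
Proof.
move=> lN t b; have := cell_rankP lN; rewrite -/t => /andP [H1 H2].
rewrite /b /Fperm IStepE // -/t add1n subSn //=.
by apply: nth_IB; rewrite ltn_subLR.
Qed.

Lemma Fperm_admissible : admissible M O n (Fperm O o n).
Proof.
split; last first.
  move=> l lN x y xl yl; have [bN bt _] := FpermP lN.
  by rewrite (SstarE hO decodeK lN xl) (Ssum_cellE hO decodeK bN yl) bt Svalue_cell_rank.
split.
- by move=> l lN; have [] := FpermP lN.
- move=> l l'; rewrite !inE /= => lN l'N E.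
  have [_ bt bl] := FpermP lN; have [_ bt' bl'] := FpermP l'N.
  have rr : cell_rank l = cell_rank l'.
    by apply: (@Svalue_inj n); rewrite ?cell_rank_le // -bt -bt' E.
  move: bl bl'; rewrite E rr => -> H.
  have /andP [h1 _] := cell_rankP lN; have /andP [h2 _] := cell_rankP l'N.
  by rewrite rr in h1; rewrite -(subnK h1) H subnK.
- move=> b /= bN; have [t tT bt] := word_sum_Svalue n b.
  have [rI bE] := index_IB bN bt.
  have lN : (SMC o n t + words_below t b < 2 ^ N)%N.
    apply: leq_trans (_ : SMC o n t + size (IB O o n t) <= _)%N; first by rewrite ltn_add2l.
    rewrite size_IB // rank_wordsE // SMC_E -big_split /= -words_bits -[leqRHS]card_ord
        -sum1_card.
    by apply: leq_sum => i _; case: ltgtP.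
  exists (SMC o n t + words_below t b)%N => //.
  have rt : cell_rank (SMC o n t + words_below t b) = t.
    by apply: cell_rank_unique; rewrite // leq_addr ltn_add2l.
  rewrite /Fperm IStepE // rt add1n -addnS addKn //=.
Qed.

(** [FpermP] is the description of the word that the search finds. *)
Lemma find_digit_Fperm i l : (1 <= i <= n)%N -> (l < 2 ^ N)%N ->
  find_digit tau m M.+1 m.+2 order [seq (digit_outcome d).+1 | d <- iota 0 m] n i l =
  (word_outcome decode n (Fperm O o n l) i).+1.
Proof.
move=> iN lN; have [bN bt bl] := FpermP lN; have tT := cell_rank_le lN.
have accepts_sum k t : accepts tau order n k t -> (\sum_(d < m) k d = n)%N.
  by case/(acceptsP _ _ n0).
have tB : (cell_rank l < (n + 2) ^ m)%N.
  move: tT; rewrite leq_Tmax => /leq_trans; apply.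
  rewrite size_sort; apply: leq_trans (size_undup _) _; rewrite size_map -cardE.
  apply: leq_trans (max_card _) _; rewrite card_ffun !card_ord.
  by rewrite leq_exp2r ?addn2 //; have := nout_gt1; lia.
rewrite (find_digitE _ nout_gt1 order_lt accepts_sum (erefl : m = (2 ^ M.+1)%N) (t :=
    cell_rank l) (b := Fperm O o n l)).
- have lm d : (d %% m < m)%N by rewrite ltn_mod; have := nout_gt1; lia.
  by rewrite (nth_map 0%N) ?size_iota // nth_iota // add0n digit_outcome_mod.
- apply: (find_rankE nout_gt1 order_lt accepts_sum) => //.
  by rewrite big_ord_recr /= -SMC_rank_words // -size_IB // cell_rankP.
- by rewrite words_bits.
- by rewrite acceptedE // bt.
- rewrite (smaller_wordsE nout_gt1 order_lt accepts_sum) ?(ltnW tB) // -SMC_rank_words // -bl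
    /words_below.
  by apply: eq_bigr => x _; rewrite acceptedE.
Qed.

End Fixed_n.

End Perm.

(** * Polynomial time *)

Unset Implicit Arguments.
Set Strict Implicit.
Local Close Scope classical_set_scope.

(** The input is polynomially long because [l] has at most [n * (M + 1)] digits. *)
Lemma array_args_size M s : array_args M s ->
  (size (encode s) <= (head 0%N s + 2) ^ (M + 7))%N.
Proof.
move=> [n [i [l [-> n1 /andP [i1 iN] lN]]]].
rewrite !encode_cons !size_cat /= !size_cat /= !size_cat /=.
have h1 := @size_binary n n (ltn_expl n (isT : 1 < 2)%N).
have h2 : (size (binary i) <= n.+1)%N.
  by apply: size_binary; apply: leq_ltn_trans iN (ltn_expl n (isT : 1 < 2)%N).
have h3 := size_binary lN.
apply: leq_trans (_ : (n + 2) * (M + 6) <= _)%N.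
  move: (size (binary n)) (size (binary i)) (size (binary l)) h1 h2 h3 => a b c.
  by rewrite /nbits; nia.
rewrite (_ : M + 7 = (M + 6).+1)%N; last by rewrite addnS.
rewrite expnS leq_mul2l; apply/orP; right.
apply: leq_trans (_ : 2 ^ (M + 6) <= _)%N; first exact/ltnW/ltn_expl.
by rewrite leq_exp2r ?leq_addl // addnS.
Qed.

(** By [cellE_Rcol] the array prescribed by the permutation is constant on the
    cells, which gives its existence; the index of its value is [find_digit]. *)
Theorem theorem3 (R : realType) (M : nat) (O : R -> R)
    (o : 'I_(nout M) -> R) (vsig : 'I_(nout M) -> M.+1.-tuple bool)
    (hO : outcomes O o vsig) :
  (exists Rs : nat -> nat -> R -> R, corresponds M O (Fperm O o) Rs) /\
  (forall Rs : nat -> nat -> R -> R, corresponds M O (Fperm O o) Rs ->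
     ptime_array o (tau1 o) Rs).
Proof.
have [decode vsigK decodeK] := vsig_bijective hO.
have Fp n l (n0 : (0 < n)%N) (lN : (l < 2 ^ nbits M n)%N) := FpermP hO vsigK decodeK n0 lN.
split.
  pose P (n i : nat) (x : R) : set R := [set v | exists l y, [/\ (l < 2 ^ nbits M n)%N, cellD
      M n l x,
    cellE M n (Fperm O o n l) y & v = Rcol M O i y]]%classic.
  exists (fun n i x => xget 0 (P n i x)) => n n0; split.
    exact: (Fperm_admissible hO vsigK decodeK).
  move=> i l iN lN x y xl yl; apply: xget_unique; first by exists l, y.
  move=> _ [l' [y' [l'N xl' yl' ->]]].
  have ll : l' = l.
    by have [_ <-] := (dcellP x l'N).1 xl'; have [_ <-] := (dcellP x lN).1 xl.
  rewrite ll in yl'; have [bN _ _] := Fp n l n0 lN.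
  by rewrite (cellE_Rcol hO decodeK bN iN yl') (cellE_Rcol hO decodeK bN iN yl).
move=> Rs cRs.
pose m := nout M; pose tbl := [seq (digit_outcome decode d).+1 | d <- iota 0 m].
pose g n i l := find_digit (fun a => `[< tau1 o a >]) m M.+1 m.+2 (order decode) tbl n i l.
exists (fun s => g (nth 0%N s 0) (nth 0%N s 1) (nth 0%N s 2)).
  move=> n i l [n' [i' [l' [[-> -> ->] n0 iN lN]]]].
  have [bN _ _] := Fp n' l' n0 lN.
  exists (word_outcome decode n' (Fperm O o n' l') i').
    exact: (find_digit_Fperm hO vsigK decodeK).
  move=> x xl; have [y yl] := cellE_exists R bN.
  have [_ H] := cRs n' n0; rewrite (H i' l' iN lN x y xl yl).
  exact: (cellE_Rcol hO decodeK bN iN yl).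
apply: (definable_ptime (d := (M + 7)%N) _ (definable_find_digit _ _ _ _ _ _)).
move=> s sargs; have := array_args_size _ _ sargs.
by case: sargs => n [i [l [-> n0 iN lN]]] sz; exists n, i, l; split.
Qed.
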